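(* Let $\psi \in L^1(\mathbb{T})$ and let $P_+\psi$ denote its Riesz projection. Then \[\exp\left(\int_0^{2\pi} \log|P_+ \psi(e^{i\theta})|\,\frac{d\theta}{2\pi}\right) \leq \|\psi\|_{L^1(\mathbb{T})}.\] Moreover, for a nontrivial $\psi \in L^1(\mathbb{T})$, equality holds if and only if $\overline{I}\,\psi \geq 0$ almost everywhere on $\mathbb{T}$, where $I$ denotes the inner factor of $P_+\psi$.
   Context: $\mathbb{T}$ is the unit circle with normalized arc length measure $d\theta/2\pi$. For $0<p<\infty$, $H^p$ is the Hardy space of analytic functions $\varphi$ on the unit disc with $\sup_{0<r<1}\int_0^{2\pi}|\varphi(re^{i\theta})|^p\,\frac{d\theta}{2\pi}<\infty$, identified with its boundary values on $\mathbb{T}$. The Riesz projection of $\psi\in L^1(\mathbb{T})$ is $P_+\psi(e^{i\theta})=\sum_{n\ge 0}\widehat{\psi}(n)e^{in\theta}$; for $\psi\in L^1$, $P_+\psi$ belongs to $H^p$ for every $0<p<1$ and thus (when nontrivial) has a canonical inner-outer factorization $P_+\psi = I\Phi$ with $I$ inner and $\Phi$ outer. *)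

(* Defs.v *)
(* Complex numbers are R[i] (mathcomp-real-closed),
   for R : realType; the unit circle T is parametrised by t in [0, 2pi]
   with normalized measure dt/(2pi). *)
From HB Require Import structures.
From mathcomp Require Import all_boot all_order all_algebra.
From mathcomp Require Import all_classical all_reals all_analysis.
From mathcomp Require Import complex.
Set Implicit Arguments. Unset Strict Implicit. Unset Printing Implicit Defensive.
Import Order.TTheory GRing.Theory Num.Theory.
Import numFieldNormedType.Exports.
Local Open Scope classical_set_scope.
Local Open Scope ring_scope.
Local Open Scope complex_scope.

Section Hardy.
Variable R : realType.
Local Notation C := R[i].
Local Notation mu := (@lebesgue_measure R).

Definition Tdom : set R := `[0, 2 * pi]%classic.

Definition expi (t : R) : C := cos t +i* sin t.

Definition expC (w : C) : C :=
  (expR (complex.Re w) * cos (complex.Im w)) +i* (expR (complex.Re w) * sin (complex.Im w)).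

Definition L1T (psi : R -> C) : Prop :=
  mu.-integrable Tdom (fun t => (complex.Re (psi t))%:E) /\
  mu.-integrable Tdom (fun t => (complex.Im (psi t))%:E).

Definition cavg (f : R -> C) : C :=
  ((2 * pi)^-1)%:C *
  ((Rintegral mu Tdom (fun t => complex.Re (f t))) +i* (Rintegral mu Tdom (fun t => complex.Im (f t)))).

Definition L1norm (psi : R -> C) : R :=
  (2 * pi)^-1 * Rintegral mu Tdom (fun t => Normc.normc (psi t)).

Definition fourier (psi : R -> C) (n : int) : C :=
  cavg (fun t => psi t * expi (- (n%:~R * t))).

Definition disc : set C := [set z | Normc.normc z < 1].

(* Riesz projection P_+ psi, as an analytic function on the disc:
   P_+ psi (z) = sum_{n >= 0} \hat psi(n) z^n  (|z| < 1) *)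
Definition Pplus (psi : R -> C) (z : C) : C :=
  limn (fun N : nat => (\sum_(0 <= n < N) fourier psi n%:Z * z ^+ n : C^o)).

Definition bval (F : C -> C) (t : R) : C :=
  lim ((fun r : R => (F (r%:C * expi t) : C^o)) @ at_left 1).

Definition radial_limit (F : C -> C) (t : R) (w : C) : Prop :=
  (fun r : R => (F (r%:C * expi t) : C^o)) @ at_left 1 --> (w : C^o).

Definition logabs (z : C) : \bar R :=
  if z == 0 then -oo%E else (ln (Normc.normc z))%:E.

Definition holo_disc (F : C -> C) : Prop :=
  forall z : C, disc z -> derivable (F : C^o -> C^o) z 1.

Definition inner (I : C -> C) : Prop :=
  holo_disc I /\
  (exists M : R, forall z, disc z -> Normc.normc (I z) <= M) /\
  {ae mu, forall t, Tdom t -> exists w : C, Normc.normc w = 1 /\ radial_limit I t w}.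

Definition outer (Phi : C -> C) : Prop :=
  exists (c : C) (k : R -> R),
    Normc.normc c = 1 /\ (forall t, 0 < k t) /\
    mu.-integrable Tdom (fun t => (ln (k t))%:E) /\
    forall z, disc z ->
      Phi z = c * expC (cavg (fun t => (expi t + z) / (expi t - z) * (ln (k t))%:C)).

End Hardy.

(* Main.v *)
(* Let F be the Riesz projection of psi, F = J Phi with Phi = c exp(Hz l) outer and J
   bounded.  If F were in H^1, one would have avg(psi conj(J)) = avg(F conj(J)) =
   avg(|J|^2 Phi) = Phi(0) when |J| = 1 on the circle, whence
   exp(avg l) = |Phi(0)| <= avg |psi|, with equality iff psi conj(J) >= 0 almost everywhere.
   As F is in general only in H^p for p < 1, the pairing is tested against J h_n, where
   |h_n| <= 1, h_n -> 1, F h_n is bounded and avg(|Im h_n| (1 + |F|)) -> 0: both sides then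
   make sense, and the error comes only from the imaginary part of h_n.  Such h_n are
   products of N / (N + W_j), where F is a combination of the four Herglotz transforms W_j
   of the positive and negative parts of Re psi and Im psi.
   For the inequality no inner-outer factorization is needed: with l = log max(|F|, e) the
   quotient J = F / exp(Hz l) is bounded by 1 and (1 - |J|^2) exp l <= e, so the argument
   applies up to an error e. *)

(* Conjugation is the obstacle. Pairing [psi] with [J h_n] puts the conjugate of [h_n] on the side
   of [F], whereas the mean value property needs the analytic product [h_n Phi]. Where [|J| = 1] the
   two integrands differ by [2 |Im h_n| |Phi|] in modulus, and [Phi] need not be integrable. For one
   transform [W] of a density [f >= 0] and [h = N / (N + W)], put [x = |Im W| |h| / N]. On the
   circle [|Im h| = x |h|] and [|h W| <= f + N x], so [|Im h| |W|] is at most [f x + N x^2]. The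
   first term is harmless by dominated convergence. For the second, [Re (W h)] is exactly [N x^2]
   plus a part lying between [0] and [f]. Its average is [Re (W h)] at the origin, which tends to
   [avg f], and the dominated part alone has averages tending to [avg f]; hence [avg (N x^2)] tends
   to [0]. With several transforms the cross terms [N x_j x_l] are absorbed by
   [N (x_j^2 + x_l^2) / 2]. *)
Require Import Defs.
From HB Require Import structures.
From mathcomp Require Import all_boot all_order all_algebra.
From mathcomp Require Import all_classical all_reals all_analysis.
From mathcomp Require Import measurable_realfun complex ring lra.
Set Implicit Arguments. Unset Strict Implicit. Unset Printing Implicit Defensive.
Import Order.TTheory GRing.Theory Num.Theory.
Import numFieldNormedType.Exports.
Local Open Scope classical_set_scope.
Local Open Scope ring_scope.
Local Open Scope complex_scope.

(** * Averages and complex limits *)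

Section RealAverage.
Variable R : realType.
Local Notation mu := (@lebesgue_measure R).
Local Notation T := (@Tdom R).

Definition aeT (P : R -> Prop) : Prop := {ae mu, forall t, T t -> P t}.

Lemma aeTW (P : R -> Prop) : (forall t, T t -> P t) -> aeT P.
Proof. by move=> h; apply: aeW. Qed.

Lemma aeTS (P Q : R -> Prop) : (forall t, T t -> P t -> Q t) -> aeT P -> aeT Q.
Proof.
by move=> h; rewrite /aeT; apply: (@filterS _ _ (ae_filter_ringOfSetsType mu)) => t Pt Tt; apply: h => //; exact: Pt.
Qed.

Lemma aeTS2 (P Q S : R -> Prop) : (forall t, T t -> P t -> Q t -> S t) ->
  aeT P -> aeT Q -> aeT S.
Proof.
move=> h; rewrite /aeT; apply: (@filterS2 _ _ (ae_filter_ringOfSetsType mu)) => t Pt Qt Tt.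
by apply: h => //; [exact: Pt|exact: Qt].
Qed.

Lemma aeTS3 (P Q S U : R -> Prop) : (forall t, T t -> P t -> Q t -> S t -> U t) ->
  aeT P -> aeT Q -> aeT S -> aeT U.
Proof.
move=> h Pt Qt; apply: aeTS2 (aeTS2 (fun t Tt => @conj (P t) (Q t)) Pt Qt) => t Tt [].
by move=> Pt' Qt'; exact: h.
Qed.

Lemma aeT_forall (P : nat -> R -> Prop) :
  (forall n, aeT (P n)) -> aeT (fun t => forall n, P n t).
Proof.
move=> h; have := ae_foralln h; rewrite /aeT; apply: (@filterS _ _ (ae_filter_ringOfSetsType mu)) => t Pt Tt n.
exact: Pt.
Qed.

Implicit Types (f g h : R -> R) (c M : R).

Definition intT f : Prop := mu.-integrable T (EFin \o f).

Definition avg f : R := (2 * pi)^-1 * Rintegral mu T f.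

Lemma twopi_gt0 : 0 < 2 * pi :> R. Proof. by rewrite mulr_gt0// pi_gt0. Qed.

Lemma measurable_Tdom : measurable T. Proof. exact: measurable_itv. Qed.

Local Hint Resolve measurable_Tdom : core.

Lemma mu_Tdom : mu T = (2 * pi)%:E.
Proof. by rewrite lebesgue_measure_itv /= lte_fin twopi_gt0 oppr0 adde0. Qed.

Lemma intT_measurable f : intT f -> measurable_fun T f.
Proof. by move=> /measurable_int/measurable_EFinP. Qed.

Lemma intTD f g : intT f -> intT g -> intT (fun t => f t + g t).
Proof. by move=> fi gi; apply: eq_integrable (integrableD _ fi gi). Qed.

Lemma intTN f : intT f -> intT (fun t => - f t).
Proof. by move=> fi; apply: eq_integrable (integrableN fi). Qed.

Lemma intTB f g : intT f -> intT g -> intT (fun t => f t - g t).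
Proof. by move=> fi gi; apply: intTD => //; exact: intTN. Qed.

Lemma intTZ c f : intT f -> intT (fun t => c * f t).
Proof. by move=> fi; apply: eq_integrable (integrableZl _ c fi). Qed.

Lemma intT_norm f : intT f -> intT (fun t => `|f t|).
Proof. by move=> fi; apply: eq_integrable (integrable_norm fi). Qed.

Lemma intT_le_ae f g : measurable_fun T f -> intT g ->
  aeT (fun t => `|f t| <= g t) -> intT f.
Proof.
move=> mf gi fg; have mg := intT_measurable gi.
apply/integrableP; split; first exact/measurable_EFinP.
have /integrableP[_] := intT_norm gi; apply: le_lt_trans.
apply: ae_ge0_le_integral => //=.
- by do 2 apply: measurableT_comp => //.
- by do 3 apply: measurableT_comp => //.
- move: fg; apply: aeTS => t Tt h; rewrite lee_fin normr_id.
  by rewrite (le_trans h)// ler_norm.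
Qed.

Lemma intT_le f g : measurable_fun T f -> intT g ->
  (forall t, T t -> `|f t| <= g t) -> intT f.
Proof. by move=> mf gi fg; apply: (intT_le_ae mf gi); exact: aeTW. Qed.

Lemma intT_cst c : intT (fun=> c).
Proof.
apply: measurable_bounded_integrable => //=.
  by rewrite mu_Tdom ltry.
by exists `|c|; split; rewrite ?num_real// => x cx t _; exact: ltW.
Qed.

Lemma intT_bounded_ae M f : measurable_fun T f -> aeT (fun t => `|f t| <= M) -> intT f.
Proof. by move=> mf fM; apply: (intT_le_ae mf (intT_cst M)). Qed.

Lemma intT_bounded M f : measurable_fun T f -> (forall t, T t -> `|f t| <= M) -> intT f.
Proof. by move=> mf fM; apply: (intT_le mf (intT_cst M)). Qed.

Lemma intTM_bounded_ae M f g : intT f -> measurable_fun T g ->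
  aeT (fun t => `|g t| <= M) -> intT (fun t => f t * g t).
Proof.
move=> fi mg gM; apply: (@intT_le_ae _ (fun t => M * `|f t|)).
- by apply: measurable_funM => //; exact: intT_measurable.
- exact/intTZ/intT_norm.
- move: gM; apply: aeTS => t Tt h; by rewrite normrM mulrC ler_wpM2r.
Qed.

Lemma intTM_bounded M f g : intT f -> measurable_fun T g ->
  (forall t, T t -> `|g t| <= M) -> intT (fun t => f t * g t).
Proof. by move=> fi mg gM; apply: (intTM_bounded_ae fi mg); apply: aeTW; exact: gM. Qed.

Lemma avgD f g : intT f -> intT g -> avg (fun t => f t + g t) = avg f + avg g.
Proof. by move=> fi gi; rewrite /avg RintegralD// mulrDr. Qed.

Lemma avgB f g : intT f -> intT g -> avg (fun t => f t - g t) = avg f - avg g.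
Proof. by move=> fi gi; rewrite /avg RintegralB// mulrBr. Qed.

Lemma avgZ c f : intT f -> avg (fun t => c * f t) = c * avg f.
Proof. by move=> fi; rewrite /avg RintegralZl// mulrCA. Qed.

Lemma avgN f : intT f -> avg (fun t => - f t) = - avg f.
Proof.
move=> fi; rewrite -mulN1r -avgZ//; congr avg.
by apply/funext => t; rewrite mulN1r.
Qed.

Lemma avg_cst c : avg (fun=> c) = c.
Proof.
rewrite /avg Rintegral_cst// (_ : fine _ = 2 * pi); last exact: (congr1 fine mu_Tdom).
by rewrite mulrCA mulVf ?mulr1// gt_eqF// twopi_gt0.
Qed.

Lemma eq_avg f g : (forall t, T t -> f t = g t) -> avg f = avg g.
Proof. by move=> fg; congr (_ * _); apply: eq_Rintegral => t /set_mem; exact: fg. Qed.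

Lemma ae_eq_avg f g : measurable_fun T f -> measurable_fun T g ->
  aeT (fun t => f t = g t) -> avg f = avg g.
Proof.
move=> mf mg fg; congr (_ * fine _); apply: ae_eq_integral => //.
- exact/measurable_EFinP.
- exact/measurable_EFinP.
- by move: fg; apply: aeTS => t Tt h; rewrite h.
Qed.

Lemma avg_ge0 f : (forall t, T t -> 0 <= f t) -> 0 <= avg f.
Proof. by move=> f0; rewrite mulr_ge0 ?Rintegral_ge0// invr_ge0 ltW// twopi_gt0. Qed.

Lemma avg_ge0_ae f : measurable_fun T f -> aeT (fun t => 0 <= f t) -> 0 <= avg f.
Proof.
move=> mf f0; rewrite (@ae_eq_avg _ (fun t => `|f t|))//.
- by apply: avg_ge0.
- by apply: measurableT_comp.
- by move: f0; apply: aeTS => t Tt h; rewrite ger0_norm// h.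
Qed.

Lemma le_avg_ae f g : intT f -> intT g -> aeT (fun t => f t <= g t) -> avg f <= avg g.
Proof.
move=> fi gi fg; rewrite -subr_ge0 -avgB//; apply: avg_ge0_ae.
  by apply: intT_measurable; exact: intTB.
by move: fg; apply: aeTS => t Tt h; rewrite subr_ge0 h.
Qed.

Lemma le_avg f g : intT f -> intT g -> (forall t, T t -> f t <= g t) -> avg f <= avg g.
Proof. by move=> fi gi fg; apply: le_avg_ae => //; exact: aeTW. Qed.

Lemma avg_le_norm f : intT f -> `|avg f| <= avg (fun t => `|f t|).
Proof.
move=> fi; rewrite ler_norml -avgN; last exact: intT_norm.
apply/andP; split; apply: le_avg => //; try exact: intT_norm.
- exact/intTN/intT_norm.
- by move=> t _; rewrite lerNl -normrN ler_norm.
- by move=> t _; rewrite ler_norm.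
Qed.

Lemma avgE_ereal f : intT f ->
  (((2 * pi)^-1)%:E * \int[mu]_(t in T) (f t)%:E)%E = (avg f)%:E.
Proof. by move=> fi; rewrite EFinM fineK//; exact: integrable_fin_num. Qed.

Lemma avg_dct (f_ : nat -> R -> R) f g :
  (forall n, measurable_fun T (f_ n)) -> measurable_fun T f -> intT g ->
  aeT (fun t => f_ n t @[n --> \oo] --> f t) ->
  (forall n, aeT (fun t => `|f_ n t| <= g t)) ->
  avg (f_ n) @[n --> \oo] --> avg f.
Proof.
move=> mf_ mf gi f_f f_g.
have [] := @dominated_convergence _ _ _ mu T measurable_Tdom (fun n => EFin \o f_ n)
   (EFin \o f) (EFin \o g).
- by move=> n; apply/measurable_EFinP; exact: mf_.
- exact/measurable_EFinP.
- move: f_f; apply: aeTS => t Tt h; apply: cvg_EFin => //; exact: nearW.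
- exact: gi.
- have := aeT_forall f_g; rewrite /aeT; apply: (@filterS _ _ (ae_filter_ringOfSetsType mu)) => t h n Tt.
  by rewrite lee_fin; exact: h.
move=> fi _ h; apply: cvgMr => //; apply: fine_cvg; rewrite fineK; first exact: h.
exact: integrable_fin_num.
Qed.

Lemma avg_eq0_ae f : intT f -> aeT (fun t => 0 <= f t) -> avg f = 0 ->
  aeT (fun t => f t = 0).
Proof.
move=> fi f0 af.
have mf := intT_measurable fi.
have : (\int[mu]_(t in T) `|(f t)%:E|)%E = 0%E.
  have fn : avg (fun t => `|f t|) = 0.
    rewrite -af; apply: ae_eq_avg => //; first by apply: measurableT_comp.
    by move: f0; apply: aeTS => t Tt h; rewrite ger0_norm.
  have /eqP := avgE_ereal (intT_norm fi); rewrite fn mule_eq0 => /orP[|/eqP//].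
  by rewrite eqe invr_eq0 gt_eqF// twopi_gt0.
move/ae_eq_integral_abs => /(_ measurable_Tdom) h.
have := h ((measurable_EFinP _ _).2 mf); apply: aeTS => t Tt /=.
by case.
Qed.

End RealAverage.

(** Real-valued modulus: [|z|] in [R[i]] is itself complex, out of reach of [lra] and of the limit
    lemmas for real functions. *)
Definition nc (R : realType) (z : R[i]) : R := Normc.normc z.

(** * Complex modulus and convergence *)

Section Complex.
Variable R : realType.
Local Notation C := R[i].
Local Notation "z ^*" := (conjc z) : ring_scope.
Local Notation Re := (@complex.Re R).
Local Notation Im := (@complex.Im R).
Implicit Types (x y z w : C) (a b c r s t : R).

Lemma ReD x y : Re (x + y) = Re x + Re y. Proof. by case: x; case: y. Qed.
Lemma ImD x y : Im (x + y) = Im x + Im y. Proof. by case: x; case: y. Qed.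
Lemma ReN x : Re (- x) = - Re x. Proof. by case: x. Qed.
Lemma ImN x : Im (- x) = - Im x. Proof. by case: x. Qed.
Lemma ReB x y : Re (x - y) = Re x - Re y. Proof. by case: x; case: y. Qed.
Lemma ImB x y : Im (x - y) = Im x - Im y. Proof. by case: x; case: y. Qed.
Lemma ReM x y : Re (x * y) = Re x * Re y - Im x * Im y. Proof. by case: x; case: y. Qed.
Lemma ImM x y : Im (x * y) = Re x * Im y + Im x * Re y. Proof. by case: x; case: y. Qed.
Lemma ReJ x : Re x^* = Re x. Proof. by case: x. Qed.
Lemma ImJ x : Im x^* = - Im x. Proof. by case: x. Qed.
Lemma Re_realM a x : Re (a%:C * x) = a * Re x.
Proof. by rewrite ReM /= mul0r subr0. Qed.
Lemma Im_realM a x : Im (a%:C * x) = a * Im x.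
Proof. by rewrite ImM /= mul0r addr0. Qed.

Lemma complex_eqP x y : Re x = Re y -> Im x = Im y -> x = y.
Proof. by case: x => a b; case: y => c d /= -> ->. Qed.

Lemma ncE z : nc z = Num.sqrt (Re z ^+ 2 + Im z ^+ 2). Proof. by case: z. Qed.
Lemma nc_ge0 z : 0 <= nc z. Proof. by rewrite ncE sqrtr_ge0. Qed.
Lemma nc_sqr z : nc z ^+ 2 = Re z ^+ 2 + Im z ^+ 2.
Proof. by rewrite ncE sqr_sqrtr// addr_ge0// sqr_ge0. Qed.
Lemma normCE z : `|z| = (nc z)%:C. Proof. by rewrite normc_def ncE. Qed.
Lemma nc_eq0 z : (nc z == 0) = (z == 0).
Proof.
apply/eqP/eqP => [/Normc.eq0_normc//|->]; exact: Normc.normc0.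
Qed.
Lemma nc_gt0 z : (0 < nc z) = (z != 0).
Proof. by rewrite lt_neqAle nc_ge0 andbT eq_sym nc_eq0. Qed.
Lemma nc0 : nc (0 : C) = 0. Proof. exact: Normc.normc0. Qed.
Lemma nc1 : nc (1 : C) = 1. Proof. exact: Normc.normc1. Qed.
Lemma ncM x y : nc (x * y) = nc x * nc y. Proof. exact: Normc.normcM. Qed.
Lemma ncV x : nc x^-1 = (nc x)^-1. Proof. exact: Normc.normcV. Qed.
Lemma ncN x : nc (- x) = nc x. Proof. exact: normcN. Qed.
Lemma ncX x n : nc (x ^+ n) = nc x ^+ n.
Proof. by elim: n => [|n ih]; rewrite ?expr0 ?nc1// !exprS ncM ih. Qed.
Lemma ncJ x : nc x^* = nc x.
Proof. by rewrite !ncE ReJ ImJ sqrrN. Qed.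
Lemma nc_real a : nc a%:C = `|a|.
Proof. by rewrite ncE /= expr0n addr0 sqrtr_sqr. Qed.
Lemma ncD_le x y : nc (x + y) <= nc x + nc y. Proof. exact: le_normcD. Qed.
Lemma ncB_le x y : nc (x - y) <= nc x + nc y.
Proof. by rewrite -(ncN y) ncD_le. Qed.
Lemma nc_distC x y : nc (x - y) = nc (y - x).
Proof. by rewrite -ncN opprB. Qed.
Lemma nc_dist_tri z x y : nc (x - y) <= nc (x - z) + nc (z - y).
Proof. by apply: le_trans (ncD_le _ _); rewrite subrKA. Qed.
Lemma nc_sub_le x y : nc x - nc y <= nc (x - y).
Proof. by rewrite lerBlDr; apply: le_trans (ncD_le _ _); rewrite subrK. Qed.
Lemma nc_dist_dist x y : `|nc x - nc y| <= nc (x - y).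
Proof. by rewrite ler_norml nc_sub_le andbT lerNl opprB nc_distC nc_sub_le. Qed.
Lemma nc_sum_le I (r : seq I) (P : pred I) (F : I -> C) :
  nc (\sum_(i <- r | P i) F i) <= \sum_(i <- r | P i) nc (F i).
Proof.
elim/big_rec2 : _ => [|i a z _ h]; first by rewrite nc0.
by rewrite (le_trans (ncD_le _ _))// lerD2l.
Qed.
Lemma normr_Re_le z : `|Re z| <= nc z.
Proof. by rewrite -sqrtr_sqr ncE ler_wsqrtr// lerDl sqr_ge0. Qed.
Lemma normr_Im_le z : `|Im z| <= nc z.
Proof. by rewrite -sqrtr_sqr ncE ler_wsqrtr// lerDr sqr_ge0. Qed.
Lemma nc_le_ReIm z : nc z <= `|Re z| + `|Im z|.
Proof.
rewrite -ler_sqr ?nnegrE ?nc_ge0 ?addr_ge0// nc_sqr sqrrD !real_normK ?num_real//.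
by rewrite -addrA lerD2l lerDr mulrn_wge0// mulr_ge0.
Qed.
Lemma mulJ_nc z : z^* * z = (nc z ^+ 2)%:C.
Proof. by apply: complex_eqP; rewrite ?ReM ?ImM ReJ ImJ /= ?nc_sqr; ring. Qed.
Lemma realCD a b : (a + b)%:C = a%:C + b%:C :> C.
Proof. by rewrite rmorphD. Qed.
Lemma realCM a b : (a * b)%:C = a%:C * b%:C :> C.
Proof. by rewrite rmorphM. Qed.
Lemma invc_nc z : z^-1 = (nc z ^- 2)%:C * z^*.
Proof.
have [->|z0] := eqVneq z 0; first by rewrite nc0 expr0n /= !invr0 mul0r.
apply: (mulfI z0); rewrite mulfV// mulrCA [z * _]mulrC mulJ_nc -realCM mulVf//.
by rewrite expf_neq0// nc_eq0.
Qed.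

(** Convergence in [C] through a real null function, so that limit laws reduce to real ones; [ccvgP]
    is the link with the topology of [C^o] used by [radial_limit]. *)
Definition ccvg I (F : set_system I) (u : I -> C) (l : C) : Prop :=
  nc (u x - l) @[x --> F] --> (0 : R).

Section ccvg.
Context {I : Type} {F : set_system I} {FF : Filter F}.
Implicit Types (u v : I -> C) (l k : C).

Lemma squeeze0 (f g : I -> R) : (\forall x \near F, 0 <= f x <= g x) ->
  g x @[x --> F] --> (0 : R) -> f x @[x --> F] --> (0 : R).
Proof. by move=> fg g0; apply: (squeeze_cvgr fg) => //; exact: cvg_cst. Qed.

Lemma ccvg_ReIm u l : ccvg F u l <->
  Re (u x) @[x --> F] --> Re l /\ Im (u x) @[x --> F] --> Im l.
Proof.
split=> [h|[/subr_cvg0 hr /subr_cvg0 hi]].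
  split; apply/subr_cvg0; apply/norm_cvg0P; apply: squeeze0 h; apply: nearW => x.
    by rewrite -ReB normr_ge0 normr_Re_le.
  by rewrite -ImB normr_ge0 normr_Im_le.
apply: (@squeeze0 _ (fun i => `|Re (u i) - Re l| + `|Im (u i) - Im l|)).
  by apply: nearW => x; rewrite nc_ge0 -ReB -ImB nc_le_ReIm.
rewrite -(addr0 (0 : R)); apply: cvgD; exact/norm_cvg0P.
Qed.

Lemma ccvg_cst l : ccvg F (fun=> l) l.
Proof. by rewrite /ccvg subrr nc0; exact: cvg_cst. Qed.

Lemma ccvgD u v l k : ccvg F u l -> ccvg F v k -> ccvg F (fun i => u i + v i) (l + k).
Proof.
move=> /ccvg_ReIm[a b] /ccvg_ReIm[c d]; apply/ccvg_ReIm; rewrite ReD ImD; split.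
  under eq_fun do rewrite ReD; exact: cvgD.
under eq_fun do rewrite ImD; exact: cvgD.
Qed.

Lemma ccvgN u l : ccvg F u l -> ccvg F (fun i => - u i) (- l).
Proof. by rewrite /ccvg => h; under eq_fun do rewrite -opprD ncN. Qed.

Lemma ccvgB u v l k : ccvg F u l -> ccvg F v k -> ccvg F (fun i => u i - v i) (l - k).
Proof. by move=> hu /ccvgN; exact: ccvgD. Qed.

Lemma ccvgM u v l k : ccvg F u l -> ccvg F v k -> ccvg F (fun i => u i * v i) (l * k).
Proof.
move=> /ccvg_ReIm[a b] /ccvg_ReIm[c d]; apply/ccvg_ReIm; rewrite ReM ImM; split.
  under eq_fun do rewrite ReM; apply: cvgB; exact: cvgM.
under eq_fun do rewrite ImM; apply: cvgD; exact: cvgM.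
Qed.

Lemma ccvgJ u l : ccvg F u l -> ccvg F (fun i => (u i)^*) l^*.
Proof. by rewrite /ccvg => h; under eq_fun do rewrite -rmorphB ncJ. Qed.

Lemma ccvg_real (f : I -> R) a : f x @[x --> F] --> a -> ccvg F (fun i => (f i)%:C) a%:C.
Proof. by move=> h; apply/ccvg_ReIm; split => //=; exact: cvg_cst. Qed.

Lemma ccvg_norm u l : ccvg F u l -> nc (u x) @[x --> F] --> nc l.
Proof.
move=> h; apply/subr_cvg0; apply/norm_cvg0P; apply: squeeze0 h.
by apply: nearW => x; rewrite normr_ge0 nc_dist_dist.
Qed.

Lemma ccvgV u l : l != 0 -> ccvg F u l -> ccvg F (fun i => (u i)^-1) l^-1.
Proof.
move=> l0 h; rewrite invc_nc /ccvg; under eq_fun do rewrite invc_nc.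
apply: ccvgM (ccvgJ h); apply: ccvg_real.
apply: cvgV; first by rewrite expf_neq0// nc_eq0.
by under eq_fun do rewrite expr2; rewrite expr2; apply: cvgM; exact: ccvg_norm.
Qed.

Lemma ccvg_prod J (s : seq J) (P : pred J) (u : J -> I -> C) (l : J -> C) :
  (forall j, P j -> ccvg F (u j) (l j)) ->
  ccvg F (fun i => \prod_(j <- s | P j) u j i) (\prod_(j <- s | P j) l j).
Proof.
move=> h; elim: s => [|j s ih].
  by rewrite /ccvg; under eq_fun do rewrite !big_nil; exact: ccvg_cst.
rewrite /ccvg; under eq_fun do rewrite !big_cons.
by case: ifP => // Pj; apply: ccvgM => //; exact: h.
Qed.

Lemma ccvg_sum J (s : seq J) (P : pred J) (u : J -> I -> C) (l : J -> C) :
  (forall j, P j -> ccvg F (u j) (l j)) ->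
  ccvg F (fun i => \sum_(j <- s | P j) u j i) (\sum_(j <- s | P j) l j).
Proof.
move=> h; elim: s => [|j s ih].
  by rewrite /ccvg; under eq_fun do rewrite !big_nil; exact: ccvg_cst.
rewrite /ccvg; under eq_fun do rewrite !big_cons.
by case: ifP => // Pj; apply: ccvgD => //; exact: h.
Qed.

Lemma ccvg_expC u l : ccvg F u l -> ccvg F (fun i => expC (u i)) (expC l).
Proof.
move=> /ccvg_ReIm[a b]; apply/ccvg_ReIm; split => /=; apply: cvgM.
- by apply: continuous_cvg a; exact: continuous_expR.
- by apply: continuous_cvg b; exact: continuous_cos.
- by apply: continuous_cvg a; exact: continuous_expR.
- by apply: continuous_cvg b; exact: continuous_sin.
Qed.

Lemma ccvg_near_eq u v l : (\forall x \near F, u x = v x) -> ccvg F u l -> ccvg F v l.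
Proof.
move=> uv; apply: cvg_trans; apply: near_eq_cvg.
by apply: filterS uv => x ->.
Qed.

Lemma ccvgP u l : ccvg F u l <-> (u x : C^o) @[x --> F] --> (l : C^o).
Proof.
split=> [h|h].
  apply/cvgrPdist_lt => -[e e']; rewrite ltcE /= => /andP[/eqP -> e0].
  near=> x; have : `|nc (u x - l)| < e by near: x; exact: cvgr0_norm_lt.
  rewrite ger0_norm ?nc_ge0// => hx.
  by rewrite normCE nc_distC ltcE /= eqxx.
rewrite /ccvg; apply/cvgrPdist_lt => e e0; have e0' : (0 : C^o) < e%:C by rewrite ltcE /= eqxx.
move/cvgrPdist_lt : h => /(_ _ e0'); apply: filterS => x.
rewrite normCE nc_distC ltcE /= => /andP[_ h].
by rewrite sub0r normrN ger0_norm// nc_ge0.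
Unshelve. all: by end_near. Qed.

Lemma ccvg_epsP u l : ccvg F u l <->
  forall e : R, 0 < e -> \forall i \near F, nc (u i - l) <= e.
Proof.
split=> h.
  move=> e e0; near=> i; rewrite -[leLHS]ger0_norm ?nc_ge0//.
  by near: i; exact: (@cvgr0_norm_le _ _ _ _ _ _ h _ e0).
apply/cvgr0Pnorm_le => e e0; near=> i; rewrite ger0_norm ?nc_ge0//.
by near: i; exact: h.
Unshelve. all: by end_near. Qed.

End ccvg.

Lemma ccvg_unique I (F : set_system I) {FF : ProperFilter F} (u : I -> C) l k :
  ccvg F u l -> ccvg F u k -> l = k.
Proof.
move=> /ccvg_ReIm[a b] /ccvg_ReIm[c d]; apply: complex_eqP.
  exact: (cvg_unique _ a c).
exact: (cvg_unique _ b d).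
Qed.

Lemma ccvg_comp I J (F : set_system I) (G : set_system J) (f : I -> J) (u : J -> C) l :
  f x @[x --> F] --> G -> ccvg G u l -> ccvg F (fun i => u (f i)) l.
Proof. by move=> fg h; exact: (cvg_comp f (fun j => nc (u j - l)) fg h). Qed.

Lemma radial_limitP (G : C -> C) t w :
  radial_limit G t w <-> ccvg (at_left 1) (fun r => G (r%:C * expi t)) w.
Proof. by rewrite /radial_limit; split => /ccvgP. Qed.

Lemma bval_radial_limit (G : C -> C) t w : radial_limit G t w -> bval G t = w.
Proof. move=> h; rewrite /bval; apply: (@cvg_lim C^o); [exact: norm_hausdorff|exact: h]. Qed.

End Complex.

(** * Complex averages over the circle and orthogonality of exponentials *)

Section CircleIntegral.
Variable R : realType.
Local Notation C := R[i].
Local Notation "z ^*" := (conjc z) : ring_scope.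
Local Notation Re := (@complex.Re R).
Local Notation Im := (@complex.Im R).
Local Notation T := (@Tdom R).
Local Notation mu := (@lebesgue_measure R).
Implicit Types (u v : R -> C) (a b c : R).

Local Hint Resolve measurable_Tdom : core.

Lemma expiD a b : expi (a + b) = expi a * expi b.
Proof. by apply: complex_eqP; rewrite ?ReM ?ImM /= ?cosD ?sinD; ring. Qed.
Lemma expiN a : expi (- a) = (expi a)^*.
Proof. by apply: complex_eqP; rewrite ?ReJ ?ImJ /= ?cosN ?sinN. Qed.
Lemma expi0 : expi 0 = 1 :> C.
Proof. by apply: complex_eqP; rewrite /= ?cos0 ?sin0. Qed.
Lemma nc_expi a : nc (expi a) = 1.
Proof. by rewrite ncE /= cos2Dsin2 sqrtr1. Qed.
Lemma expi_neq0 a : expi a != 0.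
Proof. by rewrite -nc_eq0 nc_expi oner_eq0. Qed.
Lemma expi_natmul n a : expi (n%:R * a) = expi a ^+ n.
Proof.
elim: n => [|n ih]; first by rewrite mul0r expi0 expr0.
by rewrite exprS -ih -expiD -addn1 natrD mulrDl mul1r addrC.
Qed.
Lemma expiJK a : (expi a)^* * expi a = 1.
Proof. by rewrite mulJ_nc nc_expi expr1n. Qed.
Lemma expiKJ a : expi a * (expi a)^* = 1.
Proof. by rewrite mulrC expiJK. Qed.

(** Fundamental theorem of calculus for a primitive with equal values at both ends; it gives the
    vanishing means of [cos] and [sin] at nonzero frequencies. *)
Lemma avg_derive0 (F f : R -> R) : (forall x : R, is_derive x 1 F (f x)) ->
  continuous f -> F 0 = F (2 * pi) -> avg f = 0.
Proof.
move=> dF cf F0; rewrite /avg /Rintegral.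
have dbl (x : R) : derivable F x 1 by case: (dF x).
have cF : continuous F by move=> x; apply/differentiable_continuous/derivable1_diffP.
rewrite [X in fine X](@continuous_FTC2 _ f F 0 (2 * pi)).
- by rewrite -F0 -EFinB subrr mulr0.
- exact: twopi_gt0.
- exact: continuous_subspaceT.
- split => //.
    by apply: cvg_at_right_filter; exact: cF.
  by apply: cvg_at_left_filter; exact: cF.
- by move=> x _; rewrite derive1E; case: (dF x).
Qed.

Lemma continuous_comp_mul (f : R -> R) a : continuous f -> continuous (fun t => f (a * t)).
Proof.
move=> cf x; apply: (@continuous_comp _ _ _ (fun t => a * t) f); last exact: cf.
exact: mulrl_continuous.
Qed.

Lemma is_derive_comp_mul (f : R -> R) a (x : R) d :
  is_derive (a * x) 1 f d -> is_derive x 1 (fun t => f (a * t)) (d * a).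
Proof.
move=> df; have da : is_derive x 1 (fun t : R => a * t) a.
  have := @is_deriveZ _ _ _ id a x 1 1 (is_derive_id _ _).
  by rewrite /GRing.scale /= mulr1.
exact: (@is_derive1_comp _ f (fun t => a * t) x d a).
Qed.

Lemma periodic_natmul (f : R -> R) n : periodic f (pi *+ 2) ->
  f (n%:R * 0) = f (n%:R * (2 * pi)).
Proof.
move=> pf; rewrite mulr0 (_ : n%:R * (2 * pi) = 0 + pi *+ 2 *+ n); first by rewrite periodicn.
by rewrite add0r -[RHS]mulr_natl -(mulr_natl pi).
Qed.

Lemma intT_continuous (f : R -> R) : continuous f -> intT f.
Proof.
move=> cf; apply: continuous_compact_integrable; first exact: segment_compact.
exact: continuous_subspaceT.
Qed.

Lemma avg_cos n : avg (fun t : R => cos (n.+1%:R * t)) = 0.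
Proof.
have n0 : n.+1%:R != 0 :> R by [].
have cc : continuous (fun t : R => cos (n.+1%:R * t)).
  by apply: continuous_comp_mul; exact: continuous_cos.
apply/eqP; rewrite -(mulrI_eq0 _ (mulfI n0)) -avgZ; last exact: intT_continuous.
apply/eqP; apply: (@avg_derive0 (fun t => sin (n.+1%:R * t))).
- move=> x; rewrite mulrC; exact: is_derive_comp_mul.
- by move=> x; apply: cvgMr; exact: cc.
- by apply: periodic_natmul; exact: sinD2pi.
Qed.

Lemma avg_sin n : avg (fun t : R => sin (n.+1%:R * t)) = 0.
Proof.
have n0 : n.+1%:R != 0 :> R by [].
have cc : continuous (fun t : R => sin (n.+1%:R * t)).
  by apply: continuous_comp_mul; exact: continuous_sin.
apply/eqP; rewrite -(mulrI_eq0 _ (mulfI n0)) -avgZ; last exact: intT_continuous.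
apply/eqP; apply: (@avg_derive0 (fun t => - cos (n.+1%:R * t))).
- move=> x; rewrite mulrC -(opprK (sin _)) mulNr; apply: is_deriveN.
  exact: is_derive_comp_mul.
- by move=> x; apply: cvgMr; exact: cc.
- by congr (- _); apply: periodic_natmul; exact: cosD2pi.
Qed.

Definition cmeas u : Prop :=
  measurable_fun T (fun t => Re (u t)) /\ measurable_fun T (fun t => Im (u t)).

Lemma cmeas_cst (z : C) : cmeas (fun=> z).
Proof. by split; exact: measurable_cst. Qed.

Lemma cmeasD u v : cmeas u -> cmeas v -> cmeas (fun t => u t + v t).
Proof.
move=> [a b] [c d]; split.
  by under eq_fun do rewrite ReD; exact: measurable_funD.
by under eq_fun do rewrite ImD; exact: measurable_funD.
Qed.

Lemma cmeasN u : cmeas u -> cmeas (fun t => - u t).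
Proof.
move=> [a b]; split.
  by under eq_fun do rewrite ReN; exact: measurable_funN.
by under eq_fun do rewrite ImN; exact: measurable_funN.
Qed.

Lemma cmeasB u v : cmeas u -> cmeas v -> cmeas (fun t => u t - v t).
Proof. by move=> mu /cmeasN; exact: cmeasD. Qed.

Lemma cmeasM u v : cmeas u -> cmeas v -> cmeas (fun t => u t * v t).
Proof.
move=> [a b] [c d]; split.
  by under eq_fun do rewrite ReM; apply: measurable_funB; exact: measurable_funM.
by under eq_fun do rewrite ImM; apply: measurable_funD; exact: measurable_funM.
Qed.

Lemma cmeasJ u : cmeas u -> cmeas (fun t => (u t)^*).
Proof.
move=> [a b]; split.
  by under eq_fun do rewrite ReJ.
by under eq_fun do rewrite ImJ; exact: measurable_funN.
Qed.

Lemma cmeas_real (f : R -> R) : measurable_fun T f -> cmeas (fun t => (f t)%:C).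
Proof. by split => //=; exact: measurable_cst. Qed.

Lemma cmeas_nc u : cmeas u -> measurable_fun T (fun t => nc (u t)).
Proof.
move=> [a b]; under eq_fun do rewrite ncE.
have ms : measurable_fun [set: R] (fun x : R => Num.sqrt x).
  by apply: continuous_measurable_fun; exact: sqrt_continuous.
have m2 : measurable_fun T (fun t => Re (u t) ^+ 2 + Im (u t) ^+ 2).
  by apply: measurable_funD; exact: measurable_funX.
exact: (measurableT_comp ms m2).
Qed.

Lemma cmeas_expi : cmeas (@expi R).
Proof.
by split; apply: measurable_funTS; apply: continuous_measurable_fun;
  [exact: continuous_cos|exact: continuous_sin].
Qed.

Lemma cmeasX u n : cmeas u -> cmeas (fun t => u t ^+ n).
Proof.
move=> h; elim: n => [|n ih]; first exact: cmeas_cst.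
by under eq_fun do rewrite exprS; exact: cmeasM.
Qed.

Lemma cmeas_sum I (s : seq I) (u : I -> R -> C) :
  (forall i, cmeas (u i)) -> cmeas (fun t => \sum_(i <- s) u i t).
Proof.
move=> h; elim: s => [|i s ih].
  by under eq_fun do rewrite big_nil; exact: cmeas_cst.
by under eq_fun do rewrite big_cons; exact: cmeasD.
Qed.

Lemma cmeas_cvg (u_ : nat -> R -> C) u : (forall n, cmeas (u_ n)) ->
  (forall t, T t -> ccvg \oo (fun n => u_ n t) (u t)) -> cmeas u.
Proof.
move=> mu_ h; split.
  apply: (@measurable_fun_cvg _ _ _ _ (fun n t => Re (u_ n t))) => [n|t Tt].
    by case: (mu_ n).
  by have /ccvg_ReIm[] := h _ Tt.
apply: (@measurable_fun_cvg _ _ _ _ (fun n t => Im (u_ n t))) => [n|t Tt].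
  by case: (mu_ n).
by have /ccvg_ReIm[] := h _ Tt.
Qed.

Definition cint u : Prop := intT (fun t => Re (u t)) /\ intT (fun t => Im (u t)).

Lemma cint_meas u : cint u -> cmeas u.
Proof. by move=> [a b]; split; exact: intT_measurable. Qed.

Lemma cint_nc u : cint u -> intT (fun t => nc (u t)).
Proof.
move=> h; have [a b] := h.
apply: (intT_le (cmeas_nc (cint_meas h)) (intTD (intT_norm a) (intT_norm b))) => t _.
by rewrite ger0_norm ?nc_ge0// nc_le_ReIm.
Qed.

Lemma cint_le_ae (g : R -> R) u : cmeas u -> intT g -> aeT (fun t => nc (u t) <= g t) ->
  cint u.
Proof.
move=> [a b] gi ug; split; apply: intT_le_ae gi _ => //; move: ug; apply: aeTS => t _.
  by apply: le_trans; exact: normr_Re_le.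
by apply: le_trans; exact: normr_Im_le.
Qed.

Lemma cint_bounded_ae c u : cmeas u -> aeT (fun t => nc (u t) <= c) -> cint u.
Proof. by move=> mu h; apply: (cint_le_ae mu (intT_cst c)). Qed.

Lemma cint_bounded c u : cmeas u -> (forall t, T t -> nc (u t) <= c) -> cint u.
Proof. by move=> mu h; apply: (@cint_bounded_ae c) => //; exact: aeTW. Qed.

Lemma cintM_bounded_ae c u v : cint u -> cmeas v -> aeT (fun t => nc (v t) <= c) ->
  cint (fun t => u t * v t).
Proof.
move=> iu mv vc; apply: (@cint_le_ae (fun t => c * nc (u t))).
- by apply: cmeasM => //; exact: cint_meas.
- by apply: intTZ; exact: cint_nc.
- by move: vc; apply: aeTS => t _ h; rewrite ncM mulrC ler_wpM2r// nc_ge0.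
Qed.

Lemma cintM_bounded c u v : cint u -> cmeas v -> (forall t, T t -> nc (v t) <= c) ->
  cint (fun t => u t * v t).
Proof. by move=> iu mv h; apply: (@cintM_bounded_ae c) => //; exact: aeTW. Qed.

Lemma cint_cst (z : C) : cint (fun=> z).
Proof. by split; exact: intT_cst. Qed.

Lemma cintD u v : cint u -> cint v -> cint (fun t => u t + v t).
Proof.
move=> [a b] [c d]; split.
  by under eq_fun do rewrite ReD; exact: intTD.
by under eq_fun do rewrite ImD; exact: intTD.
Qed.

Lemma cintN u : cint u -> cint (fun t => - u t).
Proof.
move=> [a b]; split.
  by under eq_fun do rewrite ReN; exact: intTN.
by under eq_fun do rewrite ImN; exact: intTN.
Qed.

Lemma cintB u v : cint u -> cint v -> cint (fun t => u t - v t).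
Proof. by move=> iu /cintN; exact: cintD. Qed.

Lemma cintZ z u : cint u -> cint (fun t => z * u t).
Proof.
move=> [a b]; split.
  by under eq_fun do rewrite ReM; apply: intTB; exact: intTZ.
by under eq_fun do rewrite ImM; apply: intTD; exact: intTZ.
Qed.

Lemma cintJ u : cint u -> cint (fun t => (u t)^*).
Proof.
move=> [a b]; split.
  by under eq_fun do rewrite ReJ.
by under eq_fun do rewrite ImJ; exact: intTN.
Qed.

Lemma cint_real (f : R -> R) : intT f -> cint (fun t => (f t)%:C).
Proof. by move=> fi; split => //=; exact: intT_cst. Qed.

Lemma cint_sum I (s : seq I) (u : I -> R -> C) :
  (forall i, cint (u i)) -> cint (fun t => \sum_(i <- s) u i t).
Proof.
move=> h; elim: s => [|i s ih].
  by under eq_fun do rewrite big_nil; exact: cint_cst.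
by under eq_fun do rewrite big_cons; exact: cintD.
Qed.

Lemma Re_cavg u : Re (cavg u) = avg (fun t => Re (u t)).
Proof. by rewrite /cavg Re_realM. Qed.

Lemma Im_cavg u : Im (cavg u) = avg (fun t => Im (u t)).
Proof. by rewrite /cavg Im_realM. Qed.

Lemma eq_cavg u v : (forall t, T t -> u t = v t) -> cavg u = cavg v.
Proof.
by move=> uv; apply: complex_eqP; rewrite !(Re_cavg, Im_cavg); apply: eq_avg => t Tt; rewrite uv.
Qed.

Lemma ae_eq_cavg u v : cmeas u -> cmeas v -> aeT (fun t => u t = v t) -> cavg u = cavg v.
Proof.
move=> [a b] [c d] uv; apply: complex_eqP; rewrite !(Re_cavg, Im_cavg); apply: ae_eq_avg => //;
  by move: uv; apply: aeTS => t Tt ->.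
Qed.

Lemma cavgD u v : cint u -> cint v -> cavg (fun t => u t + v t) = cavg u + cavg v.
Proof.
move=> [a b] [c d]; apply: complex_eqP; rewrite ?(Re_cavg, Im_cavg) ?ReD ?ImD ?(Re_cavg, Im_cavg) -avgD//;
  by apply: eq_avg => t _; rewrite ?ReD ?ImD.
Qed.

Lemma cavgZ z u : cint u -> cavg (fun t => z * u t) = z * cavg u.
Proof.
move=> [a b]; apply: complex_eqP; rewrite ?(Re_cavg, Im_cavg); [rewrite ReM|rewrite ImM]; rewrite !(Re_cavg, Im_cavg).
  rewrite -!avgZ// -avgB; try exact: intTZ.
  by apply: eq_avg => t _; rewrite ReM.
rewrite -!avgZ// -avgD; try exact: intTZ.
by apply: eq_avg => t _; rewrite ImM.
Qed.

Lemma cavgN u : cint u -> cavg (fun t => - u t) = - cavg u.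
Proof.
by move=> iu; rewrite -mulN1r -cavgZ//; apply: eq_cavg => t _; rewrite mulN1r.
Qed.

Lemma cavgB u v : cint u -> cint v -> cavg (fun t => u t - v t) = cavg u - cavg v.
Proof. by move=> iu iv; rewrite cavgD ?cavgN//; exact: cintN. Qed.

Lemma cavg_cst (z : C) : cavg (fun=> z) = z.
Proof. by apply: complex_eqP; rewrite !(Re_cavg, Im_cavg) avg_cst. Qed.

Lemma cavg_real (f : R -> R) : cavg (fun t => (f t)%:C) = (avg f)%:C.
Proof. by apply: complex_eqP; rewrite !(Re_cavg, Im_cavg) /= ?avg_cst. Qed.

Lemma cavgJ u : cint u -> cavg (fun t => (u t)^*) = (cavg u)^*.
Proof.
move=> [a b]; apply: complex_eqP; rewrite ?(Re_cavg, Im_cavg) ?ReJ ?ImJ ?(Re_cavg, Im_cavg).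
  by apply: eq_avg => t _; rewrite ReJ.
by rewrite -avgN//; apply: eq_avg => t _; rewrite ImJ.
Qed.

Lemma cavg_sum I (s : seq I) (u : I -> R -> C) : (forall i, cint (u i)) ->
  cavg (fun t => \sum_(i <- s) u i t) = \sum_(i <- s) cavg (u i).
Proof.
move=> h; elim: s => [|i s ih].
  by rewrite big_nil -[RHS]cavg_cst; apply: eq_cavg => t _; rewrite big_nil.
rewrite big_cons -ih -cavgD//; last exact: cint_sum.
by apply: eq_cavg => t _; rewrite big_cons.
Qed.

(* Rotating [u] so that its average becomes a nonnegative real reduces the claim
   to the monotonicity of real averages. *)
Lemma nc_cavg_le u : cint u -> nc (cavg u) <= avg (fun t => nc (u t)).
Proof.
move=> iu; have [->|z0] := eqVneq (cavg u) 0.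
  by rewrite nc0; apply: avg_ge0 => t _; exact: nc_ge0.
move ez : (cavg u) z0 => z z0; set w := ((nc z)^-1)%:C * z^*.
have nw : nc w = 1.
  by rewrite ncM nc_real ncJ normfV ger0_norm ?nc_ge0// mulVf// nc_eq0.
have -> : nc z = Re (cavg (fun t => w * u t)).
  rewrite cavgZ// ez /w -mulrA mulJ_nc -realCM /complex.Re expr2 mulrA mulVf ?mul1r//.
  by rewrite nc_eq0.
rewrite Re_cavg; apply: le_avg; first by case: (cintZ w iu).
  exact: cint_nc.
move=> t _; apply: le_trans (ler_norm _) _.
by rewrite (le_trans (normr_Re_le _))// ncM nw mul1r.
Qed.

Lemma cavg_bounded_ae c u : cmeas u -> aeT (fun t => nc (u t) <= c) -> nc (cavg u) <= c.
Proof.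
move=> mu uc; have iu := cint_bounded_ae mu uc.
apply: le_trans (nc_cavg_le iu) _; rewrite -[leRHS]avg_cst.
by apply: le_avg_ae => //; [exact: cint_nc|exact: intT_cst].
Qed.

Lemma cavg_dct (u_ : nat -> R -> C) u (g : R -> R) :
  (forall n, cmeas (u_ n)) -> cmeas u -> intT g ->
  aeT (fun t => ccvg \oo (fun n => u_ n t) (u t)) ->
  (forall n, aeT (fun t => nc (u_ n t) <= g t)) ->
  ccvg \oo (fun n => cavg (u_ n)) (cavg u).
Proof.
move=> mu_ [a b] gi uu ug; apply/ccvg_ReIm; split.
  under eq_fun do rewrite Re_cavg; rewrite Re_cavg.
  apply: avg_dct gi _ _ => //; first by move=> n; case: (mu_ n).
    by move: uu; apply: aeTS => t _ /ccvg_ReIm[].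
  by move=> n; move: (ug n); apply: aeTS => t _; apply: le_trans; exact: normr_Re_le.
under eq_fun do rewrite Im_cavg; rewrite Im_cavg.
apply: avg_dct gi _ _ => //; first by move=> n; case: (mu_ n).
  by move: uu; apply: aeTS => t _ /ccvg_ReIm[].
by move=> n; move: (ug n); apply: aeTS => t _; apply: le_trans; exact: normr_Im_le.
Qed.

Lemma cavg_expiX n : cavg (fun t : R => expi t ^+ n) = (n == 0)%:R.
Proof.
case: n => [|n]; first exact: cavg_cst.
apply: complex_eqP; rewrite !(Re_cavg, Im_cavg) /=.
  rewrite -[RHS](avg_cos n); apply: eq_avg => t _.
  by rewrite -expi_natmul.
rewrite -[RHS](avg_sin n); apply: eq_avg => t _.
by rewrite -expi_natmul.
Qed.

Lemma cmeas_expiX n : cmeas (fun t : R => expi t ^+ n).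
Proof. by apply: cmeasX; exact: cmeas_expi. Qed.

Lemma nc_expiX n (t : R) : nc (expi t ^+ n) = 1.
Proof. by rewrite ncX nc_expi expr1n. Qed.

Lemma cint_expiX n : cint (fun t : R => expi t ^+ n).
Proof.
by apply: (@cint_bounded 1); [exact: cmeas_expiX|move=> t _; rewrite nc_expiX].
Qed.

Lemma expiXKJ n (t : R) : expi t ^+ n * (expi t ^+ n)^* = 1.
Proof. by rewrite mulrC mulJ_nc nc_expiX expr1n. Qed.

Lemma cavg_expi_orth m n :
  cavg (fun t : R => expi t ^+ n * (expi t ^+ m)^*) = (n == m)%:R.
Proof.
have [mn|/ltnW nm] := leqP m n.
  rewrite (@eq_cavg _ (fun t => expi t ^+ (n - m))); last first.
    move=> t _; rewrite -{1}(subnK mn) exprD -mulrA.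
    by rewrite expiXKJ mulr1.
  by rewrite cavg_expiX subn_eq0 eqn_leq mn andbT.
rewrite (@eq_cavg _ (fun t => (expi t ^+ (m - n))^*)); last first.
  move=> t _; rewrite -{1}(subnK nm) exprD rmorphM mulrCA.
  by rewrite expiXKJ mulr1.
rewrite cavgJ ?cavg_expiX ?subn_eq0; last exact: cint_expiX.
by rewrite eqn_leq nm; case: (m <= n)%N; rewrite ?conjc0 ?conjc1.
Qed.

End CircleIntegral.

(** * Locally uniform limits of polynomials *)

Section ExpEstimate.
Variable R : realType.
Local Notation C := R[i].
Local Notation Re := (@complex.Re R).
Local Notation Im := (@complex.Im R).

Lemma lipschitz_derive (f df : R -> R) (y K : R) :
  (forall x : R, is_derive x 1 f (df x)) ->
  (forall x, `|x| <= `|y| -> `|df x| <= K) -> `|f y - f 0| <= K * `|y|.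
Proof.
move=> dfd dfK.
have cf A : {within A, continuous f}.
  apply: continuous_subspaceT => x; apply/differentiable_continuous/derivable1_diffP.
  by case: (dfd x).
have [y0|/ltW y0] := leP 0 y.
  have [c] := MVT_segment y0 (fun x _ => dfd x) (cf _).
  rewrite in_itv /= subr0 => /andP[c0 cy] ->.
  by rewrite normrM ler_wpM2r// dfK// !ger0_norm.
have [c] := MVT_segment y0 (fun x _ => dfd x) (cf _).
rewrite in_itv /= sub0r => /andP[c0 cy] e.
rewrite distrC e normrM normrN ler_wpM2r// dfK// !ler0_norm// ?lerN2//.
Qed.

Lemma normr_sin_le (y : R) : `|sin y| <= `|y|.
Proof.
have := @lipschitz_derive sin cos y 1 (@is_derive_sin _).
rewrite sin0 subr0 mul1r; apply => x _; exact: cos_max.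
Qed.

Lemma cos_sub1_le (y : R) : `|cos y - 1| <= y ^+ 2.
Proof.
have := @lipschitz_derive cos (fun x => - sin x) y `|y| (@is_derive_cos _).
rewrite cos0 -expr2 real_normK ?num_real//; apply => x xy.
by rewrite normrN (le_trans (normr_sin_le _)).
Qed.

Lemma sin_sub_le (y : R) : `|sin y - y| <= y ^+ 2 * `|y|.
Proof.
have := @lipschitz_derive (fun x => sin x - x) (fun x => cos x - 1) y (y ^+ 2).
rewrite sin0 !subr0; apply=> x xy.
rewrite (le_trans (cos_sub1_le _))//.
by rewrite -[leLHS]real_normK ?num_real// -[leRHS]real_normK ?num_real// ler_sqr ?nnegrE.
Qed.

(** From [exp (- x) >= 1 - x] one gets [(1 - x) exp x <= 1], so the remainder is at most
    [x^2 / (1 - x)], and [1 - x >= 1/2]. *)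
Lemma expR_sub1_le (x : R) : `|x| <= 2^-1 -> `|expR x - 1 - x| <= 2 * x ^+ 2.
Proof.
rewrite ler_norml => /andP[x1 x2].
have := expR_ge1Dx x; have := expR_ge1Dx (- x).
rewrite expRN => h1 h2; have e0 := expR_gt0 x.
rewrite ger0_norm; last lra.
have : (1 - x) * expR x <= 1 by rewrite -ler_pdivlMr// mul1r.
nra.
Qed.

Lemma nc_expC (z : C) : nc (expC z) = expR (Re z).
Proof.
by rewrite /expC ncE /= !exprMn -mulrDr cos2Dsin2 mulr1 sqrtr_sqr ger0_norm// expR_ge0.
Qed.

Lemma expCD (z w : C) : expC (z + w) = expC z * expC w.
Proof.
apply: complex_eqP; rewrite ?ReM ?ImM /= ReD ImD expRD ?cosD ?sinD; ring.
Qed.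

Lemma expC0 : expC (0 : C) = 1.
Proof. by apply: complex_eqP; rewrite /= expR0 ?cos0 ?sin0 ?mulr1 ?mulr0. Qed.

Lemma expC_neq0 (z : C) : expC z != 0.
Proof. by rewrite -nc_eq0 nc_expC gt_eqF// expR_gt0. Qed.

Lemma expCN (z : C) : expC (- z) = (expC z)^-1.
Proof.
by apply: (mulfI (expC_neq0 z)); rewrite -expCD subrr expC0 divff// expC_neq0.
Qed.

Lemma expC_natmul n (z : C) : expC (n%:R * z) = expC z ^+ n.
Proof.
elim: n => [|n ih]; first by rewrite mul0r expC0.
by rewrite exprS -ih -expCD -natr1 mulrDl mul1r addrC.
Qed.

(** Only the quadratic order matters for [expC_approx]; the constant [5] is generous, as the bounds
    below add up to [7/2]. *)
Lemma expC_taylor1 (z : C) : nc z <= 2^-1 -> nc (expC z - 1 - z) <= 5 * nc z ^+ 2.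
Proof.
move=> z1; rewrite (le_trans (nc_le_ReIm _))// nc_sqr.
have := normr_Re_le z; have := normr_Im_le z.
rewrite !ReB !ImB /= subr0; set x := Re z; set y := Im z => yz xz.
have x1 : `|x| <= 2^-1 by rewrite (le_trans xz).
have y1 : `|y| <= 2^-1 by rewrite (le_trans yz).
have ex := expR_sub1_le x1.
have cy := cos_sub1_le y; have sy := sin_sub_le y; have sy1 := normr_sin_le y.
have e2 : expR x <= 2.
  move: x1 ex; rewrite !ler_norml => /andP[? ?] /andP[? ?].
  have hx : x ^+ 2 <= 4^-1 by nra.
  lra.
have e0 := expR_ge0 x.
have -> : expR x * cos y - 1 - x = expR x * (cos y - 1) + (expR x - 1 - x) by ring.
have -> : expR x * sin y - y = expR x * (sin y - y) + (expR x - 1 - x) * y + x * y by ring.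
have h1 : `|expR x * (cos y - 1)| <= 2 * y ^+ 2.
  by rewrite normrM ger0_norm// ler_pM.
have h2 : `|expR x * (sin y - y)| <= y ^+ 2.
  have t : 0 <= y ^+ 2 * (2^-1 - `|y|) by rewrite mulr_ge0 ?sqr_ge0 ?subr_ge0.
  rewrite normrM ger0_norm//; apply: (@le_trans _ _ (2 * (y ^+ 2 * `|y|))); last by lra.
  by rewrite ler_pM.
have h3 : `|(expR x - 1 - x) * y| <= x ^+ 2.
  have t : 0 <= x ^+ 2 * (2^-1 - `|y|) by rewrite mulr_ge0 ?sqr_ge0 ?subr_ge0.
  rewrite normrM; apply: (@le_trans _ _ (2 * x ^+ 2 * `|y|)); last by lra.
  by rewrite ler_wpM2r.
have h4 : `|x * y| <= 2^-1 * x ^+ 2 + 2^-1 * y ^+ 2.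
  rewrite normrM -[x ^+ 2]real_normK ?num_real// -[y ^+ 2]real_normK ?num_real//.
  have := sqr_ge0 (`|x| - `|y|); lra.
have t1 := ler_normD (expR x * (cos y - 1)) (expR x - 1 - x).
have t2 := ler_normD (expR x * (sin y - y) + (expR x - 1 - x) * y) (x * y).
have t3 := ler_normD (expR x * (sin y - y)) ((expR x - 1 - x) * y).
have := sqr_ge0 x; have := sqr_ge0 y; lra.
Qed.

Lemma nc_subXX_le (a b : C) (A : R) n : nc a <= A -> nc b <= A ->
  nc (a ^+ n.+1 - b ^+ n.+1) <= nc (a - b) * (n.+1%:R * A ^+ n).
Proof.
move=> aA bA; rewrite subrXX ncM ler_wpM2l ?nc_ge0//.
rewrite (le_trans (nc_sum_le _ _ _))// -[n.+1 in leRHS]card_ord -sum1_card.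
rewrite natr_sum mulr_suml ler_sum// => i _; rewrite mul1r ncM !ncX.
have A0 : 0 <= A by rewrite (le_trans (nc_ge0 a)).
rewrite -[n in leRHS](@subnK i); last by rewrite -ltnS.
by rewrite exprD ler_pM// ?exprn_ge0 ?nc_ge0// lerXn2r ?nnegrE ?nc_ge0.
Qed.

(** [exp w] is the [N]-th power of [exp (w / N)], which differs from [1 + w / N] by [O(1 / N^2)]; in
    the factorization of the difference of [N]-th powers all bases are at most [exp (M / N)]. The
    condition [2 M <= N] puts [w / N] in the range of [expC_taylor1]. *)
Lemma expC_approx (M : R) (w : C) n : nc w <= M -> 2 * M <= n.+1%:R ->
  nc (expC w - (1 + n.+1%:R^-1%:C * w) ^+ n.+1) <= 5 * M ^+ 2 * expR M / n.+1%:R.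
Proof.
move=> wM nM; set N : R := n.+1%:R.
have N0 : 0 < N by rewrite ltr0n.
have M0 : 0 <= M by rewrite (le_trans (nc_ge0 w)).
set d := (n.+1%:R^-1%:C * w).
have nd : nc d <= M / N.
  by rewrite ncM nc_real ger0_norm ?invr_ge0 ?ler0n// mulrC ler_wpM2r// invr_ge0 ltW.
have -> : expC w = expC d ^+ n.+1.
  rewrite -expC_natmul mulrA -[n.+1%:R]/(n.+1%:R : C) -(rmorph_nat (real_complex R)).
  by rewrite -realCM divff ?mul1r// gt_eqF.
have e1 : nc (expC d) <= expR (M / N).
  by rewrite nc_expC ler_expR (le_trans (ler_norm _))// (le_trans (normr_Re_le _)).
have e2 : nc (1 + d) <= expR (M / N).
  rewrite (le_trans (ncD_le _ _))// nc1 (le_trans _ (expR_ge1Dx _))//.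
  by rewrite lerD2l.
rewrite (le_trans (nc_subXX_le _ e1 e2))//.
have h : nc (expC d - (1 + d)) <= 5 * (M / N) ^+ 2.
  rewrite opprD addrA (le_trans (expC_taylor1 _))//.
    by rewrite (le_trans nd)// ler_pdivrMr// mulrC -ler_pdivrMr ?invr_gt0// invrK mulrC.
  by rewrite ler_wpM2l// ler_sqr ?nnegrE ?nc_ge0// divr_ge0// ltW.
have h2 : expR (M / N) ^+ n <= expR M.
  rewrite -expRM_natl ler_expR mulrCA ler_piMr// ler_pdivrMr// mul1r.
  by rewrite ler_nat.
rewrite (@le_trans _ _ (5 * (M / N) ^+ 2 * (N * expR M)))//.
  by rewrite ler_pM ?nc_ge0 ?mulr_ge0 ?exprn_ge0 ?expR_ge0// ?ler0n// ler_wpM2l// ltW.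
by rewrite le_eqVlt; apply/orP; left; apply/eqP; field; rewrite gt_eqF.
Qed.

End ExpEstimate.

Section Analytic.
Variable R : realType.
Local Notation C := R[i].
Local Notation Re := (@complex.Re R).
Local Notation Im := (@complex.Im R).
Local Notation T := (@Tdom R).
Implicit Types (G H : C -> C) (r e M : R) (z w : C).

(* Locally uniform limits of polynomials on the disc: by Runge's theorem these are the
   holomorphic functions, but this form needs no Cauchy theory, as integral identities
   only have to be checked on monomials. *)
Definition ana G : Prop := forall r e, r < 1 -> 0 < e ->
  exists p : {poly C}, forall z, nc z <= r -> nc (G z - p.[z]) <= e.

Lemma poly_bounded (p : {poly C}) r :
  exists M, 0 < M /\ forall z, nc z <= r -> nc p.[z] <= M.
Proof.
exists (1 + \sum_(i < size p) nc p`_i * `|r| ^+ i); split.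
  by rewrite ltr_pwDl// sumr_ge0// => i _; rewrite mulr_ge0 ?nc_ge0// exprn_ge0.
move=> z zr; rewrite horner_coef (le_trans (nc_sum_le _ _ _))// ler_wpDl// ler_sum// => i _.
rewrite ncM ncX ler_wpM2l ?nc_ge0// lerXn2r ?nnegrE ?nc_ge0//.
by rewrite (le_trans zr)// ler_norm.
Qed.

Lemma ana_bounded G r : ana G -> r < 1 ->
  exists M, 0 < M /\ forall z, nc z <= r -> nc (G z) <= M.
Proof.
move=> /(_ r 1) aG r1; have [p hp] := aG r1 ltr01.
have [M [M0 hM]] := poly_bounded p r; exists (1 + M); split; first by rewrite addr_gt0.
move=> z zr; rewrite -(subrK p.[z] (G z)) (le_trans (ncD_le _ _))// lerD//.
  exact: hp.
exact: hM.
Qed.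

Lemma ana_horner (p : {poly C}) : ana (fun z => p.[z]).
Proof. by move=> r e _ e0; exists p => z _; rewrite subrr nc0 ltW. Qed.

Lemma ana_ext G H : (forall z, disc z -> G z = H z) -> ana G -> ana H.
Proof.
move=> GH aG r e r1 e0; have [p hp] := aG r e r1 e0; exists p => z zr.
by rewrite -GH; [exact: hp|exact: le_lt_trans zr r1].
Qed.

Lemma ana_lim G : (forall r e, r < 1 -> 0 < e ->
    exists2 H, ana H & forall z, nc z <= r -> nc (G z - H z) <= e) -> ana G.
Proof.
move=> h r e r1 e0; have e2 : 0 < e / 2 by rewrite divr_gt0.
have [H aH GH] := h r (e / 2) r1 e2; have [p hp] := aH r (e / 2) r1 e2.
exists p => z zr; rewrite (le_trans (nc_dist_tri (H z) _ _))//.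
by rewrite [leRHS](splitr e) lerD// ?GH ?hp.
Qed.

Lemma ana_cst z : ana (fun=> z).
Proof. by apply: ana_ext (ana_horner z%:P) => w _; rewrite hornerC. Qed.

Lemma ana_id : ana id.
Proof. by apply: ana_ext (ana_horner 'X) => w _; rewrite hornerX. Qed.

Lemma anaD G H : ana G -> ana H -> ana (fun z => G z + H z).
Proof.
move=> aG aH r e r1 e0; have e2 : 0 < e / 2 by rewrite divr_gt0.
have [p hp] := aG r (e / 2) r1 e2; have [q hq] := aH r (e / 2) r1 e2.
exists (p + q) => z zr; rewrite hornerD opprD addrACA (le_trans (ncD_le _ _))//.
by rewrite [leRHS](splitr e) lerD// ?hp ?hq.
Qed.

Lemma anaM G H : ana G -> ana H -> ana (fun z => G z * H z).
Proof.
move=> aG aH r e r1 e0.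
have [M [M0 hM]] := ana_bounded aG r1.
have d0 : 0 < e / (2 * M) by rewrite divr_gt0// mulr_gt0.
have [q hq] := aH r _ r1 d0.
have [N [N0 hN]] := poly_bounded q r.
have d1 : 0 < e / (2 * N) by rewrite divr_gt0// mulr_gt0.
have [p hp] := aG r _ r1 d1.
exists (p * q) => z zr; rewrite hornerM.
have -> : G z * H z - p.[z] * q.[z] = G z * (H z - q.[z]) + (G z - p.[z]) * q.[z] by ring.
rewrite (le_trans (ncD_le _ _))// !ncM.
have a1 : nc (G z) * nc (H z - q.[z]) <= M * (e / (2 * M)).
  by rewrite ler_pM ?nc_ge0 ?hM ?hq.
have a2 : nc (G z - p.[z]) * nc q.[z] <= e / (2 * N) * N.
  by rewrite ler_pM ?nc_ge0 ?hN ?hp.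
rewrite (le_trans (lerD a1 a2))// le_eqVlt; apply/orP; left; apply/eqP.
by field; rewrite !gt_eqF.
Qed.

Lemma anaZ (c : C) G : ana G -> ana (fun z => c * G z).
Proof. by move=> aG; apply: anaM => //; exact: ana_cst. Qed.

Lemma anaN G : ana G -> ana (fun z => - G z).
Proof. by move=> /(anaZ (-1)); apply: ana_ext => z _; rewrite mulN1r. Qed.

Lemma anaB G H : ana G -> ana H -> ana (fun z => G z - H z).
Proof. by move=> aG /anaN; exact: anaD. Qed.

Lemma anaX G n : ana G -> ana (fun z => G z ^+ n).
Proof.
move=> aG; elim: n => [|n ih]; first exact: ana_cst.
by under eq_fun do rewrite exprS; exact: anaM.
Qed.

Lemma ana_sum I (s : seq I) (G : I -> C -> C) : (forall i, ana (G i)) ->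
  ana (fun z => \sum_(i <- s) G i z).
Proof.
move=> h; elim: s => [|i s ih]; first by under eq_fun do rewrite big_nil; exact: ana_cst.
by under eq_fun do rewrite big_cons; exact: anaD.
Qed.

Lemma ana_prod I (s : seq I) (G : I -> C -> C) : (forall i, ana (G i)) ->
  ana (fun z => \prod_(i <- s) G i z).
Proof.
move=> h; elim: s => [|i s ih]; first by under eq_fun do rewrite big_nil; exact: ana_cst.
by under eq_fun do rewrite big_cons; exact: anaM.
Qed.

(** [(1 + G / N)^N] is a polynomial in [G], hence [ana], and approximates [exp G] uniformly wherever
    [G] is bounded. *)
Lemma ana_expC G : ana G -> ana (fun z => expC (G z)).
Proof.
move=> aG; apply: ana_lim => r e r1 e0.
have [M [M0 hM]] := ana_bounded aG r1.
set K := 5 * M ^+ 2 * expR M.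
have K0 : 0 <= K by rewrite !mulr_ge0// ?exprn_ge0 ?expR_ge0 ?ltW.
have Ke : 0 <= K / e by rewrite divr_ge0// ltW.
(* The summand [2 M] meets the hypothesis of [expC_approx], the summand [K / e] brings its error
   [K / N] below [e]. *)
have [n hn] : exists n, 2 * M + K / e <= n.+1%:R.
  exists (Num.bound (2 * M + K / e)).
  have h : 0 <= 2 * M + K / e by rewrite addr_ge0// mulr_ge0// ltW.
  by rewrite (le_trans (ltW (archi_boundP h)))// ler_nat.
exists (fun z => (1 + n.+1%:R^-1%:C * G z) ^+ n.+1).
  by apply: anaX; apply: anaD; [exact: ana_cst|exact: anaZ].
move=> z zr; rewrite (le_trans (expC_approx (hM _ zr) _))//.
  by rewrite (le_trans _ hn)// lerDl.
rewrite -/K ler_pdivrMr ?ltr0n// mulrC -ler_pdivrMr// (le_trans _ hn)// lerDr.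
by rewrite mulr_ge0// ltW.
Qed.

Lemma nc_geo_le (x : C) r N : nc x <= r -> r < 1 ->
  nc ((1 - x)^-1 - \sum_(m < N) x ^+ m) <= r ^+ N / (1 - r).
Proof.
move=> xr r1.
have r0 : 0 <= r by rewrite (le_trans (nc_ge0 x)).
have d : 1 - r <= nc (1 - x).
  by rewrite (le_trans _ (nc_sub_le _ _))// nc1 lerD2l lerN2.
have x1 : 1 - x != 0 by rewrite -nc_gt0 (lt_le_trans _ d)// subr_gt0.
have -> : (1 - x)^-1 - \sum_(m < N) x ^+ m = x ^+ N / (1 - x).
  apply: (mulIf x1); rewrite mulrBl mulVf// divfK// mulrC -[1 - x]opprB mulNr -subrX1.
  by ring.
rewrite ncM ncX ncV ler_pM ?exprn_ge0 ?invr_ge0 ?nc_ge0//.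
  by rewrite lerXn2r ?nnegrE ?nc_ge0.
by rewrite lef_pV2 ?posrE ?subr_gt0// (lt_le_trans _ d)// subr_gt0.
Qed.

Lemma geo_small r e K : 0 <= r -> r < 1 -> 0 < e -> exists N, forall n, (N <= n)%N ->
  K * (r ^+ n / (1 - r)) <= e.
Proof.
move=> r0 r1 e0.
have : K * (r ^+ n / (1 - r)) @[n --> \oo] --> K * (0 / (1 - r)).
  apply: cvgMr; apply: cvgMl; apply: cvg_expr; by rewrite ger0_norm.
rewrite mul0r mulr0 => /cvgr0_norm_le /(_ _ e0) [N _ hN]; exists N => n Nn.
by rewrite (le_trans (ler_norm _))//; exact: hN.
Qed.

(** A set bounded by [M] in the right half plane lies in a disc about a large [K]:
    [|K - G|^2 <= K^2 + M^2], which for [K = M^2 / (2 s)] is [K^2 + 2 s K < (s + K)^2]. Hence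
    [s + G = (s + K) - (K - G)] is inverted by a geometric series of ratio at most [q < 1]. *)
Lemma ana_inv G (s : R) : 0 < s -> ana G -> (forall z, disc z -> 0 <= Re (G z)) ->
  ana (fun z => (s%:C + G z)^-1).
Proof.
move=> s0 aG G0; apply: ana_lim => r e r1 e0.
have [M [M0 hM]] := ana_bounded aG r1.
set K := M ^+ 2 / (2 * s).
have K0 : 0 < K by rewrite divr_gt0// ?exprn_gt0// mulr_gt0.
have sK : 0 < s + K by rewrite addr_gt0.
have sK' := ltW sK; have M0' := ltW M0.
set q := Num.sqrt (K ^+ 2 + M ^+ 2) / (s + K).
have q1 : q < 1.
  rewrite ltr_pdivrMr// mul1r -ltr_sqr ?nnegrE ?sqrtr_ge0//.
  rewrite sqr_sqrtr ?addr_ge0 ?sqr_ge0//.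
  have -> : M ^+ 2 = 2 * s * K by rewrite /K; field; rewrite gt_eqF.
  have := exprn_gt0 2 s0; nra.
have q0 : 0 <= q by rewrite divr_ge0 ?sqrtr_ge0// ltW.
pose X z := (s + K)^-1%:C * (K%:C - G z).
have hX z : nc z <= r -> nc (X z) <= q.
  move=> zr; rewrite ncM nc_real ger0_norm ?invr_ge0// mulrC /q.
  rewrite ler_wpM2r ?invr_ge0// ncE ler_wsqrtr// ReB ImB /= sub0r sqrrN.
  have := nc_sqr (G z); have := G0 z (le_lt_trans zr r1).
  have : nc (G z) ^+ 2 <= M ^+ 2 by rewrite ler_sqr ?nnegrE ?nc_ge0// hM.
  nra.
have hG z : (s%:C + G z)^-1 = (s + K)^-1%:C * (1 - X z)^-1.
  have c0 : (s + K)%:C != 0 by rewrite -nc_eq0 nc_real normr_eq0 gt_eqF.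
  have cV : (s + K)^-1%:C = (s + K)%:C^-1 by rewrite fmorphV.
  have -> : 1 - X z = (s + K)%:C^-1 * (s%:C + G z).
    rewrite /X cV -[1 in LHS](mulVf c0) -mulrBr realCD; congr (_ * _); ring.
  by rewrite invfM invrK mulrA cV mulVf// mul1r.
have [N hN] := geo_small (s + K)^-1 q0 q1 e0.
exists (fun z => (s + K)^-1%:C * \sum_(m < N) X z ^+ m).
  apply: anaZ; apply: ana_sum => i; apply: anaX; apply: anaZ; apply: anaB => //.
  exact: ana_cst.
move=> z zr; rewrite hG -mulrBr ncM nc_real ger0_norm ?invr_ge0//.
rewrite (le_trans _ (hN N _))// ler_wpM2l ?invr_ge0//.
by apply: nc_geo_le => //; exact: hX.
Qed.

Lemma ccvg_horner I (F : set_system I) {FF : Filter F} (p : {poly C}) (u : I -> C) z :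
  ccvg F u z -> ccvg F (fun i => p.[u i]) p.[z].
Proof.
move=> h; elim/poly_ind : p => [|p c ih].
  by rewrite horner0; under eq_fun do rewrite horner0; exact: ccvg_cst.
rewrite hornerMXaddC; under eq_fun do rewrite hornerMXaddC.
by apply: ccvgD; [exact: ccvgM|exact: ccvg_cst].
Qed.

Lemma ana_continuous I (F : set_system I) {FF : Filter F} G (u : I -> C) z :
  ana G -> disc z -> ccvg F u z -> ccvg F (fun i => G (u i)) (G z).
Proof.
move=> aG z1 h; apply/ccvg_epsP => e e0.
set r := (1 + nc z) / 2.
have z1' : nc z < 1 := z1.
have r1 : r < 1 by rewrite /r; lra.
have zr : nc z < r by rewrite /r; lra.
have e3 : 0 < e / 3 by rewrite divr_gt0.
have [p hp] := aG r _ r1 e3.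
have /ccvg_epsP hph := ccvg_horner (FF := FF) p h.
near=> i.
have ur : nc (u i) <= r.
  by near: i; apply: cvgr_le (ccvg_norm h) _ zr.
have pu : nc (p.[u i] - p.[z]) <= e / 3 by near: i; exact: hph.
rewrite (le_trans (nc_dist_tri p.[u i] _ _))//.
rewrite (le_trans (lerD (hp _ ur) (nc_dist_tri p.[z] _ _)))//.
have := hp z (ltW zr); rewrite (nc_distC (G z)) => pz; lra.
Unshelve. all: by end_near. Qed.

Lemma nc_realexpi r t : 0 <= r -> nc (r%:C * expi t) = r.
Proof. by move=> r0; rewrite ncM nc_real nc_expi mulr1 ger0_norm. Qed.

Lemma ana_cmeas G r : ana G -> 0 <= r -> r < 1 -> cmeas (fun t => G (r%:C * expi t)).
Proof.
move=> aG r0 r1.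
have /choice[p hp] : forall n : nat, exists p : {poly C},
    forall z, nc z <= r -> nc (G z - p.[z]) <= n.+1%:R^-1.
  by move=> n; apply: aG => //; rewrite invr_gt0.
apply: (@cmeas_cvg _ (fun n t => (p n).[r%:C * expi t])) => [n|t _].
  under eq_fun do rewrite horner_coef; apply: cmeas_sum => i.
  apply: cmeasM; first exact: cmeas_cst.
  by apply: cmeasX; apply: cmeasM; [exact: cmeas_cst|exact: cmeas_expi].
rewrite /ccvg; apply: (@squeeze0 _ _ _ _ _ (@harmonic R)); last exact: cvg_harmonic.
by apply: nearW => n; rewrite nc_ge0 nc_distC hp// nc_realexpi.
Qed.

Lemma ana_cint G r : ana G -> 0 <= r -> r < 1 -> cint (fun t => G (r%:C * expi t)).
Proof.
move=> aG r0 r1; have [M [M0 hM]] := ana_bounded aG r1.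
apply: (@cint_bounded _ M); first exact: ana_cmeas.
by move=> t _; rewrite hM// nc_realexpi.
Qed.

(* A linear functional, continuous for the uniform norm on a disc of radius [r < 1], is
   determined by its values on monomials. *)
Lemma ana_functional0 (L : (C -> C) -> C) (r K : R) : r < 1 -> 0 < K ->
  (forall G e, ana G -> (forall z, nc z <= r -> nc (G z) <= e) -> nc (L G) <= K * e) ->
  (forall G H, ana G -> ana H -> L (fun z => G z + H z) = L G + L H) ->
  (forall c G, ana G -> L (fun z => c * G z) = c * L G) ->
  (forall n, L (fun z => z ^+ n) = 0) ->
  forall G, ana G -> L G = 0.
Proof.
move=> r1 K0 LK LD LZ LX.
have Ls (s : seq nat) (c : nat -> C) : L (fun z => \sum_(i <- s) c i * z ^+ i) = 0.
  elim: s => [|i s ih].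
    transitivity (L (fun=> 0 * 1)); last by rewrite (LZ 0 (fun=> 1)) ?mul0r//; exact: ana_cst.
    by congr L; apply/funext => z; rewrite big_nil mul0r.
  under eq_fun do rewrite big_cons.
  rewrite LD ?LZ ?LX ?ih ?mulr0 ?addr0//.
  - by apply: anaX; exact: ana_id.
  - by apply: anaZ; apply: anaX; exact: ana_id.
  - by apply: ana_sum => j; apply: anaZ; apply: anaX; exact: ana_id.
have Lp (p : {poly C}) : L (fun z => p.[z]) = 0.
  rewrite -[RHS](Ls (iota 0 (size p)) (fun i => p`_i)); congr L; apply/funext => z.
  by rewrite horner_coef -(big_mkord xpredT (fun i => p`_i * z ^+ i)) /index_iota subn0.
move=> G aG; apply/eqP; rewrite -nc_eq0 eq_le nc_ge0 andbT.
apply/ler_addgt0Pl => e e0; rewrite addr0.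
have eK : 0 < e / K by rewrite divr_gt0.
have [p hp] := aG r _ r1 eK.
have -> : G = (fun z => (G z - p.[z]) + p.[z]) by apply/funext => z; rewrite subrK.
have ap := ana_horner p.
rewrite LD//; last exact: anaB.
rewrite Lp addr0 (le_trans (LK _ _ _ hp))//; first exact: anaB.
by rewrite mulrCA divff ?mulr1// gt_eqF.
Qed.

End Analytic.

(** * Cauchy and Poisson kernels *)

Section Kernels.
Variable R : realType.
Local Notation C := R[i].
Local Notation "z ^*" := (conjc z) : ring_scope.
Local Notation Re := (@complex.Re R).
Local Notation Im := (@complex.Im R).
Local Notation T := (@Tdom R).
Implicit Types (G H : C -> C) (u psi : R -> C) (r e M t : R) (z w : C) (f : R -> R).

(** Cauchy kernel of the circle, the sum over [m >= 0] of [z^m e^(-imt)]. *)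
Definition ck z t : C := (1 - z * (expi t)^*)^-1.

Definition cauchyT u z : C := cavg (fun t => u t * ck z t).

Definition coef u (m : nat) : C := cavg (fun t => u t * (expi t ^+ m)^*).

Definition pois z t : R := (1 - nc z ^+ 2) / nc (1 - z * (expi t)^*) ^+ 2.

(** Herglotz transform, the exponent in the definition of [outer]: its real part is the Poisson
    integral of [f], and its value at the origin is the average of [f]. *)
Definition Hz f z : C := cavg (fun t => (expi t + z) / (expi t - z) * (f t)%:C).

Lemma nc_mulJexpi z t : nc (z * (expi t)^*) = nc z.
Proof. by rewrite ncM ncJ nc_expi mulr1. Qed.

Lemma sub1_mulJexpi_ge z t : 1 - nc z <= nc (1 - z * (expi t)^*).
Proof. by rewrite -[in leLHS](nc_mulJexpi z t) (le_trans _ (nc_sub_le _ _))// nc1. Qed.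

Lemma nc_ck_le r z t : nc z <= r -> r < 1 -> nc (ck z t) <= (1 - r)^-1.
Proof.
move=> zr r1; have h : 1 - r <= nc (1 - z * (expi t)^*).
  by rewrite (le_trans _ (sub1_mulJexpi_ge _ _))// lerD2l lerN2.
by rewrite ncV lef_pV2 ?posrE ?subr_gt0// (lt_le_trans _ h)// subr_gt0.
Qed.

Lemma ck_approx z t r N : nc z <= r -> r < 1 ->
  nc (ck z t - \sum_(m < N) z ^+ m * (expi t ^+ m)^*) <= r ^+ N / (1 - r).
Proof.
move=> zr r1; have := @nc_geo_le _ (z * (expi t)^*) r N.
rewrite nc_mulJexpi => /(_ zr r1); congr (nc (_ - _) <= _).
by apply: eq_bigr => i _; rewrite exprMn rmorphXn.
Qed.

Lemma cmeas_ck z : nc z < 1 -> cmeas (ck z).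
Proof.
move=> z1.
apply: (@cmeas_cvg _ (fun N t => \sum_(m < N) z ^+ m * (expi t ^+ m)^*)) => [n|t _].
  apply: cmeas_sum => i; apply: cmeasM; first exact: cmeas_cst.
  by apply: cmeasJ; exact: cmeas_expiX.
apply/ccvg_epsP => e e0; have [N hN] := geo_small 1 (nc_ge0 z) z1 e0.
exists N => // n /= Nn; rewrite nc_distC (le_trans (ck_approx t n (lexx _) z1))//.
by rewrite -[leLHS]mul1r hN.
Qed.

Lemma cint_ck u z : nc z < 1 -> cint u -> cint (fun t => u t * ck z t).
Proof.
move=> z1 iu; apply: (cintM_bounded iu (cmeas_ck z1) (c := (1 - nc z)^-1)) => t _.
exact: nc_ck_le.
Qed.

Lemma cint_expiXJ u m : cint u -> cint (fun t => u t * (expi t ^+ m)^*).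
Proof.
move=> iu; apply: (@cintM_bounded _ 1) => //; first by apply: cmeasJ; exact: cmeas_expiX.
by move=> t _; rewrite ncJ nc_expiX.
Qed.

(** Expanding the kernel under the average turns Fourier coefficients into Taylor coefficients. The
    uniform error yields both [ana_cauchyT] and the identification with [Pplus]. *)
Lemma cauchyT_approx u z r N : cint u -> nc z <= r -> r < 1 ->
  nc (cauchyT u z - \sum_(m < N) coef u m * z ^+ m) <=
    avg (fun t => nc (u t)) * (r ^+ N / (1 - r)).
Proof.
move=> iu zr r1; have z1 := le_lt_trans zr r1.
pose v (m : nat) t := z ^+ m * (u t * (expi t ^+ m)^*).
have iv m : cint (v m) by apply: cintZ; exact: cint_expiXJ.
have -> : \sum_(m < N) coef u m * z ^+ m = cavg (fun t => \sum_(m < N) v m t).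
  rewrite cavg_sum//; apply: eq_bigr => m _.
  by rewrite mulrC -cavgZ//; exact: cint_expiXJ.
rewrite -cavgB; [|exact: cint_ck|exact: cint_sum].
have iw : cint (fun t => u t * ck z t - \sum_(m < N) v m t).
  by apply: cintB; [exact: cint_ck|exact: cint_sum].
rewrite (le_trans (nc_cavg_le iw))// mulrC -avgZ; last exact: cint_nc.
apply: le_avg; [exact: cint_nc|by apply: intTZ; exact: cint_nc|] => t _.
have -> : u t * ck z t - \sum_(m < N) v m t =
    u t * (ck z t - \sum_(m < N) z ^+ m * (expi t ^+ m)^*).
  rewrite mulrBr mulr_sumr; congr (_ - _); apply: eq_bigr => m _; rewrite /v; ring.
by rewrite ncM mulrC ler_wpM2r ?nc_ge0//; exact: ck_approx.
Qed.

Lemma ana_cauchyT u : cint u -> ana (cauchyT u).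
Proof.
move=> iu; apply: ana_lim => r e r1 e0.
have [r0|r0] := ltP r 0.
  exists (fun=> 0); first exact: ana_cst.
  by move=> z zr; have := le_lt_trans (le_trans (nc_ge0 z) zr) r0; rewrite ltxx.
have [N hN] := geo_small (avg (fun t => nc (u t))) r0 r1 e0.
exists (fun z => \sum_(m < N) coef u m * z ^+ m).
  by apply: ana_sum => i; apply: anaZ; apply: anaX; exact: ana_id.
by move=> z zr; rewrite (le_trans (cauchyT_approx _ iu zr r1))// hN.
Qed.

Lemma fourierE u m : fourier u m%:Z = coef u m.
Proof. by apply: eq_cavg => t _; rewrite expiN -expi_natmul. Qed.

Lemma cauchyT_cvg u z : cint u -> nc z < 1 ->
  ccvg \oo (fun N => \sum_(m < N) coef u m * z ^+ m) (cauchyT u z).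
Proof.
move=> iu z1; apply/ccvg_epsP => e e0.
have [N hN] := geo_small (avg (fun t => nc (u t))) (nc_ge0 z) z1 e0.
exists N => // n /= Nn; rewrite nc_distC (le_trans (cauchyT_approx n iu (lexx _) z1))//.
exact: hN.
Qed.

Lemma PplusE psi z : cint psi -> nc z < 1 -> Pplus psi z = cauchyT psi z.
Proof.
move=> ipsi z1; rewrite /Pplus; apply: (@cvg_lim C^o); first exact: norm_hausdorff.
have /ccvgP := cauchyT_cvg ipsi z1; apply: cvg_trans.
apply: near_eq_cvg; apply: nearW => N.
by rewrite big_mkord; apply: eq_bigr => i _; rewrite fourierE.
Qed.

Lemma eq_limit_small z w K r : 0 <= r -> r < 1 ->
  (exists N, forall n, (N <= n)%N -> nc (z - w) <= K * (r ^+ n / (1 - r))) -> z = w.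
Proof.
move=> r0 r1 [N hN]; apply/eqP; rewrite -subr_eq0 -nc_eq0 eq_le nc_ge0 andbT.
apply/ler_addgt0Pl => e e0; rewrite addr0; have [N' hN'] := geo_small K r0 r1 e0.
by rewrite (le_trans (hN (maxn N N') (leq_maxl _ _)))// hN'// leq_maxr.
Qed.

Lemma cauchyT_expiX k z : nc z < 1 -> cauchyT (fun t => expi t ^+ k) z = z ^+ k.
Proof.
move=> z1; apply: (eq_limit_small (nc_ge0 z) z1); exists k.+1 => n kn.
have <- : \sum_(m < n) coef (fun t => expi t ^+ k) m * z ^+ m = z ^+ k.
  rewrite (bigD1 (Ordinal kn))//= big1 ?addr0; last first.
    move=> i; rewrite -val_eqE /= => ik.
    by rewrite /coef cavg_expi_orth eq_sym (negbTE ik) mul0r.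
  by rewrite /coef cavg_expi_orth eqxx mul1r.
by apply: cauchyT_approx => //; exact: cint_expiX.
Qed.

Lemma cauchyT_expiXJ k z : nc z < 1 ->
  cauchyT (fun t => (expi t ^+ k)^*) z = (k == 0%N)%:R.
Proof.
move=> z1; apply: (eq_limit_small (nc_ge0 z) z1); exists 1%N => n n0.
have <- : \sum_(m < n) coef (fun t => (expi t ^+ k)^*) m * z ^+ m = (k == 0%N)%:R.
  have ck0 m : coef (fun t => (expi t ^+ k)^*) m = ((m == 0) && (k == 0))%N%:R.
    rewrite /coef (@eq_cavg _ _ (fun t => (expi t ^+ (k + m))^*)); last first.
      by move=> t _; rewrite exprD rmorphM.
    rewrite cavgJ ?cavg_expiX; last exact: cint_expiX.
    by rewrite addn_eq0 andbC; case: (_ && _); rewrite ?conjc0 ?conjc1.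
  rewrite (bigD1 (Ordinal n0))//= big1 ?addr0; last first.
    move=> i; rewrite -val_eqE /= => ik.
    by rewrite ck0 (negbTE ik) mul0r.
  by rewrite ck0 eqxx expr0 mulr1.
by apply: cauchyT_approx => //; apply: cintJ; exact: cint_expiX.
Qed.

(** On monomials this is [cauchyT_expiX]; the defect [L] is linear and bounded for the uniform norm
    on radius [r], so [ana_functional0] extends the identity to [G]. *)
Lemma cauchy_formula G r z : ana G -> 0 <= r -> r < 1 -> nc z < 1 ->
  cauchyT (fun t => G (r%:C * expi t)) z = G (r%:C * z).
Proof.
move=> aG r0 r1 z1.
have iG H : ana H -> cint (fun t => H (r%:C * expi t)) by move=> aH; exact: ana_cint.
have iGk H : ana H -> cint (fun t => H (r%:C * expi t) * ck z t).
  by move=> aH; apply: cint_ck => //; exact: iG.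
have s0 : 0 < 1 - nc z by rewrite subr_gt0.
have nrz : nc (r%:C * z) <= r.
  by rewrite ncM nc_real ger0_norm// ler_piMr// ltW.
pose L H := cauchyT (fun t => H (r%:C * expi t)) z - H (r%:C * z).
suff /eqP : L G = 0 by rewrite subr_eq0 => /eqP.
apply: (@ana_functional0 _ L r ((1 - nc z)^-1 + 1)) => //.
- by rewrite addr_gt0// invr_gt0.
- move=> H e aH He; rewrite /L (le_trans (ncB_le _ _))// mulrDl mul1r lerD ?He//.
  rewrite (le_trans (nc_cavg_le (iGk _ aH)))// -[leRHS]avg_cst.
  apply: le_avg; [exact/cint_nc/iGk|exact: intT_cst|] => t _.
  by rewrite ncM mulrC ler_pM ?nc_ge0 ?nc_ck_le ?He ?nc_realexpi.
- move=> H1 H2 a1 a2; rewrite /L /cauchyT.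
  under eq_cavg do rewrite mulrDl.
  rewrite cavgD; [ring|exact: iGk|exact: iGk].
- move=> c H aH; rewrite /L /cauchyT.
  under eq_cavg do rewrite -mulrA.
  rewrite cavgZ; [ring|exact: iGk].
- move=> n; rewrite /L exprMn -(cauchyT_expiX n z1) /cauchyT.
  under eq_cavg do rewrite exprMn -mulrA.
  by rewrite cavgZ ?subrr//; apply: cint_ck => //; exact: cint_expiX.
Qed.

(** The conjugate kernel has only nonnegative frequencies, as [G] has, so only the two constant
    terms meet in the average. *)
Lemma cauchy_formula_conj G r z : ana G -> 0 <= r -> r < 1 -> nc z < 1 ->
  cavg (fun t => G (r%:C * expi t) * (ck z t)^*) = G 0.
Proof.
move=> aG r0 r1 z1.
have iG H : ana H -> cint (fun t => H (r%:C * expi t)) by move=> aH; exact: ana_cint.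
have iGk u : cint u -> cint (fun t => u t * (ck z t)^*).
  move=> iu; apply: (@cintM_bounded _ (1 - nc z)^-1) => //.
    by apply: cmeasJ; exact: cmeas_ck.
  by move=> t _; rewrite ncJ nc_ck_le.
have iGk' H : ana H -> cint (fun t => H (r%:C * expi t) * (ck z t)^*).
  by move=> aH; exact/iGk/iG.
have s0 : 0 < 1 - nc z by rewrite subr_gt0.
pose L H := cavg (fun t => H (r%:C * expi t) * (ck z t)^*) - H 0.
suff /eqP : L G = 0 by rewrite subr_eq0 => /eqP.
apply: (@ana_functional0 _ L r ((1 - nc z)^-1 + 1)) => //.
- by rewrite addr_gt0// invr_gt0.
- move=> H e aH He; rewrite /L (le_trans (ncB_le _ _))// mulrDl mul1r lerD ?He ?nc0//.
  rewrite (le_trans (nc_cavg_le (iGk' _ aH)))// -[leRHS]avg_cst.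
  apply: le_avg; [exact/cint_nc/iGk'|exact: intT_cst|] => t _.
  by rewrite ncM mulrC ncJ ler_pM ?nc_ge0 ?nc_ck_le ?He ?nc_realexpi.
- move=> H1 H2 a1 a2; rewrite /L.
  under eq_cavg do rewrite mulrDl.
  rewrite cavgD; [ring|exact: iGk'|exact: iGk'].
- move=> c H aH; rewrite /L.
  under eq_cavg do rewrite -mulrA.
  rewrite cavgZ; [ring|exact: iGk'].
- move=> n; rewrite /L.
  under eq_cavg do rewrite exprMn -mulrA -[expi _ ^+ n]conjcK -rmorphM.
  have ick : cint (fun t => (expi t ^+ n)^* * ck z t).
    by apply: cint_ck => //; apply: cintJ; exact: cint_expiX.
  rewrite cavgZ ?cavgJ; [|exact: ick|exact: cintJ].
  rewrite [cavg _]cauchyT_expiXJ//.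
  case: n {ick} => [|n]; first by rewrite eqxx rmorph1 !expr0 mulr1 subrr.
  by rewrite -[n.+1 == 0%N]/false rmorph0 mulr0 expr0n subrr.
Qed.

Lemma poisE z t : nc z < 1 -> (pois z t)%:C = ck z t + (ck z t)^* - 1.
Proof.
move=> z1; rewrite /pois /ck; move: (sub1_mulJexpi_ge z t).
rewrite -(nc_mulJexpi z t) in z1 *; move: (z * _) z1 => w w1 h.
have h0 : 0 < nc (1 - w) by apply: lt_le_trans h; rewrite subr_gt0.
have n0 : nc (1 - w) != 0 by rewrite gt_eqF.
have e : nc (1 - w) ^+ 2 = 1 - 2 * Re w + nc w ^+ 2.
  by rewrite !nc_sqr ReB ImB /= sub0r; ring.
have eW : nc w ^+ 2 = nc (1 - w) ^+ 2 - 1 + 2 * Re w by rewrite e; ring.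
rewrite invc_nc; apply: complex_eqP.
  rewrite ReB ReD ReJ Re_realM ReJ ReB /= eW; field.
  exact: n0.
by rewrite ImB ImD ImJ /= subrr subr0.
Qed.

Lemma pois_ge0 z t : nc z < 1 -> 0 <= pois z t.
Proof.
move=> z1; rewrite divr_ge0 ?sqr_ge0// subr_ge0 -(expr1n _ 2).
by rewrite ler_sqr ?nnegrE ?nc_ge0// ltW.
Qed.

Lemma measurable_pois z : nc z < 1 -> measurable_fun T (pois z).
Proof.
move=> z1; have [+ _] : cmeas (fun t => (pois z t)%:C) by
  under eq_fun do rewrite poisE//; apply: cmeasB; [|exact: cmeas_cst];
  apply: cmeasD; [|apply: cmeasJ]; exact: cmeas_ck.
by [].
Qed.

Lemma pois_le r z t : nc z <= r -> r < 1 -> pois z t <= 2 / (1 - r) + 1.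
Proof.
move=> zr r1; have z1 := le_lt_trans zr r1.
have -> : pois z t = nc (pois z t)%:C by rewrite nc_real ger0_norm ?pois_ge0.
rewrite poisE// (le_trans (ncB_le _ _))// nc1 lerD2r (le_trans (ncD_le _ _))// ncJ.
by have := @nc_ck_le r z t zr r1; lra.
Qed.

Lemma intTM_pois f z : nc z < 1 -> intT f -> intT (fun t => f t * pois z t).
Proof.
move=> z1 fi; apply: (@intTM_bounded _ (2 / (1 - nc z) + 1)) => //.
  exact: measurable_pois.
by move=> t _; rewrite ger0_norm ?pois_ge0// pois_le.
Qed.

Lemma cintM_pois u z : nc z < 1 -> cint u -> cint (fun t => u t * (pois z t)%:C).
Proof.
move=> z1 iu; apply: (@cintM_bounded _ (2 / (1 - nc z) + 1)) => //.
  by apply: cmeas_real; exact: measurable_pois.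
by move=> t _; rewrite nc_real ger0_norm ?pois_ge0// pois_le.
Qed.

(** By [poisE] the three terms of the kernel contribute [G (r z)], [G 0] and [- G 0]. *)
Lemma poisson_formula G r z : ana G -> 0 <= r -> r < 1 -> nc z < 1 ->
  cavg (fun t => G (r%:C * expi t) * (pois z t)%:C) = G (r%:C * z).
Proof.
move=> aG r0 r1 z1; have iG := ana_cint aG r0 r1.
under eq_cavg do rewrite poisE// mulrBr mulr1 mulrDr.
have i1 := cint_ck z1 iG.
have i2 : cint (fun t => G (r%:C * expi t) * (ck z t)^*).
  apply: (@cintM_bounded _ (1 - nc z)^-1) => //.
    by apply: cmeasJ; exact: cmeas_ck.
  by move=> t _; rewrite ncJ nc_ck_le.
rewrite cavgB//; last exact: cintD.
rewrite cavgD//; rewrite [cavg _]cauchy_formula// cauchy_formula_conj//.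
have nc0' : nc (0 : C) < 1 by rewrite nc0.
have := cauchy_formula aG r0 r1 nc0'; rewrite mulr0 => <-.
rewrite (@eq_cavg _ _ (fun t => G (r%:C * expi t) * ck 0 t)) ?addrK//.
by move=> t _; rewrite /ck mul0r subr0 invr1 mulr1.
Qed.

Lemma pois0 t : pois 0 t = 1.
Proof. by rewrite /pois nc0 mul0r subr0 nc1 expr0n expr1n subr0 divr1. Qed.

Lemma avg_pois z : nc z < 1 -> avg (pois z) = 1.
Proof.
move=> z1; have := poisson_formula (ana_cst 1) (lexx 0) ltr01 z1.
by under eq_cavg do rewrite mul1r; rewrite cavg_real => -[].
Qed.

Lemma herglotz_kernelE z t : nc z < 1 -> (expi t + z) / (expi t - z) = 2 * ck z t - 1.
Proof.
move=> z1; rewrite /ck.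
have h0 : 1 - z * (expi t)^* != 0.
  by rewrite -nc_gt0 (lt_le_trans _ (sub1_mulJexpi_ge _ _))// subr_gt0.
have -> : expi t - z = expi t * (1 - z * (expi t)^*).
  by rewrite mulrBr mulr1 mulrCA expiKJ mulr1.
have -> : expi t + z = expi t * (1 + z * (expi t)^*).
  by rewrite mulrDr mulr1 mulrCA expiKJ mulr1.
move: (z * _) h0 => w w1; have := expi_neq0 t; move: (expi t) => x x0.
by field; rewrite x0 w1.
Qed.

Lemma HzE f z : intT f -> nc z < 1 ->
  Hz f z = 2 * cauchyT (fun t => (f t)%:C) z - (avg f)%:C.
Proof.
move=> fi z1; rewrite -cavg_real /cauchyT -cavgZ; last by apply: cint_ck => //; exact: cint_real.
rewrite -cavgB; first last.
- exact: cint_real.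
- by apply: cintZ; apply: cint_ck => //; exact: cint_real.
by apply: eq_cavg => t _; rewrite herglotz_kernelE//; ring.
Qed.

Lemma ana_Hz f : intT f -> ana (Hz f).
Proof.
move=> fi; have aH : ana (fun z => 2 * cauchyT (fun t => (f t)%:C) z - (avg f)%:C).
  by apply: anaB; [apply: anaZ; apply: ana_cauchyT; exact: cint_real|exact: ana_cst].
by apply: ana_ext aH => z z1; rewrite HzE.
Qed.

Lemma Re_Hz f z : intT f -> nc z < 1 -> Re (Hz f z) = avg (fun t => f t * pois z t).
Proof.
move=> fi z1; rewrite Re_cavg; apply: eq_avg => t _.
rewrite mulrC Re_realM herglotz_kernelE//; congr (_ * _).
have -> : pois z t = Re (pois z t)%:C by [].
by rewrite poisE// !ReB ReD ReJ mulr_natl ReD.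
Qed.

Lemma Hz0 f : Hz f 0 = (avg f)%:C.
Proof.
rewrite -cavg_real; apply: eq_cavg => t _.
by rewrite addr0 subr0 divff ?mul1r// expi_neq0.
Qed.

Lemma Re_Hz_ge0 f z : intT f -> (forall t, T t -> 0 <= f t) -> nc z < 1 -> 0 <= Re (Hz f z).
Proof.
move=> fi f0 z1; rewrite Re_Hz//; apply: avg_ge0 => t Tt.
by rewrite mulr_ge0 ?f0 ?pois_ge0.
Qed.

End Kernels.

(** * Radial limits of Poisson integrals and Fatou's theorem *)

Section PoissonRadial.
Variable R : realType.
Local Notation C := R[i].
Local Notation "z ^*" := (conjc z) : ring_scope.
Local Notation Re := (@complex.Re R).
Local Notation Im := (@complex.Im R).
Local Notation T := (@Tdom R).
Local Notation mu := (@lebesgue_measure R).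
Implicit Types (r e t s h : R) (f : R -> R).

(** [1 - cos x = 2 sin^2 (x / 2)], and [|sin y| >= 3/4 |y|] for [|y| <= 1/2] because
    [|sin y - y| <= |y|^3 <= |y| / 4]; this gives [9/32], slightly more than [1/4]. *)
Lemma cos_le_quad (x : R) : `|x| <= 1 -> x ^+ 2 / 4 <= 1 - cos x.
Proof.
move=> x1; have -> : cos x = 1 - 2 * sin (x / 2) ^+ 2.
  rewrite {1}(_ : x = (x / 2) *+ 2) ?cos_mulr2n; last by rewrite -[RHS]mulr_natl; field.
  by have := cos2Dsin2 (x / 2); lra.
have y1 : `|x / 2| <= 2^-1 by rewrite normrM (ger0_norm (_ : 0 <= 2^-1)) // ler_piMl.
have := sin_sub_le (x / 2); rewrite -real_normK ?num_real// -exprSr => h.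
have h2 : `|sin (x / 2)| >= 3 / 4 * `|x / 2|.
  have : `|x / 2| ^+ 3 <= `|x / 2| / 4.
    rewrite exprS mulrC [leRHS]mulrC ler_wpM2r// (_ : 4^-1 = 2^-1 ^+ 2); last by field.
    by rewrite ler_sqr ?nnegrE.
  have := ler_distD (sin (x / 2)) 0 (x / 2); rewrite !sub0r !normrN => h1.
  lra.
have h3 : (3 / 4 * `|x / 2|) ^+ 2 <= sin (x / 2) ^+ 2.
  by rewrite -[leRHS]real_normK ?num_real// ler_sqr ?nnegrE// mulr_ge0.
have e : (3 / 4 * `|x / 2|) ^+ 2 = 9 / 64 * x ^+ 2.
  by rewrite exprMn real_normK ?num_real//; field.
have := sqr_ge0 x; lra.
Qed.

Lemma pois_expiE r t s : 0 <= r ->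
  pois (r%:C * expi t) s = (1 - r ^+ 2) / ((1 - r) ^+ 2 + 2 * r * (1 - cos (t - s))).
Proof.
move=> r0; rewrite /pois nc_realexpi//; congr (_ / _).
have -> : r%:C * expi t * (expi s)^* = r%:C * expi (t - s) by rewrite -mulrA -expiN expiD.
rewrite nc_sqr ReB ImB Re_realM Im_realM /= sub0r sqrrN.
have := cos2Dsin2 (t - s); set c := cos _; set d := sin _ => cd.
by rewrite exprMn (_ : d ^+ 2 = 1 - c ^+ 2); [ring|rewrite -cd; ring].
Qed.

Lemma cos_le_far (x a : R) : 0 <= a <= 1 -> a <= `|x| -> `|x| <= 2 * pi - a -> cos x <= cos a.
Proof.
move=> /andP[a0 a1] ax xa.
have -> : cos x = cos `|x|.
  by have [h|h] := ltP 0 x; [rewrite gtr0_norm|rewrite ler0_norm// cosN].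
have p2 : 2 <= pi :> R by exact: pi_ge2.
move: `|x| ax xa => y ay ya.
have [yp|py] := leP y pi.
  rewrite le_eqVlt; move: ay; rewrite le_eqVlt => /predU1P[->|ay]; first by rewrite eqxx.
  apply/orP; right; rewrite ltr_cos// in_itv/=; lra.
have -> : cos y = cos (2 * pi - y).
  rewrite -[RHS]cosN opprB -[RHS]cosD2pi; congr cos.
  by rewrite mulr_natl subrK.
have ay' : a <= 2 * pi - y by lra.
have yp : 2 * pi - y <= pi by lra.
move: (2 * pi - y) ay' yp => x' ay' yp.
rewrite le_eqVlt; move: ay'; rewrite le_eqVlt => /predU1P[->|ay']; first by rewrite eqxx.
apply/orP; right; rewrite ltr_cos// in_itv/=; lra.
Qed.

(** The ends of [[0, 2 pi]] are one point of the circle, so being far from [t] takes both a lower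
    and an upper bound on [|t - s|]. *)
Lemma pois_far r t s a : 2^-1 <= r < 1 -> 0 < a <= 1 -> a <= `|t - s| ->
  `|t - s| <= 2 * pi - a -> pois (r%:C * expi t) s <= 8 / a ^+ 2 * (1 - r).
Proof.
move=> /andP[r2 r1] /andP[a0 a1] h1 h2.
have r0 : 0 <= r by rewrite (le_trans _ r2).
rewrite pois_expiE//.
have c1 : cos (t - s) <= cos a by apply: cos_le_far => //; rewrite ltW.
have c2 : a ^+ 2 / 4 <= 1 - cos a by apply: cos_le_quad; rewrite ger0_norm// ltW.
have a2 : 0 < a ^+ 2 by rewrite exprn_gt0.
have D : a ^+ 2 / 4 <= (1 - r) ^+ 2 + 2 * r * (1 - cos (t - s)).
  have := sqr_ge0 (1 - r); nra.
rewrite (@le_trans _ _ ((1 - r ^+ 2) / (a ^+ 2 / 4)))//.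
  rewrite ler_wpM2l//; first by rewrite subr_ge0 expr_le1// ltW.
  by rewrite lef_pV2 ?posrE// ?divr_gt0// (lt_le_trans _ D)// divr_gt0.
have -> : (1 - r ^+ 2) / (a ^+ 2 / 4) = 4 * (1 + r) / a ^+ 2 * (1 - r).
  by field; rewrite gt_eqF.
rewrite ler_wpM2r ?subr_ge0 ?(ltW r1)// ler_wpM2r ?invr_ge0 ?(ltW a2)//; lra.
Qed.

Lemma pois_near r t s : 2^-1 <= r < 1 -> `|t - s| <= 1 ->
  pois (r%:C * expi t) s <= 2 * (1 - r) / ((1 - r) ^+ 2 + (t - s) ^+ 2 / 4).
Proof.
move=> /andP[r2 r1] h1.
have r0 : 0 <= r by rewrite (le_trans _ r2).
rewrite pois_expiE//.
have c2 := cos_le_quad h1.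
have D0 : 0 < (1 - r) ^+ 2 + (t - s) ^+ 2 / 4.
  by rewrite ltr_pwDl ?exprn_gt0 ?subr_gt0// divr_ge0// sqr_ge0.
have D : (1 - r) ^+ 2 + (t - s) ^+ 2 / 4 <= (1 - r) ^+ 2 + 2 * r * (1 - cos (t - s)).
  by rewrite lerD2l; have := sqr_ge0 (t - s); nra.
rewrite (@le_trans _ _ ((1 - r ^+ 2) / ((1 - r) ^+ 2 + (t - s) ^+ 2 / 4)))//.
  rewrite ler_wpM2l//; first by rewrite subr_ge0 expr_le1// ltW.
  by rewrite lef_pV2 ?posrE// (lt_le_trans _ D).
by rewrite ler_wpM2r ?invr_ge0 ?(ltW D0)//; nra.
Qed.

(* The Poisson kernel is dominated by a geometric superposition of normalized
   indicators of balls, which is what the Lebesgue differentiation theorem controls. *)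
Lemma cauchy_kernel_dyadic d a : 0 < d -> d <= a -> exists N : nat,
  (forall j, (j <= N)%N -> 2 ^+ j * d <= 2 * a) /\
  forall x : R, `|x| < a -> 2 * d / (d ^+ 2 + x ^+ 2 / 4) <=
    \sum_(j < N.+1) 32 / (4 ^+ j * d) * (`|x| < 2 ^+ j * d)%R%:R.
Proof.
move=> d0 da.
have ex : exists n, a <= 2 ^+ n * d.
  have ad : 0 <= a / d by rewrite divr_ge0 ?ltW// (lt_le_trans d0).
  exists (Num.bound (a / d)); rewrite -ler_pdivrMr// (le_trans (ltW (archi_boundP ad)))//.
  by rewrite -natrX ler_nat ltnW// ltn_expl.
(* With [N] least such that [a <= 2^N d], every [|x| < a] is caught by one of the balls, while
   minimality keeps all radii at most [2 a]. *)
have [N hN minN] := ex_minnP ex; exists N; split.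
  move=> j jN; apply: (@le_trans _ _ (2 ^+ N * d)).
    by rewrite ler_wpM2r ?(ltW d0)// ler_weXn2l// ler1n.
  case: N hN minN {jN} => [|N] hN minN; first by rewrite expr0; lra.
  have : 2 ^+ N * d < a by rewrite ltNge; apply/negP => /minN; rewrite ltnn.
  by rewrite exprS -mulrA => /ltW; rewrite ler_pM2l.
move=> x xa.
have exj : exists j, `|x| < 2 ^+ j * d by exists N; exact: lt_le_trans xa hN.
have [j hj minj] := ex_minnP exj.
have jN : (j < N.+1)%N by rewrite ltnS minj// (lt_le_trans xa).
(* The term of the least admissible [j] alone dominates: for [j > 0] minimality gives
   [|x| >= 2^(j-1) d], that is [4^j d^2 <= 4 x^2]. *)
rewrite (bigD1 (Ordinal jN))//= hj mulr1.
set S := \sum_(_ < _ | _) _.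
have S0 : 0 <= S.
  by rewrite sumr_ge0// => i _; rewrite mulr_ge0// divr_ge0// mulr_ge0 ?exprn_ge0 ?(ltW d0).
apply: (@le_trans _ _ (32 / (4 ^+ j * d))); last by rewrite lerDl.
have d2 : 0 < d ^+ 2 by rewrite exprn_gt0.
have p4 : 0 < 4 ^+ j :> R by rewrite exprn_gt0.
have x2 : 0 <= x ^+ 2 / 4 by rewrite divr_ge0// sqr_ge0.
suff h : 4 ^+ j * d ^+ 2 <= 16 * (d ^+ 2 + x ^+ 2 / 4).
  rewrite ler_pdivrMr; last by rewrite ltr_pwDl.
  rewrite mulrAC ler_pdivlMr; last by rewrite mulr_gt0.
  by rewrite [leLHS](_ : _ = 2 * (4 ^+ j * d ^+ 2)); [lra|ring].
case: j hj minj {jN S S0 p4} => [|j] hj minj; first by rewrite expr0; lra.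
have : 2 ^+ j * d <= `|x| by rewrite leNgt; apply/negP => /minj; rewrite ltnn.
have p2 : 0 <= 2 ^+ j * d by rewrite mulr_ge0 ?exprn_ge0 ?(ltW d0).
rewrite -ler_sqr ?nnegrE// real_normK ?num_real// exprMn -exprM mulnC exprM.
rewrite (_ : 2 ^+ 2 = 4 :> R); last by ring.
rewrite [4 ^+ j.+1]exprS -mulrA; lra.
Qed.

(** Translates the mean oscillation over a ball, the language of Lebesgue points, into an average
    against the indicator occurring in [cauchy_kernel_dyadic]; [h *+ 2] is the length of the
    ball. *)
Lemma avg_ball f t h a : intT f -> 0 < t < 2 * pi -> 0 < h -> ball t h `<=` T ->
  (davg (f \_ T) t h <= a%:E)%E ->
  avg (fun s => `|f s - f t| * (`|t - s| < h)%R%:R) <= (2 * pi)^-1 * (h *+ 2 * a).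
Proof.
move=> fi /andP[t0 t2] h0 bT hd.
rewrite /avg ler_wpM2l ?invr_ge0 ?(ltW (twopi_gt0 R))//.
have phi_int : intT (fun s => `|f s - f t|).
  by apply: intT_norm; apply: intTB => //; exact: intT_cst.
have mb : measurable (ball t h : set R) by exact: measurable_ball.
rewrite (@eq_Rintegral _ _ _ mu T ((fun s => `|f s - f t|) \_ (ball t h))); last first.
  move=> s _; rewrite patchE; case: ifPn => [/set_mem|/negP sb].
    by rewrite /ball /= => ->; rewrite mulr1.
  case: ltP => [ts|]; last by rewrite mulr0.
  by exfalso; apply: sb; apply/mem_set.
rewrite -Rintegral_mkcondr (_ : T `&` ball t h = ball t h); last exact/setIidPr.
have bi : mu.-integrable (ball t h) (EFin \o (fun s => `|f s - f t|)).
  by apply: integrableS phi_int => //; exact: measurable_Tdom.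
rewrite -lee_fin /Rintegral fineK; last exact: integrable_fin_num.
move: hd; rewrite /davg /iavg.
have -> : (\int[mu]_(y in ball t h) `|((center ((f \_ T) t) \o (f \_ T)) y)%:E| =
           \int[mu]_(x in ball t h) (`|f x - f t|)%:E)%E.
  apply: eq_integral => s /set_mem sb /=; rewrite !patchE !mem_set//.
    by apply: bT; exact: ballxx.
  exact: bT.
rewrite lebesgue_measure_ball ?(ltW h0)// => hd.
have h2 : 0 < h *+ 2 by rewrite mulrn_wgt0.
rewrite EFinM -lee_pdivrMl//; move: hd.
by rewrite inver gt_eqF.
Qed.

Lemma intT_sum I (l : seq I) (f : I -> R -> R) :
  (forall i, intT (f i)) -> intT (fun t => \sum_(i <- l) f i t).
Proof.
move=> h; elim: l => [|i l ih]; first by under eq_fun do rewrite big_nil; exact: intT_cst.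
by under eq_fun do rewrite big_cons; exact: intTD.
Qed.

Lemma avg_sum I (l : seq I) (f : I -> R -> R) : (forall i, intT (f i)) ->
  avg (fun t => \sum_(i <- l) f i t) = \sum_(i <- l) avg (f i).
Proof.
move=> h; elim: l => [|i l ih].
  by rewrite big_nil -[RHS]avg_cst; apply: eq_avg => t _; rewrite big_nil.
rewrite big_cons -ih -avgD//; last exact: intT_sum.
by apply: eq_avg => t _; rewrite big_cons.
Qed.

Lemma aeT_interior : aeT (fun t : R => 0 < t < 2 * pi).
Proof.
have null (x : R) : aeT (fun t => t != x).
  exists [set x]; split => //; first exact: lebesgue_measure_set1.
  by move=> t /= /not_implyP[_ /negP]; rewrite negbK => /eqP.
apply: aeTS2 (null 0) (null (2 * pi)) => t /=.
rewrite /Tdom /= in_itv /= => /andP[t0 t2] n0 n2.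
by rewrite !lt_neqAle t0 t2 n2 eq_sym n0.
Qed.

Lemma intT_ball f t h : intT f -> intT (fun s => f s * (`|t - s| < h)%R%:R).
Proof.
move=> fi; apply: (@intTM_bounded _ 1) => //; last first.
  by move=> s _; case: (_ < _); rewrite ?normr1 ?normr0.
rewrite (_ : (fun s => _) = \1_(ball t h)); first by apply: measurable_indic; exact: measurable_ball.
apply/funext => s; rewrite indicE; congr (nat_of_bool _)%:R.
by apply/idP/idP => [h1|/set_mem//]; apply/mem_set.
Qed.

Lemma sum_pow_half_le n : \sum_(j < n) (2^-1 : R) ^+ j <= 2.
Proof.
have h : (1 - 2^-1 : R) * \sum_(j < n) 2^-1 ^+ j = 1 - 2^-1 ^+ n.
  by rewrite -opprB mulNr -subrX1 opprB.
have : (2^-1 : R) ^+ n >= 0 by rewrite exprn_ge0.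
move: h; set S := \sum_(_ < _) _; lra.
Qed.

Lemma twopi_ge1 : 1 <= 2 * pi :> R.
Proof. by have := pi_ge2 R; lra. Qed.

(** The kernel has average [1], so it suffices to average [|f s - f t|] against it: away from [t]
    the kernel is [O(1 - r)], and close to [t] each dyadic ball is controlled by the Lebesgue point
    property. *)
Lemma pois_radial_pt f t : intT f -> 0 < t < 2 * pi -> lebesgue_pt (f \_ T) t ->
  avg (fun s => f s * pois (r%:C * expi t) s) @[r --> at_left 1] --> f t.
Proof.
move=> fi t02 lt; have /andP[t0 t2] := t02.
pose phi s := `|f s - f t|.
have phi_int : intT phi by apply: intT_norm; apply: intTB => //; exact: intT_cst.
suff main e : 0 < e -> \forall r \near (1 : R)^'-,
    avg (fun s => phi s * pois (r%:C * expi t) s) <= e.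
  apply/cvgrPdist_le => e e0; near=> r.
  have r1 : r < 1 by near: r; exact: nbhs_left_lt.
  have r0 : 0 <= r by apply: ltW; near: r; exact: nbhs_left_gt.
  have z1 : nc (r%:C * expi t) < 1 by rewrite nc_realexpi.
  have pi_ : intT (pois (r%:C * expi t)).
    by have := intTM_pois z1 (intT_cst 1); under eq_fun do rewrite mul1r.
  rewrite -[f t]mulr1 -(avg_pois z1) -avgZ// -avgB//; [|exact: intTZ|exact: intTM_pois].
  apply: le_trans (avg_le_norm _) _; first by apply: intTB; [exact: intTZ|exact: intTM_pois].
  rewrite (@eq_avg _ _ (fun s => phi s * pois (r%:C * expi t) s)); first by near: r; exact: main.
  by move=> s _; rewrite -mulrBl normrM distrC (ger0_norm (pois_ge0 _ _)).
move=> e0.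
(* Ball [j] will contribute at most [64 e' / 2^j], the geometric sum is at most [2], and the near
   part is allowed [e / 2]; hence [256]. *)
have [e' e'0 ee'] : exists2 e', 0 < e' & 16 * 16 * e' = e.
  by exists (e / (16 * 16)); [rewrite divr_gt0// mulr_gt0|field].
have [h0 h00 hh0] : exists2 h0, 0 < h0 & forall h, 0 < h < h0 -> (davg (f \_ T) t h <= e'%:E)%E.
  have /fine_cvgP[dfin dcv] : davg (f \_ T) t h @[h --> (0 : R)^'+] --> 0%:E := lt.
  have : \forall h \near (0 : R)^'+, (davg (f \_ T) t h <= e'%:E)%E.
    near=> h; rewrite -[davg _ _ _]fineK; last by near: h; exact: dfin.
    rewrite lee_fin (le_trans (ler_norm _))//; near: h.
    exact: (@cvgr0_norm_le _ _ _ _ _ _ dcv _ e'0).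
  move=> [h0 /= h00 hb]; exists h0 => // h /andP[h1 h2]; apply: hb => //.
  by rewrite /= sub0r normrN gtr0_norm.
(* The balls used have radius at most [2 a]: [h0 / 4] keeps them below the scale [h0], the bounds by
   [t / 2] and [(2 pi - t) / 2] keep them inside the interval, and [1/2] meets the range of the
   kernel estimates. *)
have [a [a0 a1 a2 a3 a4]] :
    exists a, [/\ 0 < a, a <= 2^-1, a <= h0 / 4, a <= t / 2 & a <= (2 * pi - t) / 2].
  exists (Num.min (Num.min (2^-1) (h0 / 4)) (Num.min (t / 2) ((2 * pi - t) / 2))).
  by rewrite !lt_min !ge_min !lexx !orbT !divr_gt0 ?subr_gt0// invr_gt0 ltr0n; split.
have A0 : 0 <= avg phi by apply: avg_ge0 => s _; exact: normr_ge0.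
have [K K0 eK] : exists2 K, 0 <= K & K = 8 / a ^+ 2 * avg phi.
  by exists (8 / a ^+ 2 * avg phi) => //; rewrite mulr_ge0// divr_ge0// sqr_ge0.
near=> r.
have r1 : r < 1 by near: r; exact: nbhs_left_lt.
have r2 : 2^-1 <= r by apply: ltW; near: r; apply: nbhs_left_gt; lra.
have ra : 1 - a <= r by apply: ltW; near: r; apply: nbhs_left_gt; lra.
(* Makes the far part [K (1 - r)] at most [e / 2]; [K + 1] avoids a zero denominator. *)
have rK : 1 - e / (2 * (K + 1)) <= r.
  apply: ltW; near: r; apply: nbhs_left_gt.
  by rewrite ltrBlDr ltrDl divr_gt0// mulr_gt0//; lra.
have d0 : 0 < 1 - r by rewrite subr_gt0.
have da : 1 - r <= a by rewrite lerBlDr -lerBlDl.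
have [N [hN hdy]] := cauchy_kernel_dyadic d0 da.
have [d ed] : exists d, d = 1 - r by exists (1 - r).
have rd : r = 1 - d by rewrite ed subKr.
rewrite -ed in d0 da hN hdy.
pose near_part (j : 'I_N.+1) s := 32 / (4 ^+ j * d) * (phi s * (`|t - s| < 2 ^+ j * d)%R%:R).
have np_int j : intT (near_part j) by apply: intTZ; exact: intT_ball.
have z1 : nc (r%:C * expi t) < 1 by rewrite nc_realexpi// (le_trans _ r2).
apply: (@le_trans _ _ (avg (fun s => 8 / a ^+ 2 * d * phi s + \sum_j near_part j s))).
  apply: le_avg; first exact: intTM_pois.
    by apply: intTD; [exact: intTZ|exact: intT_sum].
  move=> s; rewrite /Tdom /= in_itv /= => /andP[s0 s2].
  have phi0 : 0 <= phi s by exact: normr_ge0.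
  have S0 : 0 <= \sum_j near_part j s.
    apply: sumr_ge0 => j _; apply: mulr_ge0; last exact: mulr_ge0.
    by rewrite divr_ge0// mulr_ge0 ?exprn_ge0// (ltW d0).
  have [ts|ts] := ltP `|t - s| a.
    apply: (@le_trans _ _ (\sum_j near_part j s)); last first.
      by rewrite lerDr mulr_ge0// mulr_ge0 ?(ltW d0)// divr_ge0// sqr_ge0.
    rewrite /near_part; under eq_bigr do rewrite mulrCA.
    rewrite -mulr_sumr ler_wpM2l// (le_trans _ (hdy _ ts))//.
    by rewrite ed; apply: pois_near; [rewrite r2|rewrite (le_trans (ltW ts))// (le_trans a1)// invf_le1// ler1n].
  apply: (@le_trans _ _ (8 / a ^+ 2 * d * phi s)); last by rewrite lerDl.
  rewrite mulrC ler_wpM2r// ed; apply: pois_far => //; first by rewrite r2.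
    by rewrite a0 (le_trans a1)// invf_le1// ler1n.
  by rewrite ler_norml; clear -a0 a3 a4 s0 s2; lra.
rewrite avgD; [|exact: intTZ|exact: intT_sum].
rewrite avgZ// avg_sum//.
have h1 : 8 / a ^+ 2 * d * avg phi <= e / 2.
  have -> : 8 / a ^+ 2 * d * avg phi = K * d by rewrite eK; ring.
  have K1 : 0 < 2 * (K + 1) by rewrite mulr_gt0// ltr_wpDl.
  have h : d * (2 * (K + 1)) <= e by rewrite -ler_pdivlMr// ed lerBlDr -lerBlDl.
  by clear -h d0; nra.
suff h2 : \sum_j avg (near_part j) <= e / 2 by rewrite [leRHS](splitr e) lerD.
apply: (@le_trans _ _ (\sum_(j < N.+1) 64 * e' * 2^-1 ^+ j)); last first.
  rewrite -mulr_sumr; have := sum_pow_half_le N.+1; move: (\sum_(_ < _) _) => S.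
  by clear -ee' e'0; nra.
apply: ler_sum => j _.
have hj0 : 0 < 2 ^+ j * d by rewrite mulr_gt0// exprn_gt0.
have hj : 2 ^+ j * d <= 2 * a by apply: hN; rewrite -ltnS.
rewrite /near_part avgZ; last exact: intT_ball.
have c0 : 0 <= 32 / (4 ^+ j * d) by rewrite divr_ge0// mulr_ge0 ?exprn_ge0// ltW.
have bT : ball t (2 ^+ j * d) `<=` T.
  move=> s; rewrite /ball /= ltr_norml => /andP[s1 s2].
  by rewrite /Tdom /= in_itv /=; clear -s1 s2 hj a3 a4; lra.
have hd : (davg (f \_ T) t (2 ^+ j * d) <= e'%:E)%E.
  by apply: hh0; rewrite hj0 (le_lt_trans hj)//; clear -a2 h00; lra.
apply: le_trans (ler_wpM2l c0 (avg_ball fi t02 hj0 bT hd)) _.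
have tp : (2 * pi)^-1 <= 1 :> R by rewrite invf_le1 ?twopi_gt0// twopi_ge1.
have -> : 32 / (4 ^+ j * d) * ((2 * pi)^-1 * (2 ^+ j * d *+ 2 * e')) =
          (2 * pi)^-1 * (64 * e' * 2^-1 ^+ j).
  have -> : (4 : R) ^+ j = 2 ^+ j * 2 ^+ j by rewrite -exprMn; congr (_ ^+ _); ring.
  have p2 : (2 : R) ^+ j != 0 by rewrite expf_neq0.
  rewrite exprVn -(mulr_natl (2 ^+ j * d)); have := lt0r_neq0 (pi_gt0 R).
  move: (pi : R) => p p0; field.
  by rewrite p2 p0 (gt_eqF d0).
by rewrite ler_piMl// mulr_ge0 ?exprn_ge0// mulr_ge0// ltW.
Unshelve. all: by end_near. Qed.

Lemma pois_radial f : intT f ->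
  aeT (fun t => avg (fun s => f s * pois (r%:C * expi t) s) @[r --> at_left 1] --> f t).
Proof.
move=> fi; have L : aeT (fun t => lebesgue_pt (f \_ T) t).
  have := lebesgue_differentiation (integrable_locally_restrict (@measurable_Tdom R) fi).
  by rewrite /aeT; apply: (@filterS _ _ (ae_filter_ringOfSetsType mu)) => t h _.
by apply: aeTS2 aeT_interior L => t _ ti; exact: pois_radial_pt.
Qed.

End PoissonRadial.

(** * Measurable boundary functions and square means over circles *)

Section Boundary.
Variable R : realType.
Local Notation C := R[i].
Local Notation "z ^*" := (conjc z) : ring_scope.
Local Notation Re := (@complex.Re R).
Local Notation Im := (@complex.Im R).
Local Notation T := (@Tdom R).
Local Notation mu := (@lebesgue_measure R).
Implicit Types (G H : C -> C) (r e t s M : R) (f : R -> R) (z w : C).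

(** Upper limits exist at every [t], which is what gives measurability. The radii are a parameter
    because Fatou's theorem first obtains convergence along a subsequence of radii only. *)
Definition blim (rho : nat -> R) G t : C :=
  fine (limn_esup (fun n => (Re (G ((rho n)%:C * expi t)))%:E)) +i*
  fine (limn_esup (fun n => (Im (G ((rho n)%:C * expi t)))%:E)).

Definition rn (n : nat) : R := 1 - n.+2%:R^-1.

(* Unlike [bval], which is an unspecified value where the radial limit fails to exist,
   this boundary function is measurable on the whole circle. *)
Definition bd G t : C := blim rn G t.

Definition ae_lim G : Prop := aeT (fun t => radial_limit G t (bd G t)).

Lemma rn_ge0 n : 0 <= rn n.
Proof. by rewrite subr_ge0 invf_le1 ?ler1n ?ltr0n. Qed.

Lemma rn_lt1 n : rn n < 1.
Proof. by rewrite ltrBlDr ltrDl invr_gt0 ltr0n. Qed.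

Lemma rn_cvg : rn n @[n --> \oo] --> (1 : R).
Proof.
rewrite -[X in _ --> X]subr0; apply: cvgB; first exact: cvg_cst.
by have := @cvg_harmonic R; rewrite -(cvg_shiftS (@harmonic R)).
Qed.

Lemma seq_at_left (rho : nat -> R) : (forall n, rho n < 1) ->
  rho n @[n --> \oo] --> (1 : R) -> rho n @[n --> \oo] --> (1 : R)^'-.
Proof.
move=> rho1 rhol A hA.
have [N _ hN] := rhol _ hA.
by exists N => // n /= Nn; exact: (hN n Nn (rho1 n)).
Qed.

Lemma rn_at_left : rn n @[n --> \oo] --> (1 : R)^'-.
Proof. by apply: seq_at_left; [exact: rn_lt1|exact: rn_cvg]. Qed.

Lemma radial_limit_seq (rho : nat -> R) G t w : rho n @[n --> \oo] --> (1 : R)^'- ->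
  radial_limit G t w -> ccvg \oo (fun n => G ((rho n)%:C * expi t)) w.
Proof. by move=> h /radial_limitP; exact: ccvg_comp h. Qed.

Lemma blim_cvg rho G t w : ccvg \oo (fun n => G ((rho n)%:C * expi t)) w -> blim rho G t = w.
Proof.
move=> /ccvg_ReIm[a b]; rewrite /blim.
have a' : (Re (G ((rho n)%:C * expi t)))%:E @[n --> \oo] --> (Re w)%:E.
  by apply: cvg_EFin => //; exact: nearW.
have b' : (Im (G ((rho n)%:C * expi t)))%:E @[n --> \oo] --> (Im w)%:E.
  by apply: cvg_EFin => //; exact: nearW.
by rewrite (cvg_limn_einf_sup a').2 (cvg_limn_einf_sup b').2 /=; case: (w).
Qed.

Lemma bd_radial G t w : radial_limit G t w -> bd G t = w.
Proof. by move=> h; apply: blim_cvg; apply: radial_limit_seq h; exact: rn_at_left. Qed.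

Lemma blim_meas rho G : (forall n, 0 <= rho n) -> (forall n, rho n < 1) -> ana G ->
  cmeas (blim rho G).
Proof.
move=> h0 h1 aG; have m n := ana_cmeas aG (h0 n) (h1 n).
have fm : measurable_fun [set: \bar R] (@fine R) by exact: fine_measurable.
split => /=.
  apply: (measurableT_comp fm); apply: measurable_fun_limn_esup => n.
  by apply/measurable_EFinP; case: (m n).
apply: (measurableT_comp fm); apply: measurable_fun_limn_esup => n.
by apply/measurable_EFinP; case: (m n).
Qed.

Lemma bd_meas G : ana G -> cmeas (bd G).
Proof. by apply: blim_meas; [exact: rn_ge0|exact: rn_lt1]. Qed.

Lemma ae_limP G : aeT (fun t => exists w, radial_limit G t w) -> ae_lim G.
Proof. by apply: aeTS => t _ [w h]; rewrite (bd_radial h). Qed.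

Lemma at_left_disc (P : R -> Prop) : (forall r, 0 <= r -> r < 1 -> P r) ->
  \forall r \near (1 : R)^'-, P r.
Proof.
move=> h; near=> r; apply: h.
  by apply: ltW; near: r; exact: nbhs_left_gt.
by near: r; exact: nbhs_left_lt.
Unshelve. all: by end_near. Qed.

Lemma radial_limit_ext G H t w : (forall z, disc z -> G z = H z) ->
  radial_limit G t w -> radial_limit H t w.
Proof.
move=> GH /radial_limitP h; apply/radial_limitP; apply: ccvg_near_eq h.
apply: at_left_disc => r r0 r1; apply: GH.
by have : nc (r%:C * expi t) < 1 by rewrite nc_realexpi.
Qed.

Lemma radial_limit_norm_le G t w M : (forall z, disc z -> nc (G z) <= M) ->
  radial_limit G t w -> nc w <= M.
Proof.
move=> GM /radial_limitP /ccvg_norm h; apply: (cvgr_to_le h).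
apply: at_left_disc => r r0 r1; apply: GM.
by have : nc (r%:C * expi t) < 1 by rewrite nc_realexpi.
Qed.

Lemma sqr_dist_le (x y : C) : `|nc x ^+ 2 - nc y ^+ 2| <= nc (x - y) * (nc x + nc y).
Proof.
rewrite subr_sqr normrM [X in _ * X]ger0_norm ?addr_ge0 ?nc_ge0//.
by rewrite ler_wpM2r ?addr_ge0 ?nc_ge0// nc_dist_dist.
Qed.

Definition nsq (u : R -> C) : R := avg (fun t => nc (u t) ^+ 2).

Lemma intT_nsq M (u : R -> C) : cmeas u -> (forall t, T t -> nc (u t) <= M) ->
  intT (fun t => nc (u t) ^+ 2).
Proof.
move=> mu_ uM; apply: (@intT_bounded _ (M ^+ 2)).
  by apply: measurable_funX; exact: cmeas_nc.
move=> t Tt; rewrite ger0_norm ?sqr_ge0// ler_sqr ?nnegrE ?nc_ge0 ?uM//.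
by rewrite (le_trans (nc_ge0 (u t)))// uM.
Qed.

Lemma nsq_dist_le M e (u v : R -> C) : cmeas u -> cmeas v ->
  (forall t, T t -> nc (u t) <= M) -> (forall t, T t -> nc (v t) <= M) ->
  (forall t, T t -> nc (u t - v t) <= e) -> `|nsq u - nsq v| <= 2 * M * e.
Proof.
move=> mu_ mv uM vM uv; have iu := intT_nsq mu_ uM; have iv := intT_nsq mv vM.
rewrite /nsq -avgB// (le_trans (avg_le_norm (intTB iu iv)))// -[leRHS]avg_cst.
apply: le_avg; [exact/intT_norm/intTB|exact: intT_cst|] => t Tt.
rewrite (le_trans (sqr_dist_le _ _))// mulrC ler_pM ?addr_ge0 ?nc_ge0 ?uv//.
by rewrite mulr_natl mulr2n lerD ?uM ?vM.
Qed.

Lemma parseval (c : nat -> C) N :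
  nsq (fun t => \sum_(i < N) c i * expi t ^+ i) = \sum_(i < N) nc (c i) ^+ 2.
Proof.
apply: (@complexI R); rewrite -cavg_real rmorph_sum /=.
pose v (i j : 'I_N) t := c i * (c j)^* * (expi t ^+ i * (expi t ^+ j)^*).
have iv i j : cint (v i j).
  by apply: cintZ; apply: cint_expiXJ; exact: cint_expiX.
rewrite (@eq_cavg _ _ (fun t => \sum_i \sum_j v i j t)); last first.
  move=> t _; rewrite -mulJ_nc rmorph_sum /= mulr_suml exchange_big /=.
  apply: eq_bigr => i _; rewrite mulr_sumr; apply: eq_bigr => j _.
  by rewrite /v rmorphM; ring.
rewrite cavg_sum; last by move=> i; apply: cint_sum => j; exact: iv.
apply: eq_bigr => i _; rewrite cavg_sum; last by move=> j; exact: iv.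
rewrite (bigD1 i)//= big1 ?addr0.
  rewrite cavgZ ?cavg_expi_orth ?eqxx ?mulr1; last by apply: cint_expiXJ; exact: cint_expiX.
  by rewrite mulrC mulJ_nc.
move=> j ji; rewrite cavgZ ?cavg_expi_orth; last by apply: cint_expiXJ; exact: cint_expiX.
by rewrite -val_eqE eq_sym /= in ji; rewrite (negbTE ji) mulr0.
Qed.

Lemma horner_circle (p : {poly C}) r t :
  p.[r%:C * expi t] = \sum_(i < size p) p`_i * (r ^+ i)%:C * expi t ^+ i.
Proof.
by rewrite horner_coef; apply: eq_bigr => i _; rewrite exprMn rmorphXn mulrA.
Qed.

(** By Parseval this is [(s^i - r^i)^2 <= s^(2i) - r^(2i)] in each coefficient. Thus square means
    increase with the radius, and their increments control the distance between dilates. *)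
Lemma nsq_poly_dist (p : {poly C}) r s : 0 <= r -> r <= s ->
  nsq (fun t => p.[s%:C * expi t] - p.[r%:C * expi t]) <=
  nsq (fun t => p.[s%:C * expi t]) - nsq (fun t => p.[r%:C * expi t]).
Proof.
move=> r0 rs.
under [X in nsq X <= _]eq_fun do rewrite !horner_circle -sumrB.
under [X in _ <= nsq X - _]eq_fun do rewrite horner_circle.
under [X in _ <= _ - nsq X]eq_fun do rewrite horner_circle.
under [X in nsq X <= _]eq_fun do under eq_bigr do rewrite -mulrBl -mulrBr -rmorphB.
rewrite (parseval (fun i => p`_i * (s ^+ i - r ^+ i)%:C)).
rewrite (parseval (fun i => p`_i * (s ^+ i)%:C)) (parseval (fun i => p`_i * (r ^+ i)%:C)).
rewrite -sumrB; apply: ler_sum => i _.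
rewrite !ncM !exprMn -mulrBr ler_wpM2l ?sqr_ge0// !nc_real !real_normK ?num_real//.
have a0 : 0 <= r ^+ i by rewrite exprn_ge0.
have ab : r ^+ i <= s ^+ i by rewrite lerXn2r ?nnegrE// (le_trans r0).
nra.
Qed.

Lemma nsq_ana_dist G r s : ana G -> 0 <= r -> r <= s -> s < 1 ->
  nsq (fun t => G (s%:C * expi t) - G (r%:C * expi t)) <=
  nsq (fun t => G (s%:C * expi t)) - nsq (fun t => G (r%:C * expi t)).
Proof.
move=> aG r0 rs s1; have s0 := le_trans r0 rs; have r1 := le_lt_trans rs s1.
have [M [M0 GM]] := ana_bounded aG s1.
(* Replacing [G] by a polynomial within [e <= 1] costs [2 (M + 1) e] for each of the two means on
   the right and [8 (M + 1) e] for the mean of the difference. *)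
have K0 : 0 < 12 * (M + 1) by rewrite mulr_gt0// addr_gt0.
apply/ler_addgt0Pl => e0 e00.
have [e ee e1] : exists2 e, 0 < e & e <= 1 /\ 12 * (M + 1) * e <= e0.
  exists (Num.min 1 (e0 / (12 * (M + 1)))).
    by rewrite lt_min ltr01 divr_gt0.
  split; first by rewrite ge_min lexx.
  by rewrite mulrC -ler_pdivlMr// ge_min lexx orbT.
have [e1' e2] := e1.
have [p hp] := aG s e s1 ee; have ap := ana_horner p.
have pM z : nc z <= s -> nc p.[z] <= M + 1.
  move=> zs; have := hp _ zs; have := GM _ zs; have := nc_sub_le p.[z] (G z).
  rewrite nc_distC; lra.
have ns t : nc (s%:C * expi t) <= s by rewrite nc_realexpi.
have nr t : nc (r%:C * expi t) <= s by rewrite nc_realexpi.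
have mG x : 0 <= x -> x < 1 -> cmeas (fun t => G (x%:C * expi t)) by exact: ana_cmeas.
have mp x : 0 <= x -> x < 1 -> cmeas (fun t => p.[x%:C * expi t]) by exact: (ana_cmeas ap).
have GM1 z : nc z <= s -> nc (G z) <= M + 1.
  by move=> /GM h; rewrite (le_trans h)// lerDl.
have d1 := nsq_dist_le (mG _ s0 s1) (mp _ s0 s1) (fun t _ => GM1 _ (ns t))
  (fun t _ => pM _ (ns t)) (fun t _ => hp _ (ns t)).
have d2 := nsq_dist_le (mG _ r0 r1) (mp _ r0 r1) (fun t _ => GM1 _ (nr t))
  (fun t _ => pM _ (nr t)) (fun t _ => hp _ (nr t)).
have d3 : `|nsq (fun t => G (s%:C * expi t) - G (r%:C * expi t)) -
    nsq (fun t => p.[s%:C * expi t] - p.[r%:C * expi t])| <= 2 * (2 * (M + 1)) * (2 * e).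
  apply: nsq_dist_le => [||t _|t _|t _].
  - by apply: cmeasB; exact: mG.
  - by apply: cmeasB; exact: mp.
  - by rewrite (le_trans (ncB_le _ _))// mulr_natl mulr2n lerD// GM1.
  - by rewrite (le_trans (ncB_le _ _))// mulr_natl mulr2n lerD// pM.
  - have -> : forall a b c d : C, a - b - (c - d) = (a - c) - (b - d) by move=> *; ring.
    by rewrite (le_trans (ncB_le _ _))// mulr_natl mulr2n lerD// hp.
have d4 := nsq_poly_dist p r0 rs.
move: d1 d2 d3 d4 e2; rewrite !ler_norml.
move: (nsq _) (nsq _) (nsq _) (nsq _) (nsq _) (nsq _) => x1 x2 x3 x4 x5 x6.
clear; move=> /andP[? ?] /andP[? ?] /andP[? ?]; lra.
Qed.

(** Beppo Levi: the sum of the series has a finite integral, hence is finite almost everywhere. *)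
Lemma ae_summable (f : nat -> R -> R) B : (forall n, intT (f n)) ->
  (forall n t, 0 <= f n t) -> (forall n, \sum_(i < n) avg (f i) <= B) ->
  aeT (fun t => cvgn (series (fun n => f n t))).
Proof.
move=> fi f0 fB; pose F t := (\sum_(0 <= n <oo) (f n t)%:E)%E.
have mf n : measurable_fun T (EFin \o f n) by apply/measurable_EFinP; exact: intT_measurable.
have F0 t : (0 <= F t)%E by apply: nneseries_ge0 => n _ _; rewrite lee_fin.
have Fint : mu.-integrable T F.
  have mF : measurable_fun T F.
    apply: (@ge0_emeasurable_sum _ _ _ T (fun n t => (f n t)%:E) xpredT) => n.
      by move=> t _ _; rewrite lee_fin.
    by move=> _; exact: mf.
  apply/integrableP; split => //.
  under eq_integral do rewrite gee0_abs//.
  rewrite integral_nneseries//; [|exact: measurable_Tdom|by move=> n t _; rewrite lee_fin].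
  apply: (@le_lt_trans _ _ (2 * pi * B)%:E); last by rewrite ltry.
  apply: lime_le; first by apply: is_cvg_nneseries => n _ _; apply: integral_ge0 => t _; rewrite lee_fin.
  apply: nearW => n.
  rewrite (eq_bigr (fun i => (2 * pi * avg (f i))%:E)); last first.
    move=> i _; rewrite /avg mulrA mulfV ?mul1r ?gt_eqF ?twopi_gt0//.
    by rewrite /Rintegral fineK//; apply: integrable_fin_num => //; [exact: measurable_Tdom|exact: fi].
  rewrite big_mkord sumEFin lee_fin -mulr_sumr ler_wpM2l//.
  exact: ltW (twopi_gt0 R).
have := @integrable_ae _ _ _ mu _ (@measurable_Tdom R) F Fint; apply: aeTS => t Tt Ffin.
apply: nondecreasing_is_cvgn.
  by apply/nondecreasing_seqP => n; rewrite /series /= big_nat_recr//= lerDl.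
exists (fine (F t)) => _ [n _ <-]; rewrite -lee_fin fineK//.
rewrite /series /= -sumEFin.
exact: (@nneseries_lim_ge _ (fun k => (f k t)%:E) xpredT 0 n (fun k _ _ => f0 k t)).
Qed.

End Boundary.

(** * Bounded functions: radial limits and Poisson representation *)

Section Fatou.
Variable R : realType.
Local Notation C := R[i].
Local Notation "z ^*" := (conjc z) : ring_scope.
Local Notation Re := (@complex.Re R).
Local Notation Im := (@complex.Im R).
Local Notation T := (@Tdom R).
Local Notation mu := (@lebesgue_measure R).
Implicit Types (G H : C -> C) (r e t s M : R) (f : R -> R) (z w : C).

Lemma rn_homo : {homo @rn R : m n / (m <= n)%N >-> m <= n}.
Proof.
move=> m n mn; rewrite lerD2l lerN2 lef_pV2 ?posrE ?ltr0n//.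
by rewrite ler_nat !ltnS.
Qed.

(** The rate [4^-j] for square means is chosen so that mean distances decay like [2^-j], which is
    summable. *)
Lemma subsequence_rn (a : nat -> R) (M : R) : {homo a : m n / (m <= n)%N >-> m <= n} ->
  (forall n, a n <= M) -> exists nn : nat -> nat,
  [/\ forall j, (j <= nn j)%N, forall j, (nn j <= nn j.+1)%N &
      forall j, a (nn j.+1) - a (nn j) <= 4 ^- j].
Proof.
move=> ha aM.
have ca : cvgn a by apply: nondecreasing_is_cvgn => //; exists M => _ [n _ <-].
have aL n : a n <= limn a by exact: nondecreasing_cvgn_le.
have /choice[idx hidx] : forall j : nat, exists n, limn a - a n <= 4 ^- j.
  move=> j; have j0 : (0 : R) < 4 ^- j by rewrite invr_gt0 exprn_gt0.
  have /cvgrPdist_le /(_ _ j0)[N _ hN] := ca.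
  by exists N; rewrite (le_trans (ler_norm _))//; apply: hN => /=.
(* Summing the successors of the indices makes the sequence monotone, at least [j] and beyond
   [idx j], all at once. *)
exists (fun j => \sum_(i < j.+1) (idx i).+1)%N; split.
- by elim=> // j ih; rewrite big_ord_recr /= addnS ltnS (leq_trans ih)// leq_addr.
- by move=> j; rewrite [in X in (_ <= X)%N]big_ord_recr /= leq_addr.
- move=> j; apply: le_trans (hidx j).
  apply: lerB => //; apply: ha.
  by rewrite big_ord_recr /= (leq_trans (leqnSn _))// leq_addl.
Qed.

Lemma abs_summable_cvg (x : nat -> R) (d : nat -> R) :
  (forall n, `|x n.+1 - x n| <= d n) -> cvgn (series d) -> cvgn x.
Proof.
move=> xd cd.
have : cvgn (series (telescope x)).
  apply: normed_cvg; apply: (series_le_cvg _ _ xd cd) => n //.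
  by rewrite (le_trans _ (xd n)).
rewrite telescopeK => h.
have -> : x = (fun n => (x n - x 0%N) + x 0%N) by apply/funext => n; rewrite subrK.
by apply: is_cvgD => //; exact: is_cvg_cst.
Qed.

(** Square means over circles increase with the radius and stay bounded, so along a fast subsequence
    of radii the increments are summable almost everywhere. The Poisson formula for the dilates then
    passes to the limit by bounded convergence. *)
Lemma fatou_repr G M : ana G -> (forall z, disc z -> nc (G z) <= M) ->
  exists g : R -> C, [/\ cmeas g, aeT (fun t => nc (g t) <= M) &
    forall z, nc z < 1 -> G z = cavg (fun t => g t * (pois z t)%:C)].
Proof.
move=> aG GM.
have GMr r t : 0 <= r -> r < 1 -> nc (G (r%:C * expi t)) <= M.
  by move=> r0 r1; apply: GM; have : nc (r%:C * expi t) < 1 by rewrite nc_realexpi.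
have mG r : 0 <= r -> r < 1 -> cmeas (fun t => G (r%:C * expi t)) by exact: ana_cmeas.
have M0 : 0 <= M by rewrite (le_trans (nc_ge0 _) (GMr 0 0 _ _)).
pose a n := nsq (fun t => G ((rn R n)%:C * expi t)).
have nsq0 (u : R -> C) : 0 <= nsq u by apply: avg_ge0 => t _; exact: sqr_ge0.
have ha : {homo a : m n / (m <= n)%N >-> m <= n}.
  move=> m n mn; rewrite -subr_ge0.
  exact: le_trans (nsq0 _) (nsq_ana_dist aG (rn_ge0 _ _) (rn_homo mn) (rn_lt1 _ _)).
have aM n : a n <= M ^+ 2.
  rewrite -[leRHS]avg_cst; apply: le_avg; [|exact: intT_cst|] => [|t _].
    by apply: (@intT_nsq _ M) => [|t _]; [apply: mG|apply: GMr]; rewrite ?rn_ge0 ?rn_lt1.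
  by rewrite ler_sqr ?nnegrE ?nc_ge0// GMr ?rn_ge0 ?rn_lt1.
have [nn [nn1 nn2 nn3]] := subsequence_rn ha aM.
pose rho j := rn R (nn j).
have rho0 j : 0 <= rho j by exact: rn_ge0.
have rho1 j : rho j < 1 by exact: rn_lt1.
have rhol : rho j @[j --> \oo] --> (1 : R)^'-.
  apply: seq_at_left => //; apply: squeeze_cvgr (@rn_cvg R) _; last exact: cvg_cst.
  by apply: nearW => j; rewrite rn_homo// ltW.
pose D j t := nc (G ((rho j.+1)%:C * expi t) - G ((rho j)%:C * expi t)).
have mD j : cmeas (fun t => G ((rho j.+1)%:C * expi t) - G ((rho j)%:C * expi t)).
  by apply: cmeasB; exact: mG.
have DM j t : D j t <= 2 * M.
  by rewrite (le_trans (ncB_le _ _))// mulr_natl mulr2n lerD// GMr.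
have iD j : intT (D j).
  by apply: (@intT_bounded _ (2 * M)) => [|t _]; [exact: cmeas_nc|rewrite ger0_norm ?nc_ge0].
have iD2 j : intT (fun t => D j t ^+ 2).
  by apply: (@intT_nsq _ (2 * M)) => // t _; exact: DM.
have D1 j : avg (D j) <= 2 * 2^-1 ^+ j.
  (* The pointwise bound [D <= q + D^2 / q] with [q = 2^-j] stands in for the Cauchy-Schwarz
     inequality. *)
  apply: (@le_trans _ _ (avg (fun t => 2^-1 ^+ j + 2 ^+ j * D j t ^+ 2))).
    apply: le_avg => //; first by apply: intTD; [exact: intT_cst|exact: intTZ].
    move=> t _; have p2 : (0 : R) < 2 ^+ j by rewrite exprn_gt0.
    have e2 : (2 : R) ^+ j * 2^-1 ^+ j = 1 by rewrite exprVn mulfV// gt_eqF.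
    have := sqr_ge0 (2 ^+ j * D j t - 2^-1); move: (nc_ge0 (G ((rho j.+1)%:C * expi t) - G ((rho j)%:C * expi t))).
    rewrite -/(D j t); move: (D j t) (2 ^+ j) (2^-1 ^+ j) p2 e2; clear => d p q p0 e d0 h.
    rewrite -(ler_pM2l p0) mulrDr e; nra.
  rewrite avgD; [|exact: intT_cst|exact: intTZ].
  rewrite avg_cst avgZ// mulr_natl mulr2n lerD2l.
  have h : avg (fun t => D j t ^+ 2) <= 4 ^- j.
    apply: le_trans (nn3 j).
    by apply: nsq_ana_dist => //; exact: rn_homo.
  rewrite (le_trans (ler_wpM2l _ h)) ?exprn_ge0//.
  by rewrite -exprVn -exprMn (_ : 2 * 4^-1 = 2^-1)//; field.
have cv : aeT (fun t => cvgn (series (fun j => D j t))).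
  apply: (@ae_summable _ _ 4) => // [j t|n]; first exact: nc_ge0.
  apply: (@le_trans _ _ (\sum_(j < n) 2 * 2^-1 ^+ j)); first by apply: ler_sum.
  by rewrite -mulr_sumr; have := sum_pow_half_le R n; lra.
have cvl : aeT (fun t => ccvg \oo (fun j => G ((rho j)%:C * expi t)) (blim rho G t)).
  apply: aeTS cv => t _ cvt.
  have cr : cvgn (fun j => Re (G ((rho j)%:C * expi t))).
    apply: abs_summable_cvg cvt => j; rewrite -ReB; exact: normr_Re_le.
  have ci : cvgn (fun j => Im (G ((rho j)%:C * expi t))).
    apply: abs_summable_cvg cvt => j; rewrite -ImB; exact: normr_Im_le.
  have h : ccvg \oo (fun j => G ((rho j)%:C * expi t))
    (limn (fun j => Re (G ((rho j)%:C * expi t))) +i* limn (fun j => Im (G ((rho j)%:C * expi t)))).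
    by apply/ccvg_ReIm; split.
  by rewrite (blim_cvg h).
exists (blim rho G); split.
- exact: blim_meas.
- apply: aeTS cvl => t _ /ccvg_norm h; apply: (cvgr_to_le h).
  by apply: nearW => j; exact: GMr.
- move=> z z1.
  have h1 : ccvg \oo (fun j => G ((rho j)%:C * z)) (G z).
    apply: ana_continuous => //.
    rewrite -[X in ccvg _ _ X]mul1r; apply: ccvgM; last exact: ccvg_cst.
    apply: ccvg_real; move: rhol => /cvg_trans; apply; exact: cvg_within.
  apply: (ccvg_unique h1).
  rewrite /ccvg; under eq_fun do rewrite -(poisson_formula aG (rho0 _) (rho1 _) z1).
  have mp : cmeas (fun t => (pois z t)%:C) by apply: cmeas_real; exact: measurable_pois.
  apply: (@cavg_dct _ _ _ (fun=> M * (2 / (1 - nc z) + 1))).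
  + by move=> n; apply: cmeasM => //; exact: mG.
  + by apply: cmeasM => //; exact: blim_meas.
  + exact: intT_cst.
  + by apply: aeTS cvl => t _ h; apply: ccvgM => //; exact: ccvg_cst.
  + move=> n; apply: aeTW => t _; rewrite ncM ler_pM ?nc_ge0 ?GMr//.
    by rewrite nc_real ger0_norm ?pois_ge0// pois_le.
Qed.

(** [fatou_repr] converges along selected radii only; but since [G] is the Poisson integral of [g],
    [pois_radial] upgrades this to a full radial limit, and [g] is then [bd G] almost everywhere. *)
Lemma bounded_ae_limW G M : ana G -> (forall z, disc z -> nc (G z) <= M) ->
  [/\ ae_lim G, aeT (fun t => nc (bd G t) <= M) &
    forall z, nc z < 1 -> G z = cavg (fun t => bd G t * (pois z t)%:C)].
Proof.
move=> aG GM; have [g [mg gM Gg]] := fatou_repr aG GM.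
have gi : cint g by exact: cint_bounded_ae gM.
have lg : aeT (fun t => radial_limit G t (g t)).
  have [gr gi'] := gi.
  apply: aeTS2 (pois_radial gr) (pois_radial gi') => t _ hr hi.
  apply/radial_limitP; apply/ccvg_ReIm; split.
    apply: cvg_trans hr; apply: near_eq_cvg; apply: at_left_disc => r r0 r1.
    have z1 : nc (r%:C * expi t) < 1 by rewrite nc_realexpi.
    by rewrite (Gg _ z1) Re_cavg; apply: eq_avg => s _; rewrite [g s * _]mulrC Re_realM mulrC.
  apply: cvg_trans hi; apply: near_eq_cvg; apply: at_left_disc => r r0 r1.
  have z1 : nc (r%:C * expi t) < 1 by rewrite nc_realexpi.
  by rewrite (Gg _ z1) Im_cavg; apply: eq_avg => s _; rewrite [g s * _]mulrC Im_realM mulrC.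
have bg : aeT (fun t => bd G t = g t) by apply: aeTS lg => t _; exact: bd_radial.
split.
- by apply: ae_limP; apply: aeTS lg => t _ h; exists (g t).
- by apply: aeTS2 bg gM => t _ ->.
- move=> z z1; rewrite Gg//; apply: ae_eq_cavg.
  + by apply: cmeasM => //; apply: cmeas_real; exact: measurable_pois.
  + by apply: cmeasM; [exact: bd_meas|apply: cmeas_real; exact: measurable_pois].
  + by apply: aeTS bg => t _ ->.
Qed.

Lemma bounded_ae_lim G M : ana G -> (forall z, disc z -> nc (G z) <= M) -> ae_lim G.
Proof. by move=> aG GM; have [] := bounded_ae_limW aG GM. Qed.

Lemma bounded_bd_le G M : ana G -> (forall z, disc z -> nc (G z) <= M) ->
  aeT (fun t => nc (bd G t) <= M).
Proof. by move=> aG GM; have [] := bounded_ae_limW aG GM. Qed.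

Lemma bd_mean G M : ana G -> (forall z, disc z -> nc (G z) <= M) -> cavg (bd G) = G 0.
Proof.
move=> aG GM; have [_ _ ->] := bounded_ae_limW aG GM; last by rewrite nc0.
by apply: eq_cavg => t _; rewrite pois0 mulr1.
Qed.

(** The Poisson kernel is nonnegative with average [1]. The bound [M0] is qualitative and secures
    the representation, [M] is the quantitative one. *)
Lemma max_principle G M0 M z : ana G -> (forall z, disc z -> nc (G z) <= M0) ->
  aeT (fun t => nc (bd G t) <= M) -> disc z -> nc (G z) <= M.
Proof.
move=> aG GM bM z1'; have z1 : nc z < 1 := z1'.
have [_ _ ->//] := bounded_ae_limW aG GM.
have ib : cint (bd G) by apply: cint_bounded_ae bM; exact: bd_meas.
apply: le_trans (nc_cavg_le (cintM_pois z1 ib)) _.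
have ip : intT (pois z).
  by have := intTM_pois z1 (intT_cst 1); under eq_fun do rewrite mul1r.
rewrite -[leRHS]mulr1 -(avg_pois z1) -avgZ//; apply: le_avg_ae.
- by apply: cint_nc; exact: cintM_pois.
- exact: intTZ.
- apply: aeTS bM => t _ h; rewrite ncM nc_real ger0_norm ?pois_ge0//.
  by rewrite ler_wpM2r ?pois_ge0.
Qed.

End Fatou.

(** * Outer functions *)

Section OuterFunctions.
Variable R : realType.
Local Notation C := R[i].
Local Notation "z ^*" := (conjc z) : ring_scope.
Local Notation Re := (@complex.Re R).
Local Notation Im := (@complex.Im R).
Local Notation T := (@Tdom R).
Local Notation mu := (@lebesgue_measure R).
Implicit Types (G H h : C -> C) (r e t s M : R) (f l : R -> R) (z w : C).

Lemma radial_limitM G H t z w : radial_limit G t z -> radial_limit H t w ->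
  radial_limit (fun x => G x * H x) t (z * w).
Proof. by move=> /radial_limitP a /radial_limitP b; apply/radial_limitP; exact: ccvgM. Qed.

Lemma radial_limitD G H t z w : radial_limit G t z -> radial_limit H t w ->
  radial_limit (fun x => G x + H x) t (z + w).
Proof. by move=> /radial_limitP a /radial_limitP b; apply/radial_limitP; exact: ccvgD. Qed.

Lemma radial_limitB G H t z w : radial_limit G t z -> radial_limit H t w ->
  radial_limit (fun x => G x - H x) t (z - w).
Proof. by move=> /radial_limitP a /radial_limitP b; apply/radial_limitP; exact: ccvgB. Qed.

Lemma radial_limitV G t z : z != 0 -> radial_limit G t z ->
  radial_limit (fun x => (G x)^-1) t z^-1.
Proof. by move=> z0 /radial_limitP a; apply/radial_limitP; exact: ccvgV. Qed.

Lemma radial_limit_expC G t z : radial_limit G t z ->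
  radial_limit (fun x => expC (G x)) t (expC z).
Proof. by move=> /radial_limitP a; apply/radial_limitP; exact: ccvg_expC. Qed.

Lemma radial_limit_cst w t : radial_limit (fun=> w) t w.
Proof. by apply/radial_limitP; exact: ccvg_cst. Qed.

Lemma Re_Hz_radial f : intT f ->
  aeT (fun t => Re (Hz f (r%:C * expi t)) @[r --> (1 : R)^'-] --> f t).
Proof.
move=> fi; apply: aeTS (pois_radial fi) => t _; apply: cvg_trans; apply: near_eq_cvg.
apply: at_left_disc => r r0 r1; rewrite Re_Hz//.
by rewrite nc_realexpi.
Qed.

Lemma Re_bd_Hz f : intT f -> ae_lim (Hz f) -> aeT (fun t => Re (bd (Hz f) t) = f t).
Proof.
move=> fi af; apply: aeTS2 (Re_Hz_radial fi) af => t _ h1 /radial_limitP/ccvg_ReIm[h2 _].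
exact: (cvg_unique _ h2 h1).
Qed.

Lemma nc_bd_expHz l : intT l -> ae_lim (fun z => expC (Hz l z)) ->
  aeT (fun t => nc (bd (fun z => expC (Hz l z)) t) = expR (l t)).
Proof.
move=> li ae; apply: aeTS2 (Re_Hz_radial li) ae => t _ h1 /radial_limitP/ccvg_norm h2.
have h3 : expR (Re (Hz l (r%:C * expi t))) @[r --> (1 : R)^'-] --> expR (l t).
  by apply: continuous_cvg h1; exact: continuous_expR.
move: h2; under eq_fun do rewrite nc_expC.
by move=> h2; exact: (cvg_unique _ h2 h3).
Qed.

Lemma nc_expHz l z : intT l -> nc z < 1 ->
  nc (expC (Hz l z)) = expR (avg (fun t => l t * pois z t)).
Proof. by move=> li z1; rewrite nc_expC Re_Hz. Qed.

(** An upper bound on [l] makes the outer factor bounded, so that [max_principle] applies to the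
    product. *)
Lemma outer_max_bounded l (m M0 M : R) G z : intT l -> (forall t, T t -> l t <= m) ->
  ana G -> (forall x, disc x -> nc (G x) <= M0) ->
  aeT (fun t => nc (bd G t) * expR (l t) <= M) -> disc z ->
  nc (G z) * nc (expC (Hz l z)) <= M.
Proof.
move=> li lm aG GM bM zd.
pose E x := expC (Hz l x).
have aE : ana E by apply: ana_expC; exact: ana_Hz.
have EM x : disc x -> nc (E x) <= expR m.
  move=> xd; have x1 : nc x < 1 := xd.
  rewrite nc_expHz// ler_expR.
  have ip : intT (fun t => m * pois x t) by apply: (intTM_pois x1); exact: intT_cst.
  have := le_avg (intTM_pois x1 li) ip.
  have -> : avg (fun t => m * pois x t) = m.
    rewrite avgZ ?avg_pois ?mulr1//.
    by have := intTM_pois x1 (intT_cst 1); under eq_fun do rewrite mul1r.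
  by apply=> t Tt; rewrite ler_wpM2r ?pois_ge0 ?lm.
have lE := bounded_ae_lim aE EM; have lG := bounded_ae_lim aG GM.
have nE := nc_bd_expHz li lE.
rewrite -ncM; apply: (@max_principle _ (fun x => G x * E x) (M0 * expR m)) => //.
- exact: anaM.
- by move=> x xd; rewrite ncM ler_pM ?nc_ge0 ?GM ?EM.
- have lGE : aeT (fun t => bd (fun x => G x * E x) t = bd G t * bd E t).
    by apply: aeTS2 lG lE => t _ a b; apply: bd_radial; exact: radial_limitM.
  by apply: aeTS3 lGE nE bM => t _ -> <-; rewrite ncM.
Qed.

(* Smirnov's maximum principle: dividing a bounded function by an outer one still obeys
   the maximum principle; [l] is truncated from above so that all factors are bounded. *)
Lemma outer_max l (M0 M : R) G z : intT l -> ana G -> (forall x, disc x -> nc (G x) <= M0) ->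
  aeT (fun t => nc (bd G t) * expR (l t) <= M) -> disc z ->
  nc (G z) * nc (expC (Hz l z)) <= M.
Proof.
move=> li aG GM bM zd; have z1 : nc z < 1 := zd.
pose lm (n : nat) t := Num.min (l t) n%:R.
have mlm n : measurable_fun T (lm n).
  by apply: measurable_minr; [exact: intT_measurable|exact: measurable_cst].
have lmle n t : `|lm n t| <= `|l t|.
  rewrite /lm; have [//|h] := leP (l t) n%:R.
  by rewrite ger0_norm ?ler0n// (le_trans (ltW h))// ler_norm.
have ilm n : intT (lm n).
  by apply: (intT_le (mlm n) (intT_norm li)).
have h1 n : nc (G z) * expR (avg (fun t => lm n t * pois z t)) <= M.
  rewrite -nc_expHz//; apply: (@outer_max_bounded _ n%:R M0) => //.
    by move=> t _; rewrite ge_min lexx orbT.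
  apply: aeTS bM => t _; apply: le_trans; rewrite ler_wpM2l ?nc_ge0// ler_expR.
  by rewrite ge_min lexx.
rewrite nc_expHz//.
have cv : avg (fun t => lm n t * pois z t) @[n --> \oo] --> avg (fun t => l t * pois z t).
  apply: (@avg_dct _ _ _ (fun t => `|l t| * pois z t)).
  - by move=> n; apply: measurable_funM => //; exact: measurable_pois.
  - by apply: measurable_funM; [exact: intT_measurable|exact: measurable_pois].
  - by apply: intTM_pois => //; exact: intT_norm.
  - apply: aeTW => t _; apply: cvgMl; apply: cvg_near_cst.
    exists (Num.bound `|l t|) => // n /= hn; rewrite /lm min_l//.
    rewrite (le_trans (ler_norm _))// (le_trans (ltW (archi_boundP _)))// ler_nat//.
  - move=> n; apply: aeTW => t _; rewrite normrM (ger0_norm (pois_ge0 _ _))//.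
    by rewrite ler_wpM2r ?pois_ge0.
have cv2 : nc (G z) * expR (avg (fun t => lm n t * pois z t)) @[n --> \oo] -->
    nc (G z) * expR (avg (fun t => l t * pois z t)).
  by apply: cvgMr; apply: continuous_cvg cv; exact: continuous_expR.
by apply: (cvgr_to_le cv2); exact: nearW.
Qed.

(* Jensen's inequality, obtained by comparing [h] with the outer functions of modulus
   [max (min 1 |h|) (e ^- n)]. *)
Lemma jensen h : ana h -> (forall z, disc z -> nc (h z) <= 1) -> h 0 != 0 ->
  aeT (fun t => bd h t != 0) /\ intT (fun t => ln (nc (bd h t))).
Proof.
move=> ah h1 h0.
have mb : measurable_fun T (fun t => nc (bd h t)) by apply: cmeas_nc; exact: bd_meas.
pose q t := Num.min 1 (nc (bd h t)).
have q0 t : 0 <= q t by rewrite le_min ler01 nc_ge0.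
have q1 t : q t <= 1 by rewrite ge_min lexx.
have mq : measurable_fun T q by apply: measurable_minr => //; exact: measurable_cst.
pose k n t := Num.max (q t) (expR (- n%:R)).
have k0 n t : 0 < k n t by rewrite lt_max expR_gt0 orbT.
have kn n t : expR (- n%:R) <= k n t by rewrite le_max lexx orbT.
have k1 n t : k n t <= 1 by rewrite ge_max q1 expR_le1 oppr_le0 ler0n.
pose l n t := - ln (k n t).
have l0 n t : 0 <= l n t by rewrite oppr_ge0 ln_le0.
have ln_ n t : l n t <= n%:R.
  by rewrite lerNl -ler_expR lnK ?posrE.
have ml n : measurable_fun T (l n).
  apply: measurable_funN; apply: measurableT_comp; first exact: measurable_ln.
  by apply: measurable_maxr => //; exact: measurable_cst.
have li n : intT (l n).
  by apply: (@intT_bounded _ n%:R) => // t _; rewrite ger0_norm.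
have bh := bounded_bd_le ah h1.
have d0 : disc (0 : C) by have : nc (0 : C) < 1 by rewrite nc0.
(* On the circle [|h| <= k n], so [h] times the outer function of modulus [1 / k n] is bounded by
   [1]; at the origin this bounds [avg (l n)] uniformly in [n]. *)
have al n : avg (l n) <= - ln (nc (h 0)).
  have := @outer_max (l n) 1 1 h 0 (li n) ah h1.
  have n0 : nc (0 : C) < 1 by rewrite nc0.
  rewrite nc_expHz// (@eq_avg _ _ (l n)) => [H|t _]; last by rewrite pois0 mulr1.
  have hh : nc (h 0) * expR (avg (l n)) <= 1.
    apply: H => //; apply: aeTS bh => t _ bt.
    rewrite expRN lnK ?posrE// ler_pdivrMr// mul1r le_max.
    by rewrite /q le_min bt lexx.
  have p0 : 0 < nc (h 0) by rewrite nc_gt0.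
  by rewrite lerNr -ler_expR lnK ?posrE// expRN -div1r ler_pdivlMr ?expR_gt0.
pose phi t := limn (fun n => (l n t)%:E).
have lhomo t : {homo (fun n => (l n t)%:E) : m n / (m <= n)%N >-> (m <= n)%E}.
  move=> m n mn; rewrite lee_fin lerN2 ler_ln ?posrE// ge_max !le_max lexx /=.
  by rewrite ler_expR lerN2 ler_nat mn orbT.
have mlE n : measurable_fun T (fun t => (l n t)%:E) by exact/measurable_EFinP.
have phi0 t : (0 <= phi t)%E.
  apply: lime_ge; first exact: ereal_nondecreasing_is_cvgn.
  by apply: nearW => n; rewrite lee_fin.
have phi_int : (\int[mu]_(t in T) phi t < +oo)%E.
  rewrite monotone_convergence//.
  - apply: (@le_lt_trans _ _ (2 * pi * - ln (nc (h 0)))%:E); last by rewrite ltry.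
    apply: lime_le.
      apply: ereal_nondecreasing_is_cvgn => m n mn; apply: ge0_le_integral => //.
      - exact: measurable_Tdom.
      - by move=> t _; rewrite lee_fin.
      - exact: mlE.
      - exact: mlE.
      - by move=> t _; exact: lhomo.
    apply: nearW => n.
    have : (\int[mu]_(t in T) (l n t)%:E = (2 * pi * avg (l n))%:E)%E.
      rewrite /avg mulrA mulfV ?mul1r ?gt_eqF ?twopi_gt0// /Rintegral fineK//.
      by apply: integrable_fin_num; [exact: measurable_Tdom|exact: li].
    by move=> ->; rewrite lee_fin ler_wpM2l// (ltW (twopi_gt0 R)).
  - exact: measurable_Tdom.
  - by move=> n t _; rewrite lee_fin.
have mphi : measurable_fun T phi.
  apply: (@emeasurable_fun_cvg _ _ _ _ (fun n t => (l n t)%:E)) => // t _.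
  exact: ereal_nondecreasing_is_cvgn.
(* Where [q] vanishes [l n] equals [n], so integrability of the monotone limit [phi] forces [q > 0]
   almost everywhere. *)
have phi_q0 t : q t = 0 -> phi t = +oo%E.
  move=> qt; apply: cvg_lim => //.
  have -> : (fun n => (l n t)%:E) = (fun n : nat => (n%:R : R)%:E).
    apply/funext => n; rewrite /l /k qt max_r; last exact: expR_ge0.
    by rewrite expRK opprK.
  exact/cvgenyP.
have phi_q t : 0 < q t -> phi t = (- ln (q t))%:E.
  move=> qt; apply: cvg_lim => //; apply: cvg_near_cst.
  exists (Num.bound (`|ln (q t)|)) => // n /= hn; rewrite /l /k max_l//.
  rewrite -[leRHS]lnK ?posrE// ler_expR lerNl.
  rewrite (le_trans (ler_norm _))// normrN (le_trans (ltW (archi_boundP _)))// ler_nat//.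
have phii : mu.-integrable T phi.
  by apply/integrableP; split => //; under eq_integral do rewrite gee0_abs//.
have qn0 : aeT (fun t => 0 < q t).
  have := @integrable_ae _ _ _ mu _ (@measurable_Tdom R) phi phii; apply: aeTS => t Tt pfin.
  rewrite lt_neqAle q0 andbT eq_sym; apply/eqP => qt.
  by move: pfin; rewrite phi_q0.
have bq : aeT (fun t => q t = nc (bd h t)).
  by apply: aeTS bh => t _ bt; rewrite /q min_r.
split.
  by apply: aeTS2 qn0 bq => t _ qt e; rewrite -nc_gt0 -e.
have mlq : measurable_fun T (fun t => ln (q t)).
  by apply: measurableT_comp; [exact: measurable_ln|].
have ilq : intT (fun t => ln (q t)).
  apply/integrableP; split; first exact/measurable_EFinP.
  apply: le_lt_trans phi_int; apply: ge0_le_integral => //=.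
  - exact: measurable_Tdom.
  - by do 2 apply: measurableT_comp => //.
  (* The default [ln 0 = 0] keeps the bound by [phi] valid at zeros of [q]. *)
  - move=> t _; have [/eqP qt|qt] := eqVneq (q t) 0.
      by rewrite (eqP qt) ln0// normr0.
    have qt0 : 0 < q t by rewrite lt_neqAle eq_sym qt q0.
    by rewrite phi_q// lee_fin ler0_norm// ln_le0.
apply: (@intT_le_ae _ _ (fun t => `|ln (q t)|)).
- by apply: measurableT_comp; [exact: measurable_ln|].
- exact: intT_norm.
- by apply: aeTS bq => t _ ->.
Qed.

Lemma add1_Re_neq0 z : 0 <= Re z -> 1 + z != 0.
Proof.
move=> z0; apply/eqP => /(congr1 Re); rewrite ReD /= => h.
have : 0 < 1 + Re z by rewrite ltr_pwDl.
by rewrite h ltxx.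
Qed.

Lemma nc_add_Re_ge (a : R) z : 0 <= a -> 0 <= Re z -> a <= nc (a%:C + z).
Proof.
move=> a0 z0; apply: le_trans (normr_Re_le _); rewrite ReD /= ger0_norm ?addr_ge0//.
by rewrite lerDl.
Qed.

(** The transform may be unbounded, but its real part is nonnegative, so [1 / (1 + Hz f)] is bounded
    by [1] and has radial limits. By [jensen] these are nonzero almost everywhere and can be
    inverted. *)
Lemma ae_lim_Hz_ge0 f : intT f -> (forall t, T t -> 0 <= f t) -> ae_lim (Hz f).
Proof.
move=> fi f0; pose h z := (1%:C + Hz f z)^-1.
have W0 z : disc z -> 0 <= Re (Hz f z) by move=> zd; exact: Re_Hz_ge0.
have ah : ana h by apply: ana_inv => //; exact: ana_Hz.
have h1 z : disc z -> nc (h z) <= 1.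
  move=> /W0 zd; have ge1 := nc_add_Re_ge ler01 zd.
  by rewrite ncV invf_le1// (lt_le_trans _ ge1).
have d0 : disc (0 : C) by have : nc (0 : C) < 1 by rewrite nc0.
have h0 : h 0 != 0 by rewrite invr_eq0; apply: add1_Re_neq0; exact: W0.
have [bn _] := jensen ah h1 h0.
apply: ae_limP; apply: aeTS2 bn (bounded_ae_lim ah h1) => t _ b0 hl.
exists ((bd h t)^-1 - 1).
apply: (@radial_limit_ext _ (fun z => (h z)^-1 - 1)).
  by move=> z zd; rewrite /h invrK addrC addKr.
by apply: radial_limitB; [exact: radial_limitV|exact: radial_limit_cst].
Qed.

Lemma HzB f l z : intT f -> intT l -> nc z < 1 -> Hz (fun t => f t - l t) z = Hz f z - Hz l z.
Proof.
move=> fi li z1; rewrite !HzE//; last exact: intTB.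
rewrite avgB//.
have -> : cauchyT (fun t => (f t - l t)%:C) z =
    cauchyT (fun t => (f t)%:C) z - cauchyT (fun t => (l t)%:C) z.
  rewrite /cauchyT -cavgB; [|by apply: cint_ck => //; exact: cint_real..].
  by apply: eq_cavg => t _; rewrite rmorphB mulrBl.
by rewrite rmorphB; ring.
Qed.

Lemma ae_lim_Hz f : intT f -> ae_lim (Hz f).
Proof.
move=> fi.
have fip : intT (fun t => Num.max (f t) 0).
  apply: (intT_le _ (intT_norm fi)) => [|t _].
    by apply: measurable_maxr; [exact: intT_measurable|exact: measurable_cst].
  by have [h|h] := leP (f t) 0; rewrite ?normr0.
have fim : intT (fun t => Num.max (- f t) 0).
  apply: (intT_le _ (intT_norm fi)) => [|t _].
    by apply: measurable_maxr; [apply: intT_measurable; exact: intTN|exact: measurable_cst].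
  by have [h|h] := leP (- f t) 0; rewrite ?normr0 ?normrN.
have lp := ae_lim_Hz_ge0 fip (fun t _ => (_ : 0 <= Num.max (f t) 0)).
have lm := ae_lim_Hz_ge0 fim (fun t _ => (_ : 0 <= Num.max (- f t) 0)).
apply: ae_limP; apply: aeTS2 (lp _) (lm _) => [t _ a b|t|t]; last 2 first.
- by rewrite le_max lexx orbT.
- by rewrite le_max lexx orbT.
exists (bd (Hz (fun t => Num.max (f t) 0)) t - bd (Hz (fun t => Num.max (- f t) 0)) t).
apply: radial_limit_ext (radial_limitB a b) => z zd; rewrite -HzB//.
apply: eq_cavg => s _; congr (_ * _%:C).
by have [h|h] := leP (f s) 0; have [h'|h'] := leP (- f s) 0; lra.
Qed.

End OuterFunctions.

(** * Multipliers for the Riesz projection *)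

Section Multipliers.
Variable R : realType.
Local Notation C := R[i].
Local Notation "z ^*" := (conjc z) : ring_scope.
Local Notation Re := (@complex.Re R).
Local Notation Im := (@complex.Im R).
Local Notation T := (@Tdom R).
Local Notation mu := (@lebesgue_measure R).
Implicit Types (G H h : C -> C) (r e t s M N u v : R) (f l : R -> R) (z w b : C).

(* For [f >= 0] and [N = n + 1], [mult f n = N / (N + Hz f)] is bounded by [1], tends to
   [1], and has a bounded product with [Hz f]. *)
Definition mult f (n : nat) z : C := n.+1%:R%:C * (n.+1%:R%:C + Hz f z)^-1.

(* [N * imdev f n ^+ 2] has average tending to [0]: the mean value property for the real
   part of [Hz f * mult f n] says that no mass is lost in the limit. *)
Definition imdev f (n : nat) t : R :=
  `|Im (bd (Hz f) t)| * nc (bd (mult f n) t) / n.+1%:R.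

Section PointwiseBounds.
Variables (N : R) (w b : C).
Hypotheses (N0 : 0 < N) (w0 : 0 <= Re w) (bw : b * (N%:C + w) = N%:C).
Let x := `|Im w| * nc b / N.

Let D0 : 0 < (N + Re w) ^+ 2 + Im w ^+ 2.
Proof. by rewrite ltr_pwDl ?sqr_ge0// exprn_gt0// ltr_pwDl. Qed.

Let bD : nc b ^+ 2 * ((N + Re w) ^+ 2 + Im w ^+ 2) = N ^+ 2.
Proof.
have : nc (b * (N%:C + w)) ^+ 2 = nc (N%:C) ^+ 2 by rewrite bw.
by rewrite ncM exprMn nc_real real_normK ?num_real// (nc_sqr (_ + _)) ReD ImD /= add0r.
Qed.

Lemma mult_nc_le1 : nc b <= 1.
Proof.
rewrite -ler_sqr ?nnegrE ?nc_ge0// expr1n -(ler_pM2r D0) bD mul1r.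
rewrite -[leLHS]addr0 lerD ?sqr_ge0// ler_sqr ?nnegrE ?(ltW N0) ?addr_ge0 ?(ltW N0)//.
by rewrite lerDl.
Qed.

Lemma imdev_ge0 : 0 <= x.
Proof. by rewrite divr_ge0 ?mulr_ge0 ?nc_ge0// ltW. Qed.

Lemma imdev_sqr : N * x ^+ 2 = Im w ^+ 2 * nc b ^+ 2 / N.
Proof.
by rewrite /x !exprMn real_normK ?num_real//; field; rewrite gt_eqF.
Qed.

Lemma imdev_le1 : x <= 1.
Proof.
have N2 : 0 < N ^+ 2 by rewrite exprn_gt0.
rewrite -ler_sqr ?nnegrE ?imdev_ge0// expr1n /x !exprMn real_normK ?num_real// exprVn.
rewrite ler_pdivrMr// mul1r -bD mulrC ler_wpM2l ?sqr_ge0//.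
by rewrite lerDr sqr_ge0.
Qed.

(** Rationalizing [N / (N + w)] shows [b] as a nonnegative multiple of [N + w^*]; real and imaginary
    parts are then read off. *)
Lemma multE : b = (nc b ^+ 2 / N)%:C * (N%:C + w^*).
Proof.
have e : N%:C + w != 0.
  by apply/eqP => h; move: bw; rewrite h mulr0 => /eqP; rewrite eq_sym -nc_eq0 nc_real normr_eq0 gt_eqF.
apply: (mulIf e); rewrite bw -mulrA.
have -> : (N%:C + w^*) * (N%:C + w) = (nc (N%:C + w) ^+ 2)%:C.
  by rewrite -mulJ_nc rmorphD /= oppr0.
rewrite -realCM; congr (_%:C).
by rewrite mulrAC (nc_sqr (_ + _)) ReD ImD /= add0r bD expr2 mulfK// gt_eqF.
Qed.

Lemma Im_mult : `|Im b| = x * nc b.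
Proof.
rewrite {1}multE Im_realM ImD ImJ /= add0r mulrN normrN normrM /x.
rewrite ger0_norm ?divr_ge0 ?sqr_ge0 ?(ltW N0)//; ring.
Qed.

(** [N * x] is [|b| |Im w|], so the same [x] that measures the imaginary part of [b] also measures
    the size of [b w]. *)
Lemma mult_nc_bound : nc b * nc w <= Re w + N * x.
Proof.
have -> : N * x = nc b * `|Im w| by rewrite /x; field; rewrite gt_eqF.
rewrite (le_trans (ler_wpM2l (nc_ge0 _) (nc_le_ReIm w)))// mulrDr lerD2r ger0_norm//.
by rewrite ler_piMl// mult_nc_le1.
Qed.

(** Exact splitting: by [Re_part_ge0] and [Re_part_le] the first term lies between [0] and [Re w],
    hence is dominated uniformly in [N], and all the rest is [N x^2]. *)
Lemma Re_mult_mul : Re (w * b) = (Re w + Re w ^+ 2 / N) * nc b ^+ 2 + N * x ^+ 2.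
Proof.
rewrite imdev_sqr {1}multE mulrCA Re_realM.
have -> : Re (w * (N%:C + w^*)) = Re w * N + (Re w ^+ 2 + Im w ^+ 2).
  by rewrite ReM ReD ImD ReJ ImJ /=; ring.
by field; rewrite gt_eqF.
Qed.

Lemma Re_part_le : (Re w + Re w ^+ 2 / N) * nc b ^+ 2 <= Re w.
Proof.
rewrite -(ler_pM2r D0) -mulrA bD.
have -> : (Re w + Re w ^+ 2 / N) * N ^+ 2 = Re w * (N * (N + Re w)).
  by field; rewrite gt_eqF.
rewrite ler_wpM2l// -[leLHS]addr0 lerD ?sqr_ge0// expr2 ler_wpM2r ?addr_ge0 ?(ltW N0)//.
by rewrite lerDl.
Qed.

Lemma Re_part_ge0 : 0 <= (Re w + Re w ^+ 2 / N) * nc b ^+ 2.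
Proof. by rewrite mulr_ge0 ?sqr_ge0// addr_ge0// divr_ge0 ?sqr_ge0// ltW. Qed.

End PointwiseBounds.

Section Single.
Variable f : R -> R.
Hypotheses (fi : intT f) (f0 : forall t, T t -> 0 <= f t).

Let W0 z : disc z -> 0 <= Re (Hz f z).
Proof. by move=> zd; exact: Re_Hz_ge0. Qed.

Lemma Nat_gt0 n : (0 : R) < n.+1%:R. Proof. by rewrite ltr0n. Qed.

Lemma shift_neq0 n w : 0 <= Re w -> n.+1%:R%:C + w != 0.
Proof.
move=> w0; have := nc_add_Re_ge (ltW (Nat_gt0 n)) w0.
by rewrite -nc_gt0; apply: lt_le_trans; exact: Nat_gt0.
Qed.

Lemma mult_ana n : ana (mult f n).
Proof. by apply: anaZ; apply: ana_inv => //; exact: ana_Hz. Qed.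

Lemma multM n z : disc z -> mult f n z * (n.+1%:R%:C + Hz f z) = n.+1%:R%:C.
Proof. by move=> zd; rewrite /mult mulfVK//; apply: shift_neq0; exact: W0. Qed.

Lemma mult_le1 n z : disc z -> nc (mult f n z) <= 1.
Proof. by move=> zd; apply: (mult_nc_le1 (Nat_gt0 n) (W0 zd)); exact: multM. Qed.

Lemma Hz_mult_le n z : disc z -> nc (Hz f z * mult f n z) <= 2 * n.+1%:R.
Proof.
move=> zd; have e : Hz f z * mult f n z = n.+1%:R%:C - n.+1%:R%:C * mult f n z.
  by rewrite -{1}(multM n zd); ring.
rewrite e (le_trans (ncB_le _ _))// mulr_natl mulr2n lerD//.
  by rewrite nc_real ger0_norm.
by rewrite ncM nc_real ger0_norm// ler_piMr// mult_le1.
Qed.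

Lemma shift_cvg (w : C) : (forall n, n.+1%:R%:C + w != 0) ->
  ccvg \oo (fun n : nat => n.+1%:R%:C * (n.+1%:R%:C + w)^-1) 1.
Proof.
move=> h.
have e n : n.+1%:R%:C * (n.+1%:R%:C + w)^-1 = (1 + n.+1%:R^-1%:C * w)^-1.
  have n0 : n.+1%:R%:C != 0 :> C by rewrite -nc_eq0 nc_real normr_eq0 gt_eqF// Nat_gt0.
  rewrite -{1}[n.+1%:R%:C]invrK -invfM fmorphV mulrDr mulVf//.
apply: (@ccvg_near_eq _ _ _ _ (fun n : nat => (1 + n.+1%:R^-1%:C * w)^-1)).
  by apply: nearW => n; rewrite e.
rewrite -[X in ccvg _ _ X]invr1; apply: ccvgV; first exact: oner_neq0.
rewrite -[X in ccvg _ _ X]addr0 -(mul0r w); apply: ccvgD; first exact: ccvg_cst.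
apply: ccvgM; last exact: ccvg_cst.
by apply: ccvg_real; exact: cvg_harmonic.
Qed.

Lemma mult_cvg z : disc z -> ccvg \oo (fun n => mult f n z) 1.
Proof. by move=> zd; apply: shift_cvg => n; apply: shift_neq0; exact: W0. Qed.

(** Gathers the almost everywhere relations into one set of points, on which the later estimates are
    purely pointwise. *)
Definition has_bd t := [/\ 0 <= f t, Re (bd (Hz f) t) = f t,
  radial_limit (Hz f) t (bd (Hz f) t) &
  forall n, radial_limit (mult f n) t (bd (mult f n) t) /\
    bd (mult f n) t = n.+1%:R%:C * (n.+1%:R%:C + bd (Hz f) t)^-1].

Lemma ae_has_bd : aeT has_bd.
Proof.
have l := ae_lim_Hz fi.
apply: aeTS2 (Re_bd_Hz fi l) l => t Tt h1 h2; split; [exact: f0|exact: h1|exact: h2|move=> n].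
have h3 : radial_limit (mult f n) t (n.+1%:R%:C * (n.+1%:R%:C + bd (Hz f) t)^-1).
  apply: radial_limitM; first exact: radial_limit_cst.
  apply: radial_limitV; first by apply: shift_neq0; rewrite h1; exact: f0.
  by apply: radial_limitD; [exact: radial_limit_cst|exact: h2].
by split; [rewrite (bd_radial h3); exact: h3|exact: bd_radial h3].
Qed.

Lemma has_bd_multM t n : has_bd t ->
  bd (mult f n) t * (n.+1%:R%:C + bd (Hz f) t) = n.+1%:R%:C.
Proof.
move=> [h0 h1 _ /(_ n)[_ ->]].
have n0 : n.+1%:R%:C + bd (Hz f) t != 0 by apply: shift_neq0; rewrite h1; exact: h0.
by rewrite (mulfVK n0).
Qed.

Lemma has_bd_cvg t : has_bd t -> ccvg \oo (fun n => bd (mult f n) t) 1.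
Proof.
move=> [h0 h1 _ h2];
apply: (@ccvg_near_eq _ _ _ _ (fun n : nat => n.+1%:R%:C * (n.+1%:R%:C + bd (Hz f) t)^-1)).
  by apply: nearW => n; rewrite (h2 n).2.
by apply: shift_cvg => n; apply: shift_neq0; rewrite h1.
Qed.

Lemma has_bd_imdev_cvg t : has_bd t -> imdev f n t @[n --> \oo] --> (0 : R).
Proof.
move=> gt; rewrite /imdev -[X in _ --> X](mulr0 (`|Im (bd (Hz f) t)| * nc (1 : C))).
apply: cvgM; last exact: cvg_harmonic.
by apply: cvgMr; apply: ccvg_norm; exact: has_bd_cvg.
Qed.

Lemma measurable_imdev n : measurable_fun T (imdev f n).
Proof.
apply: measurable_funM; last exact: measurable_cst.
apply: measurable_funM; last by apply: cmeas_nc; apply: bd_meas; exact: mult_ana.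
apply: measurableT_comp => //.
by have [] := bd_meas (ana_Hz fi).
Qed.

Lemma has_bd_imdev t n : has_bd t -> 0 <= imdev f n t <= 1.
Proof.
move=> gt; have [h0 h1 _ _] := gt; have b := has_bd_multM n gt.
rewrite -h1 in h0.
by rewrite (imdev_ge0 _ _ (Nat_gt0 n)) (imdev_le1 (Nat_gt0 n) b).
Qed.

Lemma imdev_sqr_avg :
  avg (fun t => n.+1%:R * imdev f n t ^+ 2) @[n --> \oo] --> (0 : R).
Proof.
(* The dominated term of [Re_mult_mul] on the circle: it is at most [f] and tends to [f]. *)
pose y n t := (f t + f t ^+ 2 / n.+1%:R) * nc (bd (mult f n) t) ^+ 2.
pose G n z := Hz f z * mult f n z.
have d0 : disc (0 : C) by have : nc (0 : C) < 1 by rewrite nc0.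
have aG n : ana (G n) by apply: anaM; [exact: ana_Hz|exact: mult_ana].
have mG n := bd_mean (aG n) (@Hz_mult_le n).
have lG n := bounded_ae_lim (aG n) (@Hz_mult_le n).
have bG n : aeT (fun t => Re (bd (G n) t) = y n t + n.+1%:R * imdev f n t ^+ 2).
  apply: aeTS ae_has_bd => t Tt gt; have [h0 h1 h2 /(_ n)[h3 _]] := gt.
  rewrite (bd_radial (radial_limitM h2 h3)) /y -h1.
  exact: (Re_mult_mul (Nat_gt0 n) (has_bd_multM n gt)).
have my n : measurable_fun T (y n).
  apply: measurable_funM; last first.
    by apply: measurable_funX; apply: cmeas_nc; apply: bd_meas; exact: mult_ana.
  apply: measurable_funD; first exact: intT_measurable.
  by apply: measurable_funM; [apply: measurable_funX; exact: intT_measurable|exact: measurable_cst].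
have yf n : aeT (fun t => `|y n t| <= f t).
  apply: aeTS ae_has_bd => t Tt gt; have [h0 h1 _ _] := gt; have b := has_bd_multM n gt.
  rewrite -h1 in h0; rewrite /y -h1 ger0_norm; first exact: (Re_part_le (Nat_gt0 n) h0 b).
  exact: (Re_part_ge0 _ (Nat_gt0 n) h0).
have iy n : intT (y n) by exact: intT_le_ae fi (yf n).
have iG n : intT (fun t => Re (bd (G n) t)).
  have : cint (bd (G n)).
    by apply: (cint_bounded_ae (bd_meas (aG n)) (bounded_bd_le (aG n) (@Hz_mult_le n))).
  by case.
have mx n : measurable_fun T (fun t => n.+1%:R * imdev f n t ^+ 2).
  apply: measurable_funM; first exact: measurable_cst.
  by apply: measurable_funX; exact: measurable_imdev.
have e n : avg (fun t => n.+1%:R * imdev f n t ^+ 2) = Re (G n 0) - avg (y n).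
  rewrite -mG Re_cavg -avgB//; apply: ae_eq_avg => //.
    by apply: intT_measurable; exact: intTB.
  by apply: aeTS (bG n) => t _ ->; rewrite addrAC subrr add0r.
have c1 : Re (G n 0) @[n --> \oo] --> avg f.
  have : ccvg \oo (fun n => G n 0) (Hz f 0 * 1).
    by apply: ccvgM; [exact: ccvg_cst|exact: mult_cvg].
  by rewrite mulr1 Hz0 => /ccvg_ReIm[].
have c2 : avg (y n) @[n --> \oo] --> avg f.
  apply: (avg_dct my (intT_measurable fi) fi _ yf).
  apply: aeTS ae_has_bd => t _ gt; rewrite /y.
  have c : (f t + f t ^+ 2 / n.+1%:R) * (nc (bd (mult f n) t) * nc (bd (mult f n) t))
      @[n --> \oo] --> (f t + f t ^+ 2 * 0) * (nc (1 : C) * nc (1 : C)).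
    apply: cvgM; last by apply: cvgM; apply: ccvg_norm; exact: has_bd_cvg.
    by apply: cvgD; [exact: cvg_cst|apply: cvgMr; exact: cvg_harmonic].
  by move: c; rewrite mulr0 addr0 nc1 !mulr1.
have -> : (fun n => avg (fun t => n.+1%:R * imdev f n t ^+ 2)) =
    (fun n => Re (G n 0) - avg (y n)) by apply/funext.
by rewrite -[X in _ --> X](subrr (avg f)); apply: cvgB.
Qed.

Lemma intT_imdev_sqr n : intT (fun t => n.+1%:R * imdev f n t ^+ 2).
Proof.
apply: intTZ; apply: (@intT_bounded_ae _ 1).
  by apply: measurable_funX; exact: measurable_imdev.
apply: aeTS ae_has_bd => t _ /has_bd_imdev => /(_ n)/andP[h0 h1].
by rewrite ger0_norm ?sqr_ge0// expr_le1.
Qed.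

Lemma intT_imdevM n g : intT g -> intT (fun t => g t * imdev f n t).
Proof.
move=> gi; apply: (@intTM_bounded_ae _ 1) => //; first exact: measurable_imdev.
by apply: aeTS ae_has_bd => t _ /has_bd_imdev => /(_ n)/andP[h0 h1]; rewrite ger0_norm.
Qed.

Lemma imdevM_avg g : intT g -> avg (fun t => g t * imdev f n t) @[n --> \oo] --> (0 : R).
Proof.
move=> gi; rewrite -[X in _ --> X](avg_cst 0).
apply: (@avg_dct _ _ _ (fun t => `|g t|)).
- by move=> n; apply: intT_measurable; exact: intT_imdevM.
- exact: measurable_cst.
- exact: intT_norm.
- apply: aeTS ae_has_bd => t _ gt; rewrite -[X in _ --> X](mulr0 (g t)).
  by apply: cvgMr; exact: has_bd_imdev_cvg.
- move=> n; apply: aeTS ae_has_bd => t _ /has_bd_imdev => /(_ n)/andP[h0 h1].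
  by rewrite normrM (ger0_norm h0) ler_piMr.
Qed.

End Single.

End Multipliers.

Section ProductMultipliers.
Variable R : realType.
Local Notation C := R[i].
Local Notation "z ^*" := (conjc z) : ring_scope.
Local Notation Re := (@complex.Re R).
Local Notation Im := (@complex.Im R).
Local Notation T := (@Tdom R).
Local Notation mu := (@lebesgue_measure R).
Implicit Types (G H h : C -> C) (r e t s M N u v : R) (z w b : C).

Lemma nc_prod_le1 I (s : seq I) (P : pred I) (b : I -> C) :
  (forall i, P i -> nc (b i) <= 1) -> nc (\prod_(i <- s | P i) b i) <= 1.
Proof.
move=> b1; elim/big_rec : _ => [|i z Pi z1]; first by rewrite nc1.
by rewrite ncM mulr_ile1 ?nc_ge0 ?b1.
Qed.

Lemma normr_ImM_le z w : `|Im (z * w)| <= `|Im z| * nc w + nc z * `|Im w|.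
Proof.
rewrite ImM addrC (le_trans (ler_normD _ _))// !normrM lerD//.
  by rewrite ler_wpM2l// normr_Re_le.
by rewrite ler_wpM2r// normr_Re_le.
Qed.

Lemma Im_prod_le I (s : seq I) (P : pred I) (b : I -> C) :
  (forall i, P i -> nc (b i) <= 1) ->
  `|Im (\prod_(i <- s | P i) b i)| <= \sum_(i <- s | P i) `|Im (b i)|.
Proof.
move=> b1; elim: s => [|i s ih]; first by rewrite !big_nil /= normr0.
rewrite !big_cons; case: ifP => // Pi.
rewrite (le_trans (normr_ImM_le _ _))// lerD//.
  by rewrite ler_piMr// nc_prod_le1.
by rewrite (le_trans _ ih)// ler_piMl// b1.
Qed.

Variables (m : nat) (f : 'I_m -> R -> R).
Hypotheses (fi : forall j, intT (f j)) (f0 : forall j t, T t -> 0 <= f j t).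

Definition pmult (n : nat) z : C := \prod_(j < m) mult (f j) n z.

Definition all_have_bd t := forall j, has_bd (f j) t.

Definition pdev n t : R := `|Im (bd (pmult n) t)| * (1 + \sum_(l < m) nc (bd (Hz (f l)) t)).

Let pdev_bound n t : R :=
  \sum_(j < m) (1 + \sum_(l < m) f l t) * imdev (f j) n t +
  m%:R * \sum_(j < m) n.+1%:R * imdev (f j) n t ^+ 2.

Lemma pmult_ana n : ana (pmult n).
Proof. by apply: ana_prod => j; exact: (mult_ana (fi j) (@f0 j)). Qed.

Lemma pmult_le1 n z : disc z -> nc (pmult n z) <= 1.
Proof. by move=> zd; apply: nc_prod_le1 => j _; exact: (mult_le1 (fi j) (@f0 j)). Qed.

Lemma pmult_cvg z : disc z -> ccvg \oo (fun n => pmult n z) 1.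
Proof.
move=> zd; have e1 : (1 : C) = \prod_(j < m) 1 by rewrite big1_eq.
rewrite [X in ccvg _ _ X]e1.
by apply: ccvg_prod => j _; exact: (mult_cvg (fi j) (@f0 j)).
Qed.

Lemma pmult_neq0 n z : disc z -> pmult n z != 0.
Proof.
move=> zd; apply/prodf_neq0 => j _.
rewrite mulf_neq0 ?invr_eq0//.
  by rewrite -nc_eq0 nc_real normr_eq0 gt_eqF// Nat_gt0.
by apply: shift_neq0; exact: (Re_Hz_ge0 (fi j) (@f0 j)).
Qed.

Lemma Hz_pmult_le l n z : disc z -> nc (Hz (f l) z * pmult n z) <= 2 * n.+1%:R.
Proof.
move=> zd; rewrite /pmult (bigD1 l)//= mulrA ncM -[leRHS]mulr1.
rewrite ler_pM ?nc_ge0//; first exact: (Hz_mult_le (fi l) (@f0 l)).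
by apply: nc_prod_le1 => j _; exact: (mult_le1 (fi j) (@f0 j)).
Qed.

Lemma ae_all_have_bd : aeT all_have_bd.
Proof.
(* Quantifying over all naturals lets the countable [aeT_forall] handle the finite family. *)
have : aeT (fun t => forall k : nat, forall j : 'I_m, val j = k -> has_bd (f j) t).
  apply: aeT_forall => k; have [km|mk] := ltnP k m.
    by apply: aeTS (ae_has_bd (fi (Ordinal km)) (@f0 (Ordinal km))) => t _ gt j jk;
      rewrite (_ : j = Ordinal km)//; apply: val_inj.
  by apply: aeTW => t _ j jk; move: mk; rewrite -jk leqNgt ltn_ord.
by apply: aeTS => t _ h j; exact: (h (val j) j erefl).
Qed.

Lemma bd_pmult n t : all_have_bd t -> bd (pmult n) t = \prod_(j < m) bd (mult (f j) n) t.
Proof.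
move=> gt; apply: bd_radial; apply/radial_limitP; apply: ccvg_prod => j _.
by apply/radial_limitP; have [_ _ _ /(_ n)[]] := gt j.
Qed.

Lemma bd_pmult_cvg t : all_have_bd t -> ccvg \oo (fun n => bd (pmult n) t) 1.
Proof.
move=> gt; have e1 : (1 : C) = \prod_(j < m) 1 by rewrite big1_eq.
rewrite [X in ccvg _ _ X]e1.
apply: (@ccvg_near_eq _ _ _ _ (fun n => \prod_(j < m) bd (mult (f j) n) t)).
  by apply: nearW => n; rewrite bd_pmult.
by apply: ccvg_prod => j _; apply: has_bd_cvg; exact: gt.
Qed.

Lemma sum_halves (a : 'I_m -> R) :
  \sum_(l < m) \sum_(j < m) (a j / 2 + a l / 2) = m%:R * \sum_(j < m) a j.
Proof.
under eq_bigr do rewrite big_split /= sumr_const card_ord.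
rewrite big_split /= sumr_const card_ord sumrMnl -mulr_suml -mulrnDl -[LHS]mulr_natl.
by rewrite -splitr.
Qed.

(** In the term with [w l], the factor [b l] is split off the product to tame [w l]. What remains is
    at most [(u l + N x l)] times the sum of the [x j], and [N x_l x_j] is split into two halves of
    squares. *)
Lemma prod_im_bound (N : R) (u x : 'I_m -> R) (b w : 'I_m -> C) : 0 < N ->
  (forall j, 0 <= x j) -> (forall j, nc (b j) <= 1) ->
  (forall j, `|Im (b j)| = x j * nc (b j)) ->
  (forall j, nc (b j) * nc (w j) <= u j + N * x j) ->
  `|Im (\prod_(j < m) b j)| * (1 + \sum_(l < m) nc (w l)) <=
  \sum_(j < m) (1 + \sum_(l < m) u l) * x j + m%:R * \sum_(j < m) N * x j ^+ 2.
Proof.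
move=> N0 x0 b1 Ib hw.
have Ib' j : `|Im (b j)| <= x j by rewrite Ib ler_piMr.
have h1 : `|Im (\prod_(j < m) b j)| <= \sum_(j < m) x j.
  by apply: le_trans (Im_prod_le _ _) _ => //; exact: ler_sum.
have h2 l : `|Im (\prod_(j < m) b j)| <= nc (b l) * \sum_(j < m) x j.
  rewrite (bigD1 l)// [in leRHS](bigD1 l)//= (le_trans (normr_ImM_le _ _))//.
  rewrite mulrDr lerD//.
    rewrite Ib [in leRHS]mulrC -[leRHS]mulr1; apply: ler_wpM2l.
      by apply: mulr_ge0; [exact: x0|exact: nc_ge0].
    exact: nc_prod_le1.
  apply: ler_wpM2l; first exact: nc_ge0.
  by apply: le_trans (Im_prod_le _ _) _ => //; exact: ler_sum.
have X0 : 0 <= \sum_(j < m) x j by apply: sumr_ge0.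
have h3 l : `|Im (\prod_(j < m) b j)| * nc (w l) <=
    \sum_(j < m) (u l * x j + (N * x j ^+ 2 / 2 + N * x l ^+ 2 / 2)).
  apply: le_trans (ler_wpM2r (nc_ge0 _) (h2 l)) _; rewrite mulrAC.
  apply: le_trans (ler_wpM2r X0 (hw l)) _; rewrite mulr_sumr; apply: ler_sum => j _.
  rewrite mulrDl lerD2l.
  have : 0 <= N * (x j - x l) ^+ 2 by rewrite mulr_ge0 ?sqr_ge0// ltW.
  by clear; lra.
rewrite mulrDr mulr1 mulr_sumr.
apply: le_trans (lerD h1 (ler_sum _ (fun l _ => h3 l))) _.
rewrite -mulr_sumr mulrDl mul1r -addrA lerD2l.
under eq_bigr do rewrite big_split /= -mulr_sumr.
by rewrite big_split /= -mulr_suml (sum_halves (fun j => N * x j ^+ 2)).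
Qed.

Lemma pdev_ge0 n t : 0 <= pdev n t.
Proof. by rewrite mulr_ge0// addr_ge0// sumr_ge0// => l _; exact: nc_ge0. Qed.

Lemma pdev_le n t : all_have_bd t -> pdev n t <= pdev_bound n t.
Proof.
move=> gt; rewrite /pdev bd_pmult// /pdev_bound.
have bN j := has_bd_multM n (gt j).
have w0 j : 0 <= Re (bd (Hz (f j)) t) by have [h0 h1 _ _] := gt j; rewrite h1.
have N0 := Nat_gt0 R n.
apply: (prod_im_bound N0) => j.
- by have /andP[] := has_bd_imdev n (gt j).
- exact: mult_nc_le1 N0 (w0 j) (bN j).
- exact: Im_mult N0 (bN j).
- have [_ <- _ _] := gt j; exact: mult_nc_bound N0 (w0 j) (bN j).
Qed.

Lemma intT_pdev_bound n : intT (pdev_bound n).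
Proof.
apply: intTD.
  apply: intT_sum => j; apply: (intT_imdevM (fi j) (@f0 j)).
  by apply: intTD; [exact: intT_cst|exact: intT_sum].
by apply: intTZ; apply: intT_sum => j; exact: (intT_imdev_sqr (fi j) (@f0 j)).
Qed.

Lemma measurable_pdev n : measurable_fun T (pdev n).
Proof.
apply: measurable_funM.
  apply: measurableT_comp => //.
  by have [] := bd_meas (pmult_ana n).
apply: measurable_funD; first exact: measurable_cst.
by apply: measurable_sum => l; apply: cmeas_nc; apply: bd_meas; exact: ana_Hz.
Qed.

Lemma intT_pdev n : intT (pdev n).
Proof.
apply: (intT_le_ae (measurable_pdev n) (intT_pdev_bound n)).
by apply: aeTS ae_all_have_bd => t _ gt; rewrite ger0_norm ?pdev_ge0// pdev_le.
Qed.

Lemma cvgr_sum_seq I (s : seq I) (u : I -> nat -> R) (l : I -> R) :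
  (forall i, u i n @[n --> \oo] --> l i) ->
  \sum_(i <- s) u i n @[n --> \oo] --> \sum_(i <- s) l i.
Proof.
move=> ul; elim: s => [|i s ih].
  rewrite big_nil (_ : (fun n => _) = (fun=> 0)); first exact: cvg_cst.
  by apply/funext => n; rewrite big_nil.
rewrite big_cons (_ : (fun n => _) = (fun n => u i n + \sum_(j <- s) u j n)); first exact: cvgD.
by apply/funext => n; rewrite big_cons.
Qed.

Lemma pdev_avg : avg (pdev n) @[n --> \oo] --> (0 : R).
Proof.
have c : avg (pdev_bound n) @[n --> \oo] --> (0 : R).
  have e n : avg (pdev_bound n) =
      \sum_(j < m) avg (fun t => (1 + \sum_(l < m) f l t) * imdev (f j) n t) +
      m%:R * \sum_(j < m) avg (fun t => n.+1%:R * imdev (f j) n t ^+ 2).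
    have i1 j : intT (fun t => (1 + \sum_(l < m) f l t) * imdev (f j) n t).
      apply: (intT_imdevM (fi j) (@f0 j)).
      by apply: intTD; [exact: intT_cst|exact: intT_sum].
    have i2 j := intT_imdev_sqr (fi j) (@f0 j) n.
    rewrite avgD; [|exact: intT_sum|by apply: intTZ; exact: intT_sum].
    by rewrite avg_sum// avgZ ?avg_sum//; exact: intT_sum.
  have -> : (fun n => avg (pdev_bound n)) = (fun n =>
      \sum_(j < m) avg (fun t => (1 + \sum_(l < m) f l t) * imdev (f j) n t) +
      m%:R * \sum_(j < m) avg (fun t => n.+1%:R * imdev (f j) n t ^+ 2)) by apply/funext.
  have e0 : (0 : R) = \sum_(j < m) 0 + m%:R * \sum_(j < m) 0.
    by rewrite big1_eq mulr0 addr0.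
  rewrite [X in _ --> X]e0; apply: cvgD.
    apply: cvgr_sum_seq => j; apply: (imdevM_avg (fi j) (@f0 j)).
    by apply: intTD; [exact: intT_cst|exact: intT_sum].
  by apply: cvgMr; apply: cvgr_sum_seq => j; exact: (imdev_sqr_avg (fi j) (@f0 j)).
apply: squeeze0 c; apply: nearW => n.
rewrite avg_ge0 => [|t _]; last exact: pdev_ge0.
apply: le_avg_ae; [exact: intT_pdev|exact: intT_pdev_bound|].
by apply: aeTS ae_all_have_bd => t _; exact: pdev_le.
Qed.

End ProductMultipliers.

(** * Herglotz decomposition of the Riesz projection *)

Section RieszProjection.
Variable R : realType.
Local Notation C := R[i].
Local Notation "z ^*" := (conjc z) : ring_scope.
Local Notation Re := (@complex.Re R).
Local Notation Im := (@complex.Im R).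
Local Notation T := (@Tdom R).
Variable psi : R -> C.
Hypothesis ipsi : cint psi.

Let part (j : 'I_4) (t : R) : R :=
  Num.max (nth 0 [:: Re (psi t); - Re (psi t); Im (psi t); - Im (psi t)] j) 0.

Let weight (j : 'I_4) : C := nth 0 [:: 1; - 1; 'i%C; - 'i%C] j.

Let part_int j : intT (part j).
Proof.
have [ir ii] := ipsi.
have ipos (g : R -> R) : intT g -> intT (fun t => Num.max (g t) 0).
  move=> gi; apply: (intT_le _ (intT_norm gi)) => [|t _].
    by apply: measurable_maxr; [exact: intT_measurable|exact: measurable_cst].
  by have [h|h] := leP (g t) 0; rewrite ?normr0.
case: j => -[|[|[|[|//]]]] ?; apply: ipos => //=; exact: intTN.
Qed.

Let part_ge0 j t : T t -> 0 <= part j t.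
Proof. by rewrite le_max lexx orbT. Qed.

Lemma cauchyT_real (g : R -> R) (z : C) : intT g -> nc z < 1 ->
  cauchyT (fun t => (g t)%:C) z = 2^-1 * (Hz g z + (avg g)%:C).
Proof.
move=> gi z1; rewrite HzE// subrK mulrA mulVf ?mul1r//.
Qed.

Lemma max_sub_max (x : R) : Num.max x 0 - Num.max (- x) 0 = x.
Proof. by have [h|h] := leP x 0; have [h'|h'] := leP (- x) 0; lra. Qed.

Lemma complex_parts (z : C) :
  z = (Num.max (Re z) 0)%:C - (Num.max (- Re z) 0)%:C +
    'i%C * ((Num.max (Im z) 0)%:C - (Num.max (- Im z) 0)%:C).
Proof. by rewrite -!rmorphB !max_sub_max -complexE. Qed.

(** The Herglotz kernel is [2 ck - 1], so each nonnegative part has Cauchy transform half its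
    Herglotz transform plus half its average; the averages form the constant term. *)
Lemma Pplus_decomp z : disc z ->
  Pplus psi z = 2^-1 * \sum_(j < 4) weight j * (avg (part j))%:C +
    2^-1 * \sum_(j < 4) weight j * Hz (part j) z.
Proof.
move=> zd; have z1 : nc z < 1 := zd; rewrite PplusE//.
have e : cauchyT psi z = \sum_(j < 4) weight j * cauchyT (fun t => (part j t)%:C) z.
  have ick j : cint (fun t => (part j t)%:C * ck z t).
    by apply: cint_ck => //; apply: cint_real; exact: part_int.
  rewrite /cauchyT.
  under eq_bigr do rewrite -cavgZ//.
  rewrite -cavg_sum; last by move=> j; exact: cintZ.
  apply: eq_cavg => t _.
  under eq_bigr do rewrite mulrA.
  rewrite -mulr_suml; congr (_ * _).
  rewrite !big_ord_recr big_ord0 /= /weight /part /=.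
  rewrite {1}(complex_parts (psi t)).
  move: (Num.max _ _)%:C (Num.max _ _)%:C (Num.max _ _)%:C (Num.max _ _)%:C => p q r s.
  ring.
rewrite e -mulrDr -big_split /= mulr_sumr; apply: eq_bigr => j _.
by rewrite cauchyT_real//; ring.
Qed.

(** All that the duality argument needs from the multipliers. [D n] controls [|Im h_n|] against
    [1 + |F|] because an outer factor will be compared with [F] up to an additive constant. *)
Lemma Pplus_multiplier : exists (h : nat -> C -> C) (D : nat -> R -> R) (K : R),
  [/\ forall n, ana (h n), forall n z, disc z -> nc (h n z) <= 1 & forall n, h n 0 != 0] /\
  [/\ forall z, disc z -> ccvg \oo (fun n => h n z) 1,
     aeT (fun t => ccvg \oo (fun n => bd (h n) t) 1) &
     forall n, exists B, forall z, disc z -> nc (Pplus psi z * h n z) <= B] /\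
  [/\ ana (Pplus psi), ae_lim (Pplus psi), 0 <= K,
     forall n, intT (D n) /\
      aeT (fun t => `|Im (bd (h n) t)| * (1 + nc (bd (Pplus psi) t)) <= K * D n t) &
     avg (D n) @[n --> \oo] --> (0 : R)].
Proof.
pose c0 : C := 2^-1 * \sum_(j < 4) weight j * (avg (part j))%:C.
pose F z := c0 + 2^-1 * \sum_(j < 4) weight j * Hz (part j) z.
have FP z : disc z -> F z = Pplus psi z by move=> zd; rewrite Pplus_decomp.
have aF : ana F.
  by apply: anaD; [exact: ana_cst|apply: anaZ; apply: ana_sum => j; apply: anaZ; exact: ana_Hz].
have w1 j : nc (weight j) <= 1.
  have i1 : nc ('i%C : C) = 1 by rewrite ncE /= expr0n add0r expr1n sqrtr1.
  case: j => -[|[|[|[|//]]]] jlt.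
  - by rewrite -[weight _]/(1 : C) nc1.
  - by rewrite -[weight _]/(- 1 : C) ncN nc1.
  - by rewrite -[weight _]/('i%C : C) i1.
  - by rewrite -[weight _]/(- 'i%C : C) ncN i1.
have Fbd t : all_have_bd part t ->
    radial_limit F t (c0 + 2^-1 * \sum_(j < 4) weight j * bd (Hz (part j)) t).
  move=> gt; apply: radial_limitD; first exact: radial_limit_cst.
  apply: radial_limitM; first exact: radial_limit_cst.
  apply/radial_limitP; apply: ccvg_sum => j _; apply: ccvgM; first exact: ccvg_cst.
  by apply/radial_limitP; have [] := gt j.
have gg := ae_all_have_bd part_int part_ge0.
have h21 : nc (2^-1 : C) <= 1.
  rewrite (_ : 2^-1 = (2^-1 : R)%:C :> C); last by rewrite fmorphV rmorph_nat.
  by rewrite nc_real ger0_norm// invf_le1// ler1n.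
have bdP t : all_have_bd part t -> bd (Pplus psi) t = c0 + 2^-1 * \sum_(j < 4) weight j * bd (Hz (part j)) t.
  by move=> gt; apply: bd_radial; apply: radial_limit_ext (Fbd t gt).
(* [F] is [c0] plus a combination of the transforms with coefficients of modulus at most [1], so
   [1 + |F| <= (1 + |c0|) (1 + sum |W_j|)]. *)
exists (pmult part), (pdev part), (1 + nc c0).
have K0 : 0 <= 1 + nc c0 by rewrite addr_ge0// nc_ge0.
split; [split|split; split].
- exact: pmult_ana part_int part_ge0.
- exact: pmult_le1 part_int part_ge0.
- move=> n; apply: (pmult_neq0 part_int part_ge0).
  by have : nc (0 : C) < 1 by rewrite nc0.
- exact: pmult_cvg part_int part_ge0.
- by apply: aeTS gg => t _; exact: bd_pmult_cvg.
- move=> n; exists (nc c0 + 4 * (2 * n.+1%:R)) => z zd; rewrite -FP// /F mulrDl.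
  rewrite (le_trans (ncD_le _ _))// lerD//.
    by rewrite ncM ler_piMr ?nc_ge0// (pmult_le1 part_int part_ge0).
  rewrite -mulrA ncM; apply: le_trans (_ : 1 * (4 * (2 * n.+1%:R)) <= _); last by rewrite mul1r.
  rewrite ler_pM ?nc_ge0// mulr_suml (le_trans (nc_sum_le _ _ _))//.
  rewrite (le_trans (ler_sum _ (_ : forall j : 'I_4, true -> _ <= 2 * n.+1%:R)))//.
    move=> j _; rewrite -mulrA ncM -[leRHS]mul1r ler_pM ?nc_ge0//.
    exact: (Hz_pmult_le part_int part_ge0).
  by rewrite sumr_const card_ord -[leLHS]mulr_natl.
- by apply: ana_ext aF => z zd; rewrite FP.
- apply: ae_limP; apply: aeTS gg => t _ gt; eexists; apply: radial_limit_ext (Fbd t gt) => z.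
  exact: FP.
- exact: K0.
- move=> n; split; first exact: intT_pdev part_int part_ge0 n.
  apply: aeTS gg => t _ gt; rewrite bdP// /pdev mulrCA ler_wpM2l//.
  set S := \sum_(l < 4) nc _.
  have S0 : 0 <= S by apply: sumr_ge0 => l _; exact: nc_ge0.
  have hS : nc (c0 + 2^-1 * \sum_(j < 4) weight j * bd (Hz (part j)) t) <= nc c0 + S.
    rewrite (le_trans (ncD_le _ _))// lerD2l ncM -[leRHS]mul1r ler_pM ?nc_ge0//.
    rewrite (le_trans (nc_sum_le _ _ _))//; apply: ler_sum => j _.
    by rewrite ncM ler_piMl ?nc_ge0.
  have := nc_ge0 c0; nra.
- exact: pdev_avg part_int part_ge0.
Qed.

End RieszProjection.

(** * Pairing with the inner factor *)

Section Duality.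
Variable R : realType.
Local Notation C := R[i].
Local Notation "z ^*" := (conjc z) : ring_scope.
Local Notation Re := (@complex.Re R).
Local Notation Im := (@complex.Im R).
Local Notation T := (@Tdom R).
Local Notation mu := (@lebesgue_measure R).
Implicit Types (G H g J : C -> C) (r e t M : R) (z w b : C).
Variable psi : R -> C.
Hypothesis ipsi : cint psi.
Local Notation F := (Pplus psi).

Lemma aeT_and (P Q : R -> Prop) : aeT P -> aeT Q -> aeT (fun t => P t /\ Q t).
Proof. by apply: aeTS2 => t _. Qed.

Lemma disc0 : disc (0 : C).
Proof. by have : nc (0 : C) < 1 by rewrite nc0. Qed.

Lemma disc_circle r t : 0 <= r -> r < 1 -> disc (r%:C * expi t).
Proof. by move=> r0 r1; have : nc (r%:C * expi t) < 1 by rewrite nc_realexpi. Qed.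

Lemma ana_Pplus : ana F.
Proof.
by apply: ana_ext (ana_cauchyT ipsi) => z zd; rewrite PplusE.
Qed.

Lemma coef_Pplus r n : 0 <= r -> r < 1 ->
  coef (fun t => F (r%:C * expi t)) n = (r ^+ n)%:C * coef psi n.
Proof.
move=> r0 r1; apply: (eq_limit_small r0 r1 (K := avg (fun t => nc (psi t)))).
(* A partial sum with more than [n] terms already has the right [n]-th coefficient, and the tail is
   geometrically small. *)
exists n.+1 => N nN.
pose S t := \sum_(m < N) coef psi m * (r%:C * expi t) ^+ m.
have iF : cint (fun t => F (r%:C * expi t)) by apply: ana_cint => //; exact: ana_Pplus.
have iS : cint S.
  apply: cint_sum => m; under eq_fun do rewrite exprMn mulrA.
  by apply: cintZ; exact: cint_expiX.
have -> : (r ^+ n)%:C * coef psi n = coef S n.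
  rewrite /coef [in RHS](@eq_cavg _ _ (fun t => \sum_(m < N)
      coef psi m * r%:C ^+ m * (expi t ^+ m * (expi t ^+ n)^*))); last first.
    move=> t _; rewrite /S mulr_suml; apply: eq_bigr => m _.
    by rewrite exprMn; ring.
  rewrite cavg_sum; last first.
    by move=> m; apply: cintZ; apply: cint_expiXJ; exact: cint_expiX.
  rewrite (bigD1 (Ordinal nN))//= big1 ?addr0.
    rewrite cavgZ ?cavg_expi_orth ?eqxx ?mulr1 ?rmorphXn; first by rewrite mulrC.
    by apply: cint_expiXJ; exact: cint_expiX.
  move=> m; rewrite -val_eqE /= => mn.
  rewrite cavgZ ?cavg_expi_orth; last by apply: cint_expiXJ; exact: cint_expiX.
  by rewrite (negbTE mn) mulr0.
rewrite /coef -cavgB; [|exact: cint_expiXJ..].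
apply: cavg_bounded_ae.
  by apply: cmeasB; apply: cint_meas; exact: cint_expiXJ.
apply: aeTW => t _; rewrite -mulrBl ncM ncJ nc_expiX mulr1.
have z1 : nc (r%:C * expi t) < 1 by rewrite nc_realexpi.
by rewrite PplusE// cauchyT_approx// nc_realexpi.
Qed.

(** At frequency [n] both [F] and [g] on radius [r] bring a factor [r^n]; [psi] has no dilation, so
    on its side [g] takes the whole [r^(2n)]. The identity is checked on monomials, after
    conjugation to make it linear in [g]. *)
Lemma pairing g r : ana g -> 0 <= r -> r < 1 ->
  cavg (fun t => F (r%:C * expi t) * (g (r%:C * expi t))^*) =
  cavg (fun t => psi t * (g ((r ^+ 2)%:C * expi t))^*).
Proof.
move=> ag r0 r1.
have r20 : 0 <= r ^+ 2 by rewrite exprn_ge0.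
have r2r : r ^+ 2 <= r by rewrite expr2 ler_piMl// ltW.
have r21 : r ^+ 2 < 1 := le_lt_trans r2r r1.
have iF : cint (fun t => F (r%:C * expi t)) by apply: ana_cint => //; exact: ana_Pplus.
have [MF [MF0 hMF]] := ana_bounded ana_Pplus r1.
have i1 H : ana H -> cint (fun t => (F (r%:C * expi t))^* * H (r%:C * expi t)).
  move=> aH; have [B [B0 hB]] := ana_bounded aH r1.
  apply: (@cintM_bounded _ B); first exact: cintJ.
    exact: ana_cmeas.
  by move=> t _; rewrite hB// nc_realexpi.
have i2 H : ana H -> cint (fun t => (psi t)^* * H ((r ^+ 2)%:C * expi t)).
  move=> aH; have [B [B0 hB]] := ana_bounded aH r21.
  apply: (@cintM_bounded _ B); first exact: cintJ.
    exact: ana_cmeas.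
  by move=> t _; rewrite hB// nc_realexpi.
pose L H := cavg (fun t => (F (r%:C * expi t))^* * H (r%:C * expi t)) -
  cavg (fun t => (psi t)^* * H ((r ^+ 2)%:C * expi t)).
suff /eqP : L g = 0.
  rewrite subr_eq0 => /eqP/(congr1 (@conjc _)); rewrite -!cavgJ; [|exact: i2|exact: i1].
  move=> e; rewrite (@eq_cavg _ _ (fun t => ((F (r%:C * expi t))^* * g (r%:C * expi t))^*)).
    by rewrite e; apply: eq_cavg => t _; rewrite rmorphM /= conjcK.
  by move=> t _; rewrite rmorphM /= conjcK.
have Ap : 0 <= avg (fun t => nc (psi t)) by apply: avg_ge0 => t _; exact: nc_ge0.
apply: (@ana_functional0 _ L r (MF + avg (fun t => nc (psi t)))) => //.
- by rewrite ltr_pwDl.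
- move=> H e aH He; rewrite /L (le_trans (ncB_le _ _))// mulrDl lerD//.
    rewrite (le_trans (nc_cavg_le (i1 _ aH)))// -[leRHS]avg_cst.
    apply: le_avg; [exact/cint_nc/i1|exact: intT_cst|] => t _.
    by rewrite ncM ncJ ler_pM ?nc_ge0 ?hMF ?He ?nc_realexpi.
  rewrite (le_trans (nc_cavg_le (i2 _ aH)))// mulrC -avgZ; last exact: cint_nc.
  apply: le_avg; [exact/cint_nc/i2|by apply: intTZ; exact: cint_nc|] => t _.
  by rewrite ncM ncJ mulrC ler_wpM2r ?nc_ge0// He// nc_realexpi.
- move=> H1 H2 a1 a2; rewrite /L.
  under eq_cavg do rewrite mulrDr.
  under [X in _ - X = _]eq_cavg do rewrite mulrDr.
  rewrite !cavgD; [ring|exact: i2|exact: i2|exact: i1|exact: i1].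
- move=> c H aH; rewrite /L.
  under eq_cavg do rewrite mulrCA.
  under [X in _ - X = _]eq_cavg do rewrite mulrCA.
  rewrite !cavgZ; [ring|exact: i2|exact: i1].
- move=> n; rewrite /L.
  have cJ u (s : R) : cint u -> cavg (fun t => (u t)^* * (s%:C * expi t) ^+ n) =
      (s ^+ n)%:C * (coef u n)^*.
    move=> iu; rewrite /coef -cavgJ; last exact: cint_expiXJ.
    rewrite -cavgZ; last by apply: cintJ; exact: cint_expiXJ.
    apply: eq_cavg => t _; rewrite exprMn rmorphM /= conjcK rmorphXn; ring.
  have cM (s : R) w : conjc (s%:C * w) = s%:C * conjc w.
    by apply: complex_eqP; rewrite ?ReJ ?ImJ ?Re_realM ?Im_realM ?ReJ ?ImJ ?mulrN.
  by rewrite !cJ// coef_Pplus// cM mulrA -realCM -exprD addnn -mul2n exprM subrr.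
Qed.

(** Radial passage to the limit in [pairing]: one side is dominated by [B |psi|], the other by the
    bound on [F g], as [F] alone need not be integrable on the circle. *)
Lemma boundary_pairing g (B B' : R) : ana g -> ae_lim F ->
  (forall z, disc z -> nc (g z) <= B) -> (forall z, disc z -> nc (F z * g z) <= B') ->
  cavg (fun t => psi t * (bd g t)^*) = cavg (fun t => bd F t * (bd g t)^*).
Proof.
move=> ag lF gB FgB.
have lg := bounded_ae_lim ag gB.
have rn0 := rn_ge0 R; have rn1 := rn_lt1 R.
have r20 n : 0 <= rn R n ^+ 2 by rewrite exprn_ge0.
have r21 n : rn R n ^+ 2 < 1 by rewrite expr_lt1.
have r2l : rn R n ^+ 2 @[n --> \oo] --> (1 : R)^'-.
  apply: seq_at_left => //; rewrite -[X in _ --> X](mulr1 1).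
  by under eq_fun do rewrite expr2; apply: cvgM; exact: rn_cvg.
have c1 : ccvg \oo (fun n => cavg (fun t => psi t * (g ((rn R n ^+ 2)%:C * expi t))^*))
    (cavg (fun t => psi t * (bd g t)^*)).
  apply: (@cavg_dct _ _ _ (fun t => B * nc (psi t))).
  - by move=> n; apply: cmeasM; [exact: cint_meas|apply: cmeasJ; exact: ana_cmeas].
  - by apply: cmeasM; [exact: cint_meas|apply: cmeasJ; exact: bd_meas].
  - by apply: intTZ; exact: cint_nc.
  - apply: aeTS lg => t _ h; apply: ccvgM; first exact: ccvg_cst.
    by apply: ccvgJ; apply: radial_limit_seq h.
  - move=> n; apply: aeTW => t _; rewrite ncM ncJ mulrC ler_wpM2r ?nc_ge0// gB//.
    exact: disc_circle.
apply: (ccvg_unique c1).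
apply: (@ccvg_near_eq _ _ _ _
  (fun n => cavg (fun t => F ((rn R n)%:C * expi t) * (g ((rn R n)%:C * expi t))^*))).
  by apply: nearW => n; rewrite pairing.
apply: (@cavg_dct _ _ _ (fun=> B')).
- by move=> n; apply: cmeasM; [|apply: cmeasJ]; apply: ana_cmeas => //; exact: ana_Pplus.
- by apply: cmeasM; [|apply: cmeasJ]; apply: bd_meas => //; exact: ana_Pplus.
- exact: intT_cst.
- apply: aeTS2 lF lg => t _ h1 h2; have al := @rn_at_left R.
  by apply: ccvgM; [|apply: ccvgJ]; exact: radial_limit_seq.
- move=> n; apply: aeTW => t _; rewrite ncM ncJ -ncM; apply: FgB; exact: disc_circle.
Qed.

(** Boundedness of [F h_0] gives [|F| <= B1 / |h_0|] on the circle, and [ln |h_0|] is integrable by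
    [jensen]; from below [e] bounds the maximum. Taking [B1 >= 1] puts [e] under the same upper
    bound. *)
Lemma ln_max_intT e : 0 < e -> e <= 1 -> intT (fun t => ln (Num.max (nc (bd F t)) e)).
Proof.
move=> e0 e1; have [h [D [K [[ah h1 h0] [[_ _ Fh] [aF lF _ _ _]]]]]] := Pplus_multiplier ipsi.
have [B hB] := Fh 0%N.
have [bn il] := jensen (ah 0%N) (h1 0%N) (h0 0%N).
have lh := bounded_ae_lim (ah 0%N) (h1 0%N).
pose B1 := Num.max B 1; have B11 : 1 <= B1 by rewrite le_max lexx orbT.
have B10 : 0 < B1 by rewrite (lt_le_trans ltr01).
have mp t : 0 < Num.max (nc (bd F t)) e by rewrite lt_max e0 orbT.
have hb1 := bounded_bd_le (ah 0%N) (h1 0%N).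
apply: (@intT_le_ae _ _ (fun t => `|ln e| + (`|ln B1| + `|ln (nc (bd (h 0%N) t))|))).
- apply: measurableT_comp; first exact: measurable_ln.
  apply: measurable_maxr; last exact: measurable_cst.
  by apply: cmeas_nc; exact: bd_meas.
- by apply: intTD; [exact: intT_cst|apply: intTD; [exact: intT_cst|exact: intT_norm]].
have lim : aeT (fun t => radial_limit F t (bd F t) /\ radial_limit (h 0%N) t (bd (h 0%N) t)).
  by apply: aeTS2 lF lh => t _.
apply: aeTS3 lim bn hb1 => t _ [l1 l2] bhn bh1.
have p0 : 0 < nc (bd (h 0%N) t) by rewrite nc_gt0.
have FB : nc (bd F t) * nc (bd (h 0%N) t) <= B1.
  rewrite -ncM; apply: le_trans (_ : B <= _); last by rewrite le_max lexx.
  exact: (radial_limit_norm_le hB (radial_limitM l1 l2)).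
have up : Num.max (nc (bd F t)) e <= B1 / nc (bd (h 0%N) t).
  rewrite ge_max !ler_pdivlMr// FB /= (le_trans _ B11)//.
  by rewrite mulr_ile1 ?nc_ge0// ltW.
have lo : ln e <= ln (Num.max (nc (bd F t)) e) by rewrite ler_ln ?posrE// le_max lexx orbT.
have up' : ln (Num.max (nc (bd F t)) e) <= ln B1 - ln (nc (bd (h 0%N) t)).
  by rewrite -ln_div ?posrE// ler_ln ?posrE// divr_gt0.
have a1 := ler_norm (- ln e); have a2 := ler_norm (ln B1).
have a3 := ler_norm (- ln (nc (bd (h 0%N) t))).
rewrite !normrN in a1 a3.
rewrite ler_norml; have b1 := normr_ge0 (ln e); have b2 := normr_ge0 (ln B1).
have b3 := normr_ge0 (ln (nc (bd (h 0%N) t))).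
by apply/andP; split; lra.
Qed.

Lemma nc_conjB (w : C) : nc (w^* - w) = 2 * `|Im w|.
Proof.
rewrite ncE ReB ImB ReJ ImJ subrr expr0n add0r sqrtr_sqr -opprD normrN.
have -> : Im w + Im w = 2 * Im w by ring.
by rewrite normrM ger0_norm.
Qed.

(** With [p] the outer factor, [j p] the value of [F] and [j w] the test function, this compares the
    integrand of the pairing with the analytic product [w p]: one error comes from [|j| < 1], the
    other from [w^* - w]. *)
Lemma twist_dist (p j w : C) : nc j <= 1 -> nc w <= 1 ->
  nc (j * p * (j * w)^* - w * p) <= (1 - nc j ^+ 2) * nc p + 2 * (`|Im w| * nc p).
Proof.
move=> j1 w1.
have -> : j * p * (j * w)^* - w * p = p * (w^* - w - (1 - nc j ^+ 2)%:C * w^*).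
  have -> : (1 - nc j ^+ 2)%:C = 1 - j^* * j by rewrite mulJ_nc rmorphB.
  have -> : (j * w)^* = j^* * w^* by rewrite rmorphM.
  ring.
have d0 : 0 <= 1 - nc j ^+ 2 by rewrite subr_ge0 exprn_ile1 ?nc_ge0.
rewrite ncM (le_trans (ler_wpM2l (nc_ge0 p) (ncB_le _ _)))// nc_conjB ncM nc_real ncJ (ger0_norm d0).
have h : (1 - nc j ^+ 2) * nc w * nc p <= (1 - nc j ^+ 2) * nc p.
  by rewrite ler_wpM2r ?nc_ge0// ler_piMr.
by move: h; rewrite mulrDr; lra.
Qed.

(* The pairing of [psi] with the conjugate of [J] evaluates the outer factor at the
   origin: this would be the mean value property of [Phi], which need not be in H^1;
   hence the multipliers. *)
Lemma outer_value_pairing (l : R -> R) (c : C) J (B eps : R) : intT l -> nc c = 1 -> ana J ->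
  (forall z, disc z -> nc (J z) <= B) ->
  (forall z, disc z -> F z = J z * (c * expC (Hz l z))) ->
  0 <= eps -> aeT (fun t => nc (bd J t) <= 1) ->
  aeT (fun t => (1 - nc (bd J t) ^+ 2) * expR (l t) <= eps) ->
  nc (cavg (fun t => psi t * (bd J t)^*) - c * expC (Hz l 0)) <= eps.
Proof.
move=> li c1 aJ JB FJ eps0 J1 Jeps.
have [h [D [K [[ah h1 h0] [[hcv bhcv Fh] [aF lF K0 hD Dcv]]]]]] := Pplus_multiplier ipsi.
have lJ := bounded_ae_lim aJ JB.
have lW := ae_lim_Hz li.
pose ph t := c * expC (bd (Hz l) t).
have phr : aeT (fun t => radial_limit (fun z => c * expC (Hz l z)) t (ph t)).
  apply: aeTS lW => t _ h'; apply: radial_limitM; first exact: radial_limit_cst.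
  exact: radial_limit_expC.
have phn : aeT (fun t => nc (ph t) = expR (l t)).
  by apply: aeTS (Re_bd_Hz li lW) => t _ e; rewrite /ph ncM c1 mul1r nc_expC e.
have bF : aeT (fun t => bd F t = bd J t * ph t).
  apply: aeTS2 lJ phr => t _ a b; apply: bd_radial.
  by apply: radial_limit_ext (radial_limitM a b) => z zd; rewrite FJ.
(* [|F| = |J| exp l >= |J|^2 exp l], and the last is at least [exp l - eps]. *)
have kF : aeT (fun t => expR (l t) <= nc (bd F t) + eps).
  have J2 : aeT (fun t => nc (bd J t) <= 1 /\ (1 - nc (bd J t) ^+ 2) * expR (l t) <= eps).
    by apply: aeTS2 J1 Jeps => t _.
  apply: aeTS3 bF phn J2 => t _ -> e [j1 j2]; rewrite ncM e.
  have j0 := nc_ge0 (bd J t); have k0 := expR_gt0 (l t).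
  have : nc (bd J t) ^+ 2 * expR (l t) <= nc (bd J t) * expR (l t).
    by rewrite ler_wpM2r ?(ltW k0)// expr2 ler_piMr.
  by move: j2; rewrite mulrBl mul1r; lra.
have aPhi : ana (fun z => c * expC (Hz l z)) by apply: anaZ; apply: ana_expC; exact: ana_Hz.
pose g n z := J z * h n z; pose G n z := h n z * (c * expC (Hz l z)).
have ag n : ana (g n) by exact: anaM.
have aG n : ana (G n) by exact: anaM.
have B0 : 0 <= B by rewrite (le_trans (nc_ge0 _) (JB 0 disc0)).
have gB n z : disc z -> nc (g n z) <= B.
  by move=> zd; rewrite ncM -[leRHS]mulr1 ler_pM ?nc_ge0 ?JB ?h1.
have lh n := bounded_ae_lim (ah n) (h1 n).
have bg n : aeT (fun t => bd (g n) t = bd J t * bd (h n) t).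
  by apply: aeTS2 lJ (lh n) => t _ a b; apply: bd_radial; exact: radial_limitM.
have bG n : aeT (fun t => bd (G n) t = bd (h n) t * ph t).
  by apply: aeTS2 (lh n) phr => t _ a b; apply: bd_radial; exact: radial_limitM.
have bh1 n := bounded_bd_le (ah n) (h1 n).
(* [F h_n] is bounded; through [kF] so is [h_n] times the outer function on the circle, and
   [outer_max] carries the bound into the disc. *)
have GB n : exists M, forall z, disc z -> nc (G n z) <= M.
  have [B1 hB1] := Fh n; exists (B1 + eps) => z zd.
  rewrite /G !ncM c1 mul1r; apply: (outer_max li (ah n) (h1 n)) => //.
  have Fhb : aeT (fun t => nc (bd F t) * nc (bd (h n) t) <= B1).
    apply: aeTS2 lF (lh n) => t _ a b; rewrite -ncM.
    exact: (radial_limit_norm_le hB1 (radial_limitM a b)).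
  apply: aeTS3 kF Fhb (bh1 n) => t _ e1 e2 e3.
  have p0 := nc_ge0 (bd (h n) t).
  rewrite (le_trans (ler_wpM2l p0 e1))// mulrDr mulrC lerD//.
  by rewrite ler_piMl.
(* [boundary_pairing] and the mean value property of the bounded [G n] turn both quantities into
   averages over the circle, where [twist_dist] applies. *)
have est n : nc (cavg (fun t => psi t * (bd (g n) t)^*) - G n 0) <=
    eps + 2 * (1 + eps) * K * avg (D n).
  have [B1 hB1] := Fh n; have [M hM] := GB n.
  have Fg z : disc z -> nc (F z * g n z) <= B * B1.
    move=> zd; have -> : F z * g n z = J z * (F z * h n z) by rewrite /g; ring.
    by rewrite ncM ler_pM ?nc_ge0 ?JB ?hB1.
  have FgB := bounded_bd_le (anaM ana_Pplus (ag n)) Fg.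
  have mFg : cmeas (fun t => bd F t * (bd (g n) t)^*).
    by apply: cmeasM; [|apply: cmeasJ]; apply: bd_meas => //; exact: ana_Pplus.
  have bg1 := bounded_bd_le (ag n) (gB n).
  have iFg : cint (fun t => bd F t * (bd (g n) t)^*).
    apply: (@cint_bounded_ae _ (B * B1)) => //.
    apply: aeTS3 lF (bounded_ae_lim (ag n) (gB n)) FgB => t _ a b.
    by rewrite (bd_radial (radial_limitM a b)) !ncM ncJ.
  have iG : cint (bd (G n)).
    by apply: (@cint_bounded_ae _ M); [exact: bd_meas|exact: bounded_bd_le hM].
  have [iD hDn] := hD n.
  rewrite (boundary_pairing (ag n) lF (gB n) Fg) -(bd_mean (aG n) hM) -cavgB//.
  have iE := cintB iFg iG.
  rewrite (le_trans (nc_cavg_le iE))//.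
  rewrite -[X in X + _]avg_cst -[X in _ + X]avgZ// -avgD; [|exact: intT_cst|exact: intTZ].
  apply: le_avg_ae; [exact: cint_nc|by apply: intTD; [exact: intT_cst|exact: intTZ]|].
  have e1 : aeT (fun t => [/\ bd F t = bd J t * ph t, bd (g n) t = bd J t * bd (h n) t &
      bd (G n) t = bd (h n) t * ph t]) by apply: aeTS3 bF (bg n) (bG n) => t _ -> -> ->.
  have e2 : aeT (fun t => [/\ nc (bd J t) <= 1, nc (bd (h n) t) <= 1 &
      nc (ph t) <= nc (bd F t) + eps]).
    apply: aeTS3 J1 (bh1 n) (aeT_and kF phn) => t _ -> -> [a b].
    by rewrite b.
  have e3 : aeT (fun t => (1 - nc (bd J t) ^+ 2) * nc (ph t) <= eps).
    by apply: aeTS2 Jeps phn => t _ a ->.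
  have e4 := aeT_and e3 hDn.
  apply: aeTS3 e1 e2 e4 => t _ [a1 -> ->] [b1 b2 b3] [c2 c3].
  have i0 := normr_ge0 (Im (bd (h n) t)); have f0 := nc_ge0 (bd F t).
  have := twist_dist (ph t) b1 b2; rewrite -a1.
  (* Uses [|ph| <= |F| + eps <= (1 + eps) (1 + |F|)]. *)
  have : `|Im (bd (h n) t)| * nc (ph t) <= (1 + eps) * (K * D n t).
    rewrite (le_trans (ler_wpM2l i0 b3))//.
    have : (1 + eps) * (`|Im (bd (h n) t)| * (1 + nc (bd F t))) <= (1 + eps) * (K * D n t).
      by rewrite ler_wpM2l// addr_ge0.
    have : 0 <= eps * (`|Im (bd (h n) t)| * nc (bd F t)) by rewrite !mulr_ge0.
    by rewrite !mulrDr !mulrDl !mul1r mulr1; move: i0; clear; nra.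
  by move: c2; clear; lra.
have lim1 : ccvg \oo (fun n => cavg (fun t => psi t * (bd (g n) t)^*))
    (cavg (fun t => psi t * (bd J t)^*)).
  apply: (@cavg_dct _ _ _ (fun t => nc (psi t))).
  - move=> n; apply: cmeasM; [exact: cint_meas|apply: cmeasJ; exact: bd_meas].
  - by apply: cmeasM; [exact: cint_meas|apply: cmeasJ; exact: bd_meas].
  - exact: cint_nc.
  - apply: aeTS2 bhcv (aeT_forall bg) => t _ a b; apply: ccvgM; first exact: ccvg_cst.
    apply: ccvgJ; rewrite -[X in ccvg _ _ X]mulr1.
    have -> : (fun n => bd (g n) t) = (fun n => bd J t * bd (h n) t) by apply/funext.
    by apply: ccvgM => //; exact: ccvg_cst.
  - move=> n; apply: aeTS3 (bg n) J1 (bh1 n) => t _ -> a b.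
    by rewrite !ncM ncJ ncM ler_piMr ?nc_ge0// mulr_ile1 ?nc_ge0.
have lim2 : ccvg \oo (fun n => G n 0) (c * expC (Hz l 0)).
  rewrite -[X in ccvg _ _ X]mul1r; apply: ccvgM; [exact: hcv disc0|exact: ccvg_cst].
have lim3 : ccvg \oo (fun n => cavg (fun t => psi t * (bd (g n) t)^*) - G n 0)
    (cavg (fun t => psi t * (bd J t)^*) - c * expC (Hz l 0)) by apply: ccvgB.
move: lim3 => /ccvg_norm lim3.
have lim4 : eps + 2 * (1 + eps) * K * avg (D n) @[n --> \oo] --> eps.
  rewrite -[X in _ --> X]addr0; apply: cvgD; first exact: cvg_cst.
  by rewrite -[X in _ --> X](mulr0 (2 * (1 + eps) * K)); apply: cvgM => //; exact: cvg_cst.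
have := ler_cvg_to lim3 lim4; apply; exact: nearW est.
Qed.

End Duality.

(** * Geometric means *)

Section IntegralAe.
Local Open Scope ereal_scope.
Import HBNNSimple.
Context d (X : measurableType d) (R : realType) (m : {measure set X -> \bar R}).
Implicit Types (f g : X -> \bar R) (D : set X).

(* No measurability is required of [f] and [g]: off a null set, every simple function
   below [f] can be modified into one below [g]. *)
Lemma ge0_le_integral_ae D f g : (forall t, 0 <= f t) -> (forall t, 0 <= g t) ->
  {ae m, forall t, D t -> f t <= g t} -> \int[m]_(t in D) f t <= \int[m]_(t in D) g t.
Proof.
move=> f0 g0 [N [mN N0 hN]]; rewrite !ge0_integralE//; apply: ge_ereal_sup => _ [h /= hf <-].
have mNC : measurable (~` N) by exact: measurableC.
have -> : sintegral m h = sintegral m (proj_nnsfun h mNC).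
  rewrite -!integralT_nnsfun; apply: ae_eq_integral => //.
  - exact/measurable_EFinP.
  - exact/measurable_EFinP.
  exists N; split => // t /= ht; apply: contrapT => Nt; apply: ht => _.
  by rewrite mindicE mem_set ?mulr1.
apply: ereal_sup_ubound; exists (proj_nnsfun h mNC) => //= t.
rewrite mindicE; have [Nt|Nt] := pselect (N t).
  by rewrite memNset ?mulr0//=; rewrite /patch; case: ifP.
rewrite mem_set// mulr1 (le_trans (hf t))// /patch; case: ifPn => // /set_mem Dt.
by apply: contrapT => h'; apply: Nt; apply: hN => /= /(_ Dt).
Qed.

Lemma le_integral_ae D f g : {ae m, forall t, D t -> f t <= g t} ->
  \int[m]_(t in D) f t <= \int[m]_(t in D) g t.
Proof.
move=> fg; rewrite integralE [leRHS]integralE; apply: leeB; apply: ge0_le_integral_ae => //.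
  apply: filterS fg => t h Dt.
  by rewrite !funeposE ge_max !le_max lexx h// orbT.
apply: filterS fg => t h Dt.
by rewrite !funenegE ge_max !le_max lexx leeN2 h// orbT.
Qed.

Lemma eq_integral_ae D f g : {ae m, forall t, D t -> f t = g t} ->
  \int[m]_(t in D) f t = \int[m]_(t in D) g t.
Proof.
move=> fg; apply/eqP; rewrite eq_le.
by apply/andP; split; apply: le_integral_ae; apply: filterS fg => t h Dt; rewrite h.
Qed.

End IntegralAe.

Section LogMean.
Variable R : realType.
Local Notation C := R[i].
Local Notation "z ^*" := (conjc z) : ring_scope.
Local Notation Re := (@complex.Re R).
Local Notation Im := (@complex.Im R).
Local Notation T := (@Tdom R).
Local Notation mu := (@lebesgue_measure R).
Implicit Types (I Phi : C -> C) (e : R) (l : R -> R) (z w c : C).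
Variable psi : R -> C.
Hypothesis ipsi : cint psi.
Local Notation F := (Pplus psi).

Lemma HzN l z : intT l -> nc z < 1 -> Hz (fun t => - l t) z = - Hz l z.
Proof.
move=> li z1; have H0 : Hz (fun=> 0) z = 0.
  by rewrite /Hz (@eq_cavg _ _ (fun=> 0)) ?cavg_cst// => t _; rewrite mulr0.
have := HzB (intT_cst 0) li z1; rewrite H0 sub0r => <-.
by congr (Hz _ z); apply/funext => t; rewrite sub0r.
Qed.

Lemma expC_mulN w : expC (- w) * expC w = 1.
Proof. by rewrite expCN mulVf ?expC_neq0. Qed.

Lemma ae_lim_Pplus : ae_lim F.
Proof. by have [h [D [K [_ [_ []]]]]] := Pplus_multiplier ipsi. Qed.

Lemma ae_bval (G : C -> C) : ae_lim G -> aeT (fun t => bval G t = bd G t).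
Proof. by apply: aeTS => t _; exact: bval_radial_limit. Qed.

(** [F] may be unbounded, so [outer_max] is applied with exponent [- l] to the bounded products
    [F h_n], whose boundary moduli are still at most [exp l]; then [h_n] tends to [1] at [z]. *)
Lemma Pplus_div_outer_le1 l z : intT l -> aeT (fun t => nc (bd F t) <= expR (l t)) ->
  disc z -> nc (F z * expC (- Hz l z)) <= 1.
Proof.
move=> li Fl zd.
have [h [D [K [[ah h1 h0] [[hcv _ Fh] [aF lF _ _ _]]]]]] := Pplus_multiplier ipsi.
have step n : nc (F z * h n z) * nc (expC (- Hz l z)) <= 1.
  have [B hB] := Fh n; rewrite -HzN//.
  apply: (outer_max (G := fun z => F z * h n z) (intTN li) (anaM aF (ah n)) hB) => //.
  have lh := bounded_ae_lim (ah n) (h1 n).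
  apply: aeTS3 Fl (bounded_bd_le (ah n) (h1 n)) (aeT_and lF lh) => t _ a b [c d].
  rewrite (bd_radial (radial_limitM c d)) ncM expRN ler_pdivrMr ?expR_gt0// mul1r.
  by rewrite (le_trans _ a)// ler_piMr ?nc_ge0.
have lim : ccvg \oo (fun n => F z * h n z * expC (- Hz l z)) (F z * expC (- Hz l z)).
  apply: ccvgM; last exact: ccvg_cst.
  by rewrite -[X in ccvg _ _ X]mulr1; apply: ccvgM; [exact: ccvg_cst|exact: hcv].
move: lim => /ccvg_norm lim; apply: (cvgr_to_le lim).
by apply: nearW => n; rewrite ncM.
Qed.

Lemma logabs_lnP w e : 0 < e -> (logabs w <= (ln (Num.max (nc w) e))%:E)%E.
Proof.
move=> e0; rewrite /logabs; case: eqP => [_|/eqP w0]; first exact: leNye.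
by rewrite lee_fin ler_ln ?posrE ?nc_gt0// ?lt_max ?e0 ?orbT// le_max lexx.
Qed.

Lemma log_mean_approx e : 0 < e -> e <= 1 -> exists l, [/\ intT l,
  aeT (fun t => (logabs (bd F t) <= (l t)%:E)%E) & expR (avg l) <= avg (fun t => nc (psi t)) + e].
Proof.
move=> e0 e1; pose k t := Num.max (nc (bd F t)) e; pose l t := ln (k t).
have li : intT l := ln_max_intT ipsi e0 e1.
have k0 t : 0 < k t by rewrite lt_max e0 orbT.
have lk t : expR (l t) = k t by rewrite lnK ?posrE.
exists l; split => //; first by apply: aeTW => t _; exact: logabs_lnP.
pose J z := F z * expC (- Hz l z).
have aJ : ana J by apply: anaM; [exact: ana_Pplus|apply: ana_expC; apply: anaN; exact: ana_Hz].
have J1 z : disc z -> nc (J z) <= 1.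
  by apply: Pplus_div_outer_le1 => //; apply: aeTW => t _; rewrite lk le_max lexx.
have FJ z : disc z -> F z = J z * (1 * expC (Hz l z)).
  by move=> _; rewrite mul1r -mulrA expC_mulN mulr1.
have lW := ae_lim_Hz li.
have bJ : aeT (fun t => nc (bd J t) = nc (bd F t) / k t).
  apply: aeTS3 ae_lim_Pplus lW (Re_bd_Hz li lW) => t _ a b c.
  have b' : radial_limit (fun z => expC (0 - Hz l z)) t (expC (0 - bd (Hz l) t)).
    by apply: radial_limit_expC; apply: radial_limitB b; exact: radial_limit_cst.
  have -> : bd J t = bd F t * expC (0 - bd (Hz l) t).
    apply: bd_radial; apply: radial_limit_ext (radial_limitM a b') => z _.
    by rewrite /J sub0r.
  by rewrite sub0r ncM nc_expC ReN c expRN lk.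
have bJ1 := bounded_bd_le aJ J1.
have est : nc (cavg (fun t => psi t * (bd J t)^*) - 1 * expC (Hz l 0)) <= e.
  apply: (outer_value_pairing ipsi li (nc1 R) aJ J1 FJ (ltW e0) bJ1).
  (* Where [|F| <= e] the weight [exp l] equals [e]; elsewhere [|J| = 1]. *)
  apply: aeTS bJ => t _ ->; rewrite lk /k; have [Fe|Fe] := leP (nc (bd F t)) e.
    by rewrite -[leRHS]mul1r ler_wpM2r ?(ltW e0)// gerBl exprn_ge0// divr_ge0 ?nc_ge0// ltW.
  by rewrite divff ?gt_eqF ?(lt_trans e0)// expr1n subrr mul0r ltW.
have mX : cmeas (fun t => psi t * (bd J t)^*).
  by apply: cmeasM; [exact: cint_meas|apply: cmeasJ; exact: bd_meas].
have bX : aeT (fun t => nc (psi t * (bd J t)^*) <= nc (psi t)).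
  by apply: aeTS bJ1 => t _ h; rewrite ncM ncJ ler_piMr ?nc_ge0.
have iX := cint_le_ae mX (cint_nc ipsi) bX.
have h0 : nc (expC (Hz l 0)) = expR (avg l) by rewrite nc_expC Hz0.
have := nc_sub_le (expC (Hz l 0)) (cavg (fun t => psi t * (bd J t)^*)).
have := nc_cavg_le iX; have := le_avg_ae (cint_nc iX) (cint_nc ipsi) bX.
by move: est; rewrite mul1r nc_distC h0; clear; lra.
Qed.

(** [|I| = 1] on the circle permits the error [0] in [outer_value_pairing], so the pairing is
    exactly [Phi 0]. *)
Lemma inner_outer_pairing I Phi : inner I -> outer Phi -> 0 < Phi 0 ->
  (forall z, disc z -> F z = I z * Phi z) ->
  exists l, [/\ intT l, aeT (fun t => logabs (bval F t) = (l t)%:E),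
    cmeas (bd I), aeT (fun t => bval I t = bd I t /\ nc (bd I t) = 1) &
    cavg (fun t => psi t * (bd I t)^*) = (expR (avg l))%:C].
Proof.
move=> [_ [[M IM] I1]] [c [k [c1 [k0 [li PhiE]]]]] Phi0 FI.
pose l t := ln (k t); have {}li : intT l := li.
have {}c1 : nc c = 1 by [].
have c0 : c != 0 by rewrite -nc_gt0 c1.
have {}FI z : disc z -> F z = I z * (c * expC (Hz l z)).
  by move=> zd; rewrite FI// PhiE.
(* Read off from [I = F / Phi], where [1 / Phi] is again a constant times an exponential. *)
have aI : ana I.
  have a : ana (fun z => F z * (c^-1 * expC (- Hz l z))).
    apply: anaM; first exact: ana_Pplus.
    by apply: anaZ; apply: ana_expC; apply: anaN; exact: ana_Hz.
  apply: ana_ext a => z zd; rewrite FI//.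
  have -> : I z * (c * expC (Hz l z)) * (c^-1 * expC (- Hz l z)) =
    I z * (c / c) * (expC (- Hz l z) * expC (Hz l z)) by ring.
  by rewrite expC_mulN divff// !mulr1.
have lI := bounded_ae_lim aI IM.
have bI : aeT (fun t => nc (bd I t) = 1).
  by apply: aeTS I1 => t _ [w [w1 /bd_radial ->]].
have lW := ae_lim_Hz li.
exists l; split => //.
- apply: aeTS3 (aeT_and lI bI) lW (Re_bd_Hz li lW) => t _ [a a1] b b1.
  have r : radial_limit F t (bd I t * (c * expC (bd (Hz l) t))).
    apply: radial_limit_ext (fun z zd => esym (FI z zd)) _; apply: radial_limitM a _; apply: radial_limitM.
      exact: radial_limit_cst.
    exact: radial_limit_expC.
  have n1 : nc (bd I t * (c * expC (bd (Hz l) t))) = expR (l t).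
    by rewrite !ncM a1 c1 !mul1r nc_expC b1.
  rewrite (bval_radial_limit r) /logabs -nc_eq0 n1 gt_eqF ?expR_gt0//.
  by rewrite -[Normc.normc _]/(nc _) n1 expRK.
- exact: bd_meas.
- by apply: aeT_and => //; exact: ae_bval.
have := @outer_value_pairing _ psi ipsi l c I M 0 li c1 aI IM FI (lexx 0).
have h1 : aeT (fun t => nc (bd I t) <= 1) by apply: aeTS bI => t _ ->.
have h2 : aeT (fun t => (1 - nc (bd I t) ^+ 2) * expR (l t) <= 0).
  by apply: aeTS bI => t _ ->; rewrite expr1n subrr mul0r.
move=> /(_ h1 h2) h.
have /eqP : nc (cavg (fun t => psi t * (bd I t)^*) - c * expC (Hz l 0)) = 0.
  by apply/eqP; rewrite eq_le h nc_ge0.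
rewrite nc_eq0 subr_eq0 => /eqP ->.
(* The normalization [0 < Phi 0] replaces [Phi 0] by its modulus [exp (avg l)]; without it the sign
   condition on [psi] would carry a unimodular constant. *)
have P0 : Phi 0 = c * expC (Hz l 0) by rewrite PhiE//; exact: disc0.
rewrite -P0; move: Phi0; rewrite lt_def => /andP[_ p0].
have : `|Phi 0| = Phi 0 by exact: ger0_norm.
by rewrite normCE P0 ncM c1 mul1r nc_expC Hz0 /= => <-.
Qed.

(** In the order of [R[i]], [0 <= w] forces [w] to be real. Expressing this by the vanishing of a
    quantity that is always nonnegative makes [avg_eq0_ae] applicable. *)
Lemma ge0_ncP w : (0 <= w) = (nc w - Re w == 0).
Proof.
rewrite lecE /= subr_eq0; apply/andP/eqP => [[/eqP i0 r0]|h].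
  by rewrite ncE i0 expr0n addr0 sqrtr_sqr ger0_norm.
split; last by rewrite -h nc_ge0.
have := nc_sqr w; rewrite h => /eqP; rewrite -subr_eq0 opprD addrA subrr sub0r oppr_eq0.
by rewrite sqrf_eq0.
Qed.

End LogMean.

Lemma log_mean_le (R : realType) (psi : R -> R[i]) : cint psi ->
  (expeR (((2 * pi)^-1)%:E *
     \int[@lebesgue_measure R]_(t in @Tdom R) logabs (bval (Pplus psi) t))
     <= (avg (fun t => nc (psi t)))%:E)%E.
Proof.
move=> ipsi; apply/lee_addgt0Pr => e e0.
pose e' := Num.min e 1; have e'0 : 0 < e' by rewrite lt_min e0 ltr01.
have e'1 : e' <= 1 by rewrite ge_min lexx orbT.
have [l [li lb le]] := log_mean_approx ipsi e'0 e'1.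
apply: (@le_trans _ _ (expeR (avg l)%:E)).
  rewrite lee_expeR -avgE_ereal//; apply: lee_wpmul2l.
    by rewrite lee_fin invr_ge0 ltW// twopi_gt0.
  apply: le_integral_ae; apply: aeTS2 lb (ae_bval (ae_lim_Pplus ipsi)) => t _ h ->.
  exact: h.
by rewrite /= -EFinD lee_fin (le_trans le)// lerD2l ge_min lexx.
Qed.

Theorem theorem1 (R : realType) (psi : R -> R[i]) (hpsi : L1T psi) :
  (expeR (((2 * pi)^-1)%:E *
     \int[@lebesgue_measure R]_(t in @Tdom R) logabs (bval (Pplus psi) t))
     <= (L1norm psi)%:E)%E /\
  (~ {ae @lebesgue_measure R, forall t, @Tdom R t -> psi t = 0} ->
   forall I Phi : R[i] -> R[i],
     inner I -> outer Phi -> 0 < Phi 0 ->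
     (forall z, disc z -> Pplus psi z = I z * Phi z) ->
     ((expeR (((2 * pi)^-1)%:E *
        \int[@lebesgue_measure R]_(t in @Tdom R) logabs (bval (Pplus psi) t))
        = (L1norm psi)%:E)%E
      <-> {ae @lebesgue_measure R, forall t, @Tdom R t ->
             0 <= (bval I t)^* * psi t})).
Proof.
have ipsi : cint psi by [].
split; first exact: log_mean_le.
move=> _ I Phi hI hPhi Phi0 FI.
have [l [li Fl mI bI cI]] := inner_outer_pairing ipsi hI hPhi Phi0 FI.
rewrite (eq_integral_ae Fl) avgE_ereal//= -[L1norm psi]/(avg (fun t => nc (psi t))).
pose X t := psi t * conjc (bd I t).
have mX : cmeas X by apply: cmeasM; [exact: cint_meas|exact: cmeasJ].
have nX : aeT (fun t => nc (X t) = nc (psi t)).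
  by apply: aeTS bI => t _ [_ h]; rewrite ncM ncJ h mulr1.
have iX : cint X.
  by apply: (cint_le_ae mX (cint_nc ipsi)); apply: aeTS nX => t _ ->.
(* Since [cavg X] is the geometric mean itself, the defect in the inequality is the average of the
   nonnegative function [|X| - Re X]. *)
have aX : avg (fun t => nc (psi t)) - expR (avg l) = avg (fun t => nc (X t) - complex.Re (X t)).
  have [rX _] := iX; rewrite avgB//; last exact: cint_nc.
  rewrite -Re_cavg cI /=; congr (_ - _); apply: ae_eq_avg.
  - by apply: cmeas_nc; exact: cint_meas.
  - exact: cmeas_nc.
  - by apply: aeTS nX => t _ ->.
have iD : intT (fun t => nc (X t) - complex.Re (X t)).
  by have [rX _] := iX; apply: intTB; first exact: cint_nc.
have X0 : aeT (fun t => 0 <= X t) <-> aeT (fun t => nc (X t) - complex.Re (X t) = 0).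
  by split; apply: aeTS => t _; rewrite ge0_ncP => /eqP.
have bX : aeT (fun t => (bval I t)^* * psi t = X t).
  by apply: aeTS bI => t _ [-> _]; rewrite mulrC.
have X0' : aeT (fun t => 0 <= X t) <-> aeT (fun t => 0 <= (bval I t)^* * psi t).
  by split; apply: aeTS2 bX => t _ ->.
rewrite -[Y in _ <-> Y]/(aeT (fun t => 0 <= (bval I t)^* * psi t)).
split=> [[e]|/X0'/X0 h].
  apply/X0'/X0; apply: avg_eq0_ae => //; last by rewrite -aX e subrr.
  by apply: aeTW => t _; rewrite subr_ge0 (le_trans (ler_norm _) (normr_Re_le _)).
congr (_%:E); apply/esym/eqP; rewrite -subr_eq0 aX; apply/eqP.
by rewrite -(avg_cst 0); apply: ae_eq_avg => //; exact: intT_measurable.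
Qed.
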